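(* Let $G$ be any (smooth) positive-definite risk metric on the open simplex $\Delta^{n-1}$, let $A,B\in\Delta^{n-1}$, and let $\gamma^\star$ be a risk-length-minimising geodesic of $G$ from $A$ to $B$. Then for every admissible reallocation $\gamma$ from $A$ to $B$, $$\mathcal{R}[\gamma^\star]\le\mathcal{R}[\gamma].$$ In particular, when $B$ is the Markowitz target, writing $p_2=\gamma^\star$, $p_0$ for the straight line from $A$ to $B$ and $p_1$ for the projected gradient-flow path from $A$ to $B$ (assumed to be an admissible path, i.e. to stay in $\Delta^{n-1}$), $$\mathcal{R}[p_2]\le\mathcal{R}[p_0]\qquad\text{and}\qquad \mathcal{R}[p_2]\le\mathcal{R}[p_1],$$ so the transition-risk saving of the geodesic over both direct and myopic rebalancing is always non-negative. Moreover, the improvement is strictly positive, i.e. $\mathcal{R}[\gamma^\star]<\mathcal{R}[\gamma]$, whenever the competing path $\gamma$ is not itself (up to reparametrisation) a geodesic of $G$.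
   Context: The space of portfolios is the open probability simplex $\Delta^{n-1}=\{w\in\mathbb{R}^n: w_i>0 \text{ for all } i,\ \sum_{i=1}^n w_i=1\}$, a smooth $(n-1)$-manifold with tangent space $\{v\in\mathbb{R}^n:\sum_i v_i=0\}$ at each point. A risk metric is a smooth map $w\mapsto G(w)$ from $\Delta^{n-1}$ into symmetric positive-definite $n\times n$ matrices; restricting $v\mapsto v^{\mathsf T}G(w)v$ to the tangent spaces makes $\Delta^{n-1}$ a Riemannian manifold. ''Geodesic of $G$'' means geodesic of this Riemannian manifold. An admissible reallocation from $A$ to $B$ is a (piecewise $C^1$) curve $\gamma:[0,1]\to\Delta^{n-1}$ with $\gamma(0)=A$, $\gamma(1)=B$. Its transition risk is the Riemannian length $\mathcal{R}[\gamma]=\int_0^1\sqrt{\dot\gamma(t)^{\mathsf T}G(\gamma(t))\dot\gamma(t)}\,dt$, which is invariant under reparametrisation. A risk-length-minimising geodesic $\gamma^\star$ from $A$ to $B$ is a minimiser of $\mathcal{R}$ over all admissible reallocations from $A$ to $B$. Let $\mu\in\mathbb{R}^n$ (expected returns), $\Sigma\in\mathbb{R}^{n\times n}$ symmetric positive-definite (return covariance), and $\lambda>0$ (risk aversion), and write $\mathbf 1$ for the all-ones vector. The Markowitz target is the maximiser $B$ of $f(w)=\mu^{\mathsf T}w-\lambda w^{\mathsf T}\Sigma w$ over the hyperplane $\{w\in\mathbb{R}^n:\mathbf 1^{\mathsf T}w=1\}$; it is assumed to lie in $\Delta^{n-1}$. The straight line (direct rebalancing) is $p_0(t)=(1-t)A+tB$,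 $t\in[0,1]$. The projected gradient-flow path (myopic rebalancing) $p_1$ is the solution $w(t)$, $t\in[0,\infty)$, of $\dot w=P(\mu-2\lambda\Sigma w)$, $w(0)=A$, where $P=I-\tfrac1n\mathbf 1\mathbf 1^{\mathsf T}$; it conserves $\mathbf 1^{\mathsf T}w=1$ and converges to $B$ as $t\to\infty$. It is regarded as a path from $A$ to $B$ with transition risk $\mathcal{R}[p_1]=\int_0^\infty\sqrt{\dot w(t)^{\mathsf T}G(w(t))\dot w(t)}\,dt$. *)

(* Defs.v *)
(* MathComp-Analysis. *)
From HB Require Import structures.
From mathcomp Require Import all_boot all_order all_algebra.
From mathcomp Require Import all_classical all_reals all_analysis.

Set Implicit Arguments.
Unset Strict Implicit.
Unset Printing Implicit Defensive.

Import Order.TTheory GRing.Theory Num.Theory.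
Import numFieldNormedType.Exports.

Local Open Scope classical_set_scope.
Local Open Scope ring_scope.

(** Portfolios have [m.+1] assets, so [m] is the dimension of the simplex.
    Maps on the simplex, and curves, are total functions of which only the
    values on the simplex, resp. on the parameter interval, are relevant. *)

Section Simplex.
Context {R : realType} {m : nat}.

Definition simplex : set 'cV[R]_m.+1 :=
  [set w | (forall i, 0 < w i 0) /\ \sum_i w i 0 = 1].

Definition tangent : set 'cV[R]_m.+1 := [set v | \sum_i v i 0 = 0].

(** Only derivatives along tangent vectors occur: for [w] in the simplex and
    [v] tangent, ['D_v F w] depends only on the restriction of [F] to the
    simplex. *)
Fixpoint Ck_simplex (k : nat) (F : 'cV[R]_m.+1 -> 'M[R]_m.+1) : Prop :=
  {within simplex, continuous F} /\
  match k with
  | 0 => True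
  | k'.+1 => forall v, tangent v ->
      (forall w, simplex w -> derivable F w v) /\
      Ck_simplex k' (fun w => 'D_v F w)
  end.

Definition smooth_simplex (F : 'cV[R]_m.+1 -> 'M[R]_m.+1) : Prop :=
  forall k, Ck_simplex k F.

Definition qform (M : 'M[R]_m.+1) (v : 'cV[R]_m.+1) : R :=
  (v^T *m M *m v) 0 0.

Definition sympd (M : 'M[R]_m.+1) : Prop :=
  M^T = M /\ forall v, v != 0 -> 0 < qform M v.

Definition risk_metric (G : 'cV[R]_m.+1 -> 'M[R]_m.+1) : Prop :=
  smooth_simplex G /\ forall w, simplex w -> sympd (G w).

End Simplex.

Section Curves.
Context {R : realType} {V : normedModType R}.
Implicit Types (D : set R) (f g : R -> V).

(** [f] is C^1 on the interval [D] with derivative [g]: at an endpoint of [D]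
    lying in [D], continuity of [g] makes [g] the one-sided derivative of
    [f]. *)
Definition C1_deriv D f g : Prop :=
  [/\ {within D, continuous f}, {within D, continuous g} &
      forall t : R, D° t -> is_derive t 1 f (g t)].

Definition C1_on D f : Prop := exists g, C1_deriv D f g.

Definition piecewise_C1 (a b : R) f : Prop :=
  {within `[a, b], continuous f} /\
  exists s : seq R, itv_partition a b s /\
    forall i, (i < size s)%N -> C1_on `[nth b (a :: s) i, nth b s i] f.

End Curves.

Section Risk.
Context {R : realType} {m : nat}.
Implicit Types (G : 'cV[R]_m.+1 -> 'M[R]_m.+1) (A B : 'cV[R]_m.+1).
Implicit Types (c : R -> 'cV[R]_m.+1).

(** At the finitely many corners of a piecewise C^1 curve, and at the endpoints
    of [D], [derive1 c] need not be a derivative; these points are negligible. *)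
Definition risk_on G (D : set R) c : \bar R :=
  (\int[lebesgue_measure]_(t in D) (Num.sqrt (qform (G (c t)) (derive1 c t)))%:E)%E.

Definition risk G c : \bar R := risk_on G `[0, 1] c.

Definition risk_infty G c : \bar R := risk_on G `[0, +oo[ c.

Definition admissible A B c : Prop :=
  [/\ piecewise_C1 0 1 c, forall t : R, t \in `[0, 1] -> simplex (c t),
      c 0 = A & c 1 = B].

Definition minimising_geodesic G A B c : Prop :=
  admissible A B c /\
  forall d, admissible A B d -> (risk G c <= risk G d)%E.

(** The global chart of the simplex given by the first [m] weights; its [j]-th
    coordinate vector field is the constant field [e_j - e_last]. *)
Definition chart_coord (w : 'cV[R]_m.+1) (j : 'I_m) : R := w (lift ord_max j) 0.

Definition chart_frame (j : 'I_m) : 'cV[R]_m.+1 :=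
  delta_mx (lift ord_max j) 0 - delta_mx ord_max 0.

Definition chart_metric G (w : 'cV[R]_m.+1) : 'M[R]_m :=
  \matrix_(i, j) ((chart_frame i)^T *m G w *m chart_frame j) 0 0.

Definition d_metric G (l i j : 'I_m) (w : 'cV[R]_m.+1) : R :=
  'D_(chart_frame l) (fun x => chart_metric G x i j) w.

(** Christoffel symbol [Gamma^k_{ij}] of the Levi-Civita connection. *)
Definition christoffel G (k i j : 'I_m) (w : 'cV[R]_m.+1) : R :=
  2^-1 * \sum_l invmx (chart_metric G w) k l *
    (d_metric G i j l w + d_metric G j i l w - d_metric G l i j w).

(** Geodesics parametrised by [0, 1] (affinely, possibly constant), with
    velocity [v] and coordinatewise second derivative [a]. *)
Definition geodesic G c : Prop :=
  (forall t : R, t \in `[0, 1] -> simplex (c t)) /\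
  exists v a : R -> 'cV[R]_m.+1,
  [/\ C1_deriv `[0, 1] c v, C1_deriv `[0, 1] v a &
      forall t : R, t \in `[0, 1] -> forall k,
        chart_coord (a t) k +
        \sum_i \sum_j christoffel G k i j (c t) *
          chart_coord (v t) i * chart_coord (v t) j = 0].

(** Reparametrisations are nondecreasing, not necessarily injective: a path
    that pauses along a geodesic has the same risk as that geodesic. *)
Definition geodesic_up_to_reparam G c : Prop :=
  exists (d : R -> 'cV[R]_m.+1) (phi : R -> R),
  [/\ geodesic G d, piecewise_C1 0 1 phi,
      {in `[0, 1] &, {homo phi : s t / s <= t}},
      phi 0 = 0 /\ phi 1 = 1 &
      forall t : R, t \in `[0, 1] -> c t = d (phi t)].

Definition geodesic_up_to_reparam_infty G c : Prop :=
  exists (d : R -> 'cV[R]_m.+1) (phi : R -> R),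
  [/\ geodesic G d, C1_on `[0, +oo[ phi,
      {in `[0, +oo[ &, {homo phi : s t / s <= t}},
      phi 0 = 0 /\ phi t @[t --> +oo] --> (1 : R) &
      forall t : R, 0 <= t -> c t = d (phi t)].

End Risk.

Section Markowitz.
Context {R : realType} {m : nat}.
Implicit Types (A B mu w : 'cV[R]_m.+1) (Sigma : 'M[R]_m.+1).

Definition ones : 'cV[R]_m.+1 := const_mx 1.

Definition markowitz_objective mu Sigma (lambda : R) w : R :=
  (mu^T *m w) 0 0 - lambda * qform Sigma w.

Definition markowitz_target mu Sigma (lambda : R) B : Prop :=
  (ones^T *m B) 0 0 = 1 /\
  forall w, (ones^T *m w) 0 0 = 1 ->
    markowitz_objective mu Sigma lambda w <= markowitz_objective mu Sigma lambda B.

Definition straight_line A B (t : R) : 'cV[R]_m.+1 := (1 - t) *: A + t *: B.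

Definition centering : 'M[R]_m.+1 :=
  1%:M - m.+1%:R^-1 *: (ones *m ones^T).

Definition gradient_flow mu Sigma (lambda : R) A (w : R -> 'cV[R]_m.+1) : Prop :=
  w 0 = A /\
  C1_deriv `[0, +oo[ w
    (fun t => centering *m (mu - (2 * lambda) *: (Sigma *m w t))).

End Markowitz.

(* Main.v *)
(* A minimiser of the length is a geodesic after reparametrisation, so a path
   that is not one has larger risk than p2. Let c be a minimiser, made C^1 by
   pausing at its corners, with speed s (zeros allowed) and momentum q = G c'.
   Since sqrt X <= (X / s + s) / 2 with equality along c, perturbing c by e y,
   with y' bounded by a multiple of s, turns minimality into stationarity of an
   integral of energies; the perturbation y' = q - s (P + C), where P is a
   primitive of the force and C makes y vanish at both ends, yields
   int |y'|^2 / s <= 0, hence q = s (P + C). So c' is s times a continuous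
   function of (c, P), which allows dividing c by arc length; the quotient curve
   has C^1 momentum P + C and satisfies the geodesic equation.
   The gradient flow converges fast enough to be a C^1 admissible curve on [0, 1]
   in the parameter t / (1 + t), with the same risk. *)
Require Import Defs.
From HB Require Import structures.
From mathcomp Require Import all_boot all_order all_algebra.
From mathcomp Require Import all_classical all_reals all_analysis.
From mathcomp Require Import measurable_realfun ring lra.
Import Order.TTheory GRing.Theory Num.Theory.
Import numFieldNormedType.Exports.
Local Open Scope classical_set_scope.
Local Open Scope ring_scope.

Set Implicit Arguments.
Unset Strict Implicit.
Unset Printing Implicit Defensive.

(** * Continuity and C^1 functions on subsets *)

(** The obstacle is regularity. The momentum of a minimiser is not known to be differentiable, and
    its velocity may vanish on a large set, where the length has no first variation along arbitrary
    fields. Hence the equation is sought in integrated form, and bounds by multiples of the speed or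
    of its square are carried along with every quantity: under [x / 0 = 0], something bounded by the
    squared speed can be divided by the speed and stays continuous. For the same reason arc length
    need not be injective and may have no continuous inverse. Functions whose derivative is bounded
    by a multiple of the speed nevertheless factor through it, and so do the coordinates of the
    curve and the primitive of the force. All computations take place in the global chart given by
    the first [m] weights, where curves, velocities and covectors become families of scalar
    functions. Since a risk metric is differentiable along tangent directions of the simplex, the
    chain rule is built from partial derivatives along the coordinate frame. *)

Lemma cvg_bigsum (R : realType) (T I : Type) (F : set_system T) (r : seq I)
    (f : I -> T -> R) (l : I -> R) : Filter F ->
  (forall i, f i x @[x --> F] --> l i) ->
  \sum_(i <- r) f i x @[x --> F] --> \sum_(i <- r) l i.
Proof.
move=> FF fl; elim: r => [|i r IH].
  under eq_fun do rewrite big_nil.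
  by rewrite big_nil; exact: cvg_cst.
under eq_fun do rewrite big_cons.
by rewrite big_cons; exact: cvgD.
Qed.

Lemma within_cvgP (T S : topologicalType) (A : set T) (f : T -> S) :
  {within A, continuous f} <->
  forall x, A x -> f y @[y --> within A (nbhs x)] --> f x.
Proof. exact: subspace_continuousP. Qed.

Section WithinContinuity.
Context {T : topologicalType} {R : realType} (A : set T).
Implicit Types f g : T -> R.

Lemma within_continuous_cst (k : R) : {within A, continuous (fun=> k)}.
Proof. by move=> x; exact: cvg_cst. Qed.

Lemma within_continuous_add f g : {within A, continuous f} ->
  {within A, continuous g} -> {within A, continuous (fun x => f x + g x)}.
Proof. by move=> cf cg x; apply: cvgD; [exact: cf|exact: cg]. Qed.

Lemma within_continuous_sub f g : {within A, continuous f} ->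
  {within A, continuous g} -> {within A, continuous (fun x => f x - g x)}.
Proof. by move=> cf cg x; apply: cvgB; [exact: cf|exact: cg]. Qed.

Lemma within_continuousM f g : {within A, continuous f} ->
  {within A, continuous g} -> {within A, continuous (fun x => f x * g x)}.
Proof. by move=> cf cg x; apply: cvgM; [exact: cf|exact: cg]. Qed.

Lemma within_continuous_sum (I : Type) (r : seq I) (P : pred I)
    (F : I -> T -> R) : (forall i, {within A, continuous (F i)}) ->
  {within A, continuous (fun x => \sum_(i <- r | P i) F i x)}.
Proof.
move=> cF; elim: r => [|i r IH].
  under [X in continuous X]eq_fun do rewrite big_nil.
  exact: within_continuous_cst.
under [X in continuous X]eq_fun do rewrite big_cons.
by case: (P i) => //; exact: within_continuous_add.
Qed.

Lemma within_continuous_prod (I : Type) (r : seq I) (P : pred I)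
    (F : I -> T -> R) : (forall i, {within A, continuous (F i)}) ->
  {within A, continuous (fun x => \prod_(i <- r | P i) F i x)}.
Proof.
move=> cF; elim: r => [|i r IH].
  under [X in continuous X]eq_fun do rewrite big_nil.
  exact: within_continuous_cst.
under [X in continuous X]eq_fun do rewrite big_cons.
by case: (P i) => //; exact: within_continuousM.
Qed.

Lemma within_continuousV f : {within A, continuous f} ->
  (forall x, A x -> f x != 0) -> {within A, continuous (fun x => (f x)^-1)}.
Proof.
move=> cf f0; apply/within_cvgP => x Ax.
by apply: cvgV; [exact: f0|move/within_cvgP: cf; exact].
Qed.

Lemma within_continuous_comp (S : topologicalType) (B : set S) (h : S -> T)
    (f : T -> R) :
  {within B, continuous h} -> (forall s, B s -> A (h s)) ->
  {within A, continuous f} -> {within B, continuous (fun s => f (h s))}.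
Proof.
move=> /within_cvgP ch BA /within_cvgP cf.
apply/within_cvgP => s Bs; apply: cvg_trans (cf _ (BA _ Bs)).
move=> U /= fU; have := ch _ Bs _ fU; rewrite /= !nbhs_simpl /= => hU.
rewrite /within /= in hU *.
near=> u; move=> Bu; have : B u -> A (h u) -> U (f (h u)) by near: u; exact: hU.
by apply; [exact: Bu|exact: BA].
Unshelve. all: by end_near. Qed.

Lemma within_continuous_post f (k : R -> R) : {within A, continuous f} ->
  continuous k -> {within A, continuous (fun x => k (f x))}.
Proof. by move=> cf ck x; apply: (cvg_comp _ _ (cf x)); exact: ck. Qed.

Lemma eq_within_continuous (S : topologicalType) (f g : T -> S) :
  (forall x, A x -> f x = g x) ->
  {within A, continuous f} -> {within A, continuous g}.
Proof.
by move=> fg; apply: subspace_eq_continuous => x /set_mem; exact: fg.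
Qed.

End WithinContinuity.

Lemma is_derive_bigsum (R : realType) (V : normedModType R) (t v : V)
    (I : Type) (r : seq I) (F : I -> V -> R) (dF : I -> R) :
  (forall i, is_derive t v (F i) (dF i)) ->
  is_derive t v (fun s => \sum_(i <- r) F i s) (\sum_(i <- r) dF i).
Proof.
move=> hF; elim: r => [|i r IH].
  under [X in is_derive _ _ X _]eq_fun do rewrite big_nil.
  by rewrite big_nil; exact: is_derive_cst.
under [X in is_derive _ _ X _]eq_fun do rewrite big_cons.
by rewrite big_cons; exact: is_deriveD.
Qed.

Lemma is_derive_mul (R : realType) (V : normedModType R) (t v : V)
    (f g : V -> R) (df dg : R) :
  is_derive t v f df -> is_derive t v g dg ->
  is_derive t v (fun s => f s * g s) (df * g t + f t * dg).
Proof.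
move=> hf hg; apply: (is_derive_eq (is_deriveM hf hg)).
by rewrite addrC [g t *: df]mulrC.
Qed.

(** * Scalar C^1 functions and their primitives on intervals *)

Section Calculus.
Context {R : realType}.
Implicit Types (f g : R -> R) (a b : R).
Local Notation mu := (@lebesgue_measure R).

Lemma C1_deriv_derive a b f g (t : R) : C1_deriv `[a, b] f g -> a < t < b ->
  is_derive t (1 : R) f (g t).
Proof. by case=> _ _; rewrite interior_itv => + tab; apply;
  rewrite /= in_itv. Qed.

Lemma mkC1_deriv a b f g : {within `[a, b], continuous f} ->
  {within `[a, b], continuous g} ->
  (forall t : R, a < t < b -> is_derive t (1 : R) f (g t)) ->
  C1_deriv `[a, b] f g.
Proof.
move=> cf cg fg; split=> // t; rewrite interior_itv /= in_itv /= => tab.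
exact: fg.
Qed.

(** The integral over [[a, t]], hence 0 for [t < a]: a primitive only to the right of [a]. *)
Definition prim a f (t : R) : R := parameterized_integral mu a t f.

Lemma prim_left a f : prim a f a = 0.
Proof. by rewrite /prim /parameterized_integral set_itv1 Rintegral_set1. Qed.

Lemma continuous_integrable a b f : {within `[a, b], continuous f} ->
  mu.-integrable `[a, b] (EFin \o f).
Proof. by move=> cf; apply: continuous_compact_integrable => //;
  exact: segment_compact. Qed.

Lemma C1_deriv_prim a b f : a <= b -> {within `[a, b], continuous f} ->
  C1_deriv `[a, b] (prim a f) f.
Proof.
move=> ab cf; have fi := continuous_integrable cf.
apply: mkC1_deriv => //; first exact: parameterized_integral_continuous.
move=> t /andP[at_ tb].
have ft : {for t, continuous f}.
  apply: (within_continuous_continuous (lt_trans at_ tb) cf).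
  by rewrite in_itv /= at_.
have [dF Fe] := @continuous_FTC1_closed R f a t b tb fi at_ ft.
by rewrite derive1E in Fe; exact: (DeriveDef dF Fe).
Qed.

Lemma C1_derivD D f1 g1 f2 g2 : C1_deriv D f1 g1 -> C1_deriv D f2 g2 ->
  C1_deriv D (fun t => f1 t + f2 t) (fun t => g1 t + g2 t).
Proof.
move=> [c1 d1 e1] [c2 d2 e2]; split; [exact: within_continuous_add..|].
by move=> t Dt; apply: is_deriveD; [exact: e1|exact: e2].
Qed.

Lemma C1_derivB D f1 g1 f2 g2 : C1_deriv D f1 g1 -> C1_deriv D f2 g2 ->
  C1_deriv D (fun t => f1 t - f2 t) (fun t => g1 t - g2 t).
Proof.
move=> [c1 d1 e1] [c2 d2 e2]; split; [exact: within_continuous_sub..|].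
by move=> t Dt; apply: is_deriveB; [exact: e1|exact: e2].
Qed.

Lemma C1_derivM D f1 g1 f2 g2 : C1_deriv D f1 g1 -> C1_deriv D f2 g2 ->
  C1_deriv D (fun t => f1 t * f2 t) (fun t => f1 t * g2 t + f2 t * g1 t).
Proof.
move=> [c1 d1 e1] [c2 d2 e2]; split; first exact: within_continuousM.
  by apply: within_continuous_add; exact: within_continuousM.
by move=> t Dt; apply: is_deriveM; [exact: e1|exact: e2].
Qed.

Lemma C1_deriv_cst D (k : R) : C1_deriv D (fun=> k) (fun=> 0 : R).
Proof.
split; [exact: within_continuous_cst..|] => t _; exact: is_derive_cst.
Qed.

Lemma C1_derivZ D (k : R) f g : C1_deriv D f g ->
  C1_deriv D (fun t => k * f t) (fun t => k * g t).
Proof.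
move=> [cf cg fg]; split.
- by apply: within_continuousM => //; exact: within_continuous_cst.
- by apply: within_continuousM => //; exact: within_continuous_cst.
- by move=> t Dt; apply: is_deriveZ; exact: fg.
Qed.

Lemma C1_deriv_sum D (I : Type) (r : seq I) (F G : I -> R -> R) :
  (forall i, C1_deriv D (F i) (G i)) ->
  C1_deriv D (fun t => \sum_(i <- r) F i t) (fun t => \sum_(i <- r) G i t).
Proof.
move=> FG; elim: r => [|i r IH].
  under [X in C1_deriv _ X _]eq_fun do rewrite big_nil.
  under [X in C1_deriv _ _ X]eq_fun do rewrite big_nil.
  exact: C1_deriv_cst.
under [X in C1_deriv _ X _]eq_fun do rewrite big_cons.
under [X in C1_deriv _ _ X]eq_fun do rewrite big_cons.
exact: C1_derivD.
Qed.

(** At an interior point [D] is a neighbourhood, so values outside [D] never enter. This allows a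
    curve to be replaced by a formula valid on [D] only. *)
Lemma eq_C1_deriv (V : normedModType R) (D : set R) (f f' g g' : R -> V) :
  (forall t, D t -> f t = f' t) -> (forall t, D t -> g t = g' t) ->
  C1_deriv D f g -> C1_deriv D f' g'.
Proof.
move=> ff' gg' [cf cg fg]; split; [exact: eq_within_continuous cf|
  exact: eq_within_continuous cg|] => t Dt.
rewrite -gg'; last exact: interior_subset.
apply: near_eq_is_derive (fg _ Dt).
by near=> u; apply: ff'; near: u; exact: Dt.
Unshelve. all: by end_near. Qed.

Lemma C1_derivW (V : normedModType R) (D E : set R) (f g : R -> V) :
  D `<=` E -> C1_deriv E f g -> C1_deriv D f g.
Proof.
move=> DE [cf cg fg]; split; [exact: continuous_subspaceW cf|
  exact: continuous_subspaceW cg|].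
by move=> t Dt; apply: fg; move: Dt; exact: interiorS.
Qed.

Lemma C1_deriv_ndecr a b f g : C1_deriv `[a, b] f g ->
  (forall t, a < t < b -> 0 <= g t) ->
  forall s t, a <= s -> s <= t -> t <= b -> f s <= f t.
Proof.
move=> fg g0; have [cf _ _] := fg.
apply: ger0_derive1_ndecr => // t; rewrite in_itv /= => tab.
  exact: (@ex_derive _ _ _ _ _ _ _ (C1_deriv_derive fg tab)).
rewrite derive1E (@derive_val _ _ _ _ _ _ _ (C1_deriv_derive fg tab)).
exact: g0.
Qed.

Lemma C1_deriv_lt a b f g : C1_deriv `[a, b] f g ->
  (forall t, a < t < b -> 0 < g t) ->
  forall s t, a <= s -> s < t -> t <= b -> f s < f t.
Proof.
move=> fg g0; have [cf _ _] := fg; move=> s t as_ st tb.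
apply: (@gtr0_derive1_lt_cc R f a b) => //; rewrite ?in_itv /=.
- move=> u; rewrite in_itv /= => uab.
  exact: (@ex_derive _ _ _ _ _ _ _ (C1_deriv_derive fg uab)).
- move=> u; rewrite in_itv /= => uab.
  rewrite derive1E (@derive_val _ _ _ _ _ _ _ (C1_deriv_derive fg uab)).
  exact: g0.
- by rewrite as_ (le_trans (ltW st)).
- by rewrite tb (le_trans as_)// ltW.
Qed.

Lemma C1_deriv_const a b f g : C1_deriv `[a, b] f g ->
  (forall t, a < t < b -> g t = 0) ->
  forall s t, a <= s <= b -> a <= t <= b -> f s = f t.
Proof.
move=> fg g0 s t.
wlog st : s t / s <= t.
  move=> H ss tt; have [st|ts] := leP s t; first exact: H.
  by apply/esym; apply: H => //; exact: ltW.
move=> /andP[as_ _] /andP[_ tb]; apply/eqP; rewrite eq_le.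
rewrite (C1_deriv_ndecr fg)//=; last by move=> u /g0 ->.
rewrite -lerN2.
have := C1_derivZ (-1) fg => /C1_deriv_ndecr /(_ _ s t).
rewrite !mulN1r; apply => // u /g0 ->; by rewrite mulr0.
Qed.

Lemma prim_FTC a b F f : a <= b -> C1_deriv `[a, b] F f ->
  prim a f b = F b - F a.
Proof.
move=> ab Ff; have [_ cf _] := Ff.
have := C1_derivB Ff (C1_deriv_prim ab cf) => /C1_deriv_const H.
have := H _ a b; rewrite prim_left !lexx ab subr0 => -> //; first by ring.
by move=> t _; rewrite subrr.
Qed.

Lemma prim_integral a b f : {within `[a, b], continuous f} ->
  (\int[mu]_(t in `[a, b]) (f t)%:E = (prim a f b)%:E)%E.
Proof.
move=> cf; rewrite /prim /parameterized_integral /Rintegral fineK//.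
by apply: integrable_fin_num => //; exact: continuous_integrable.
Qed.

(** The primitive is nondecreasing, starts at 0 and ends at a value at most 0, so it is constant and
    its derivative [f] vanishes. *)
Lemma prim_ge0_eq0 a b f : a < b -> {within `[a, b], continuous f} ->
  (forall t, a <= t <= b -> 0 <= f t) -> prim a f b <= 0 ->
  forall t, a < t < b -> f t = 0.
Proof.
move=> ab cf f0 I0; have Ff := C1_deriv_prim (ltW ab) cf.
have nd : forall s t, a <= s -> s <= t -> t <= b -> prim a f s <= prim a f t.
  apply: (C1_deriv_ndecr Ff) => t /andP[ta tb].
  by apply: f0; rewrite !ltW.
have prim0 t : a <= t <= b -> prim a f t = 0.
  move=> /andP[ta tb]; apply/eqP; rewrite eq_le (le_trans (nd _ _ _ _ _) I0)//.
  by rewrite -[leLHS](prim_left a f) nd.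
move=> t tab; have := C1_deriv_derive Ff tab.
move=> d1; have d2 : is_derive t (1:R) (prim a f) 0.
  have : is_derive t (1:R) (fun=> 0 : R) 0 by exact: is_derive_cst.
  apply: near_eq_is_derive.
  have : \near t, t \in `]a, b[ by apply: near_in_itvoo; rewrite in_itv.
  by apply: filterS => u /=; rewrite in_itv /= => /andP[ua ub];
    rewrite prim0// !ltW.
by rewrite -(@derive_val _ _ _ _ _ _ _ d1) (@derive_val _ _ _ _ _ _ _ d2).
Qed.

End Calculus.

(** * The chart of the simplex *)

Section Ratio.
Context {T : topologicalType} {R : realType} (A : set T).

(** The quotient is bounded by [K] times the absolute value of [p], so at a zero of [p] its limit is
    0, the value given by [x / 0 = 0]. Divisions by the speed rest on this. *)
Lemma within_continuous_ratio (f p : T -> R) (K : R) :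
  {within A, continuous f} -> {within A, continuous p} ->
  (forall x, A x -> `|f x| <= K * p x ^+ 2) ->
  {within A, continuous (fun x => f x / p x)}.
Proof.
move=> /within_cvgP cf /within_cvgP cp fK.
apply/within_cvgP => x Ax; have [px0|px0] := eqVneq (p x) 0; last first.
  by apply: cvgM; [exact: cf|apply: cvgV => //; exact: cp].
rewrite px0 invr0 mulr0; apply/cvgr0Pnorm_lt => e e0.
have K1 : 0 < `|K| + 1 by rewrite ltr_wpDl.
have : \forall y \near within A (nbhs x), `|p y| < e / (`|K| + 1).
  by have := cp _ Ax; rewrite px0 => /cvgr0Pnorm_lt; apply; rewrite divr_gt0.
rewrite /prop_near1 /within /= !nbhs_simpl /=.
apply: filterS => y py Ay; have [py0|py0] := eqVneq (p y) 0.
  by rewrite py0 invr0 mulr0 normr0.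
rewrite normrM normfV ltr_pdivrMr ?normr_gt0// (le_lt_trans (fK _ Ay))//.
rewrite -real_normK ?num_real// expr2 mulrA ltr_pM2r ?normr_gt0//.
move: (py Ay); rewrite ltr_pdivlMr// => /(le_lt_trans _); apply.
rewrite mulrC ler_wpM2l ?normr_ge0// (le_trans (ler_norm _))//.
by rewrite lerDl.
Qed.

End Ratio.

(** * Entrywise limits and derivatives of matrix-valued maps *)

Section MatrixCoordinates.
Context {R : realType}.

Lemma is_derive_mxP (V : normedModType R) m n (M : V -> 'M[R]_(m, n)) (t v : V)
    (D : 'M[R]_(m, n)) :
  is_derive t v M D <->
  forall i j, is_derive t v (fun x => M x i j) (D i j).
Proof.
split=> [MD i j|MD].
  have /derivable_mxP dM : derivable M t v by exact: ex_derive.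
  have := derive_mx (@ex_derive _ _ _ _ _ _ _ MD).
  rewrite (@derive_val _ _ _ _ _ _ _ MD) => /matrixP /(_ i j); rewrite mxE => ->.
  exact/derivableP.
have dM : derivable M t v by apply/derivable_mxP => i j; exact: ex_derive.
apply: (is_derive_eq (derivableP dM)); rewrite derive_mx//.
by apply/matrixP => i j; rewrite mxE (@derive_val _ _ _ _ _ _ _ (MD i j)).
Qed.

Lemma cvg_mxP (T : Type) (F : set_system T) (FF : Filter F) m n
    (f : T -> 'M[R]_(m, n)) (l : 'M[R]_(m, n)) :
  f @ F --> l <-> forall i j, (fun x => f x i j) @ F --> l i j.
Proof.
split=> [fl i j|fl].
  exact: (@cvg_comp _ _ _ f (fun M : 'M[R]_(m, n) => M i j) _ _ _ fl
    (@coord_continuous _ _ _ i j l)).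
move=> U [P Pl PU]; rewrite /= !nbhs_simpl /=.
have : \forall x \near F, forall i j, P i j (f x i j) .
  apply: filter_forall => i; apply: filter_forall => j; exact: fl.
by apply: filterS => x Px; exact: PU.
Qed.

Lemma within_continuous_mxP (T : topologicalType) (A : set T) m n
    (f : T -> 'M[R]_(m, n)) :
  {within A, continuous f} <->
  forall i j, {within A, continuous (fun x => f x i j)}.
Proof.
split=> [cf i j x|cf x]; first by move/cvg_mxP: (cf x); exact.
by apply/cvg_mxP => i j; exact: cf.
Qed.

Lemma C1_deriv_mxP (D : set R) m n (f g : R -> 'M[R]_(m, n)) :
  C1_deriv D f g <->
  forall i j, C1_deriv D (fun t => f t i j) (fun t => g t i j).
Proof.
split=> [[cf cg fg] i j|fg].
  split; [by move/within_continuous_mxP: cf; exact|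
    by move/within_continuous_mxP: cg; exact|].
  by move=> t Dt; move/is_derive_mxP: (fg t Dt); exact.
split.
- by apply/within_continuous_mxP => i j; have [] := fg i j.
- by apply/within_continuous_mxP => i j; have [] := fg i j.
by move=> t Dt; apply/is_derive_mxP => i j; have [_ _] := fg i j; exact.
Qed.

Lemma is_derive_line (V : normedModType R) (f : V -> R) (w v : V) (t d : R) :
  is_derive (w + t *: v) v f d ->
  is_derive t (1 : R) (fun s => f (w + s *: v)) d.
Proof.
move=> fd.
have E : (fun h : R => h^-1 *: (((fun s => f (w + s *: v)) \o shift t) (h *: 1)
            - f (w + t *: v))) =
    (fun h : R => h^-1 *: ((f \o shift (w + t *: v)) (h *: v) - f (w + t *: v))).
  apply/funext => h /=; congr (_ *: (f _ - _)).
  by rewrite /shift /= [h *: 1]mulr1 scalerDl addrCA.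
apply: DeriveDef.
  by rewrite /derivable E; exact: (@ex_derive _ _ _ _ _ _ _ fd).
by rewrite /derive E; exact: (@derive_val _ _ _ _ _ _ _ fd).
Qed.

End MatrixCoordinates.

(** * Chart coordinates, the coordinate frame and tangent vectors *)

Section Chart.
Context {R : realType} {m : nat}.
Implicit Types (w v : 'cV[R]_m.+1) (u x : 'I_m -> R).
Local Notation frame := (@chart_frame R m).

(** Inverse of [chart_coord] on tangent vectors. *)
Definition frame_comb u : 'cV[R]_m.+1 := \sum_j u j *: frame j.

Lemma chart_coord_frame (i j : 'I_m) : chart_coord (frame j) i = (i == j)%:R.
Proof.
rewrite /chart_coord !mxE !eqxx !andbT (inj_eq lift_inj).
by rewrite [lift _ _ == ord_max]eq_sym (negbTE (neq_lift _ _)) subr0.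
Qed.

Lemma chart_coordD v w j : chart_coord (v + w) j = chart_coord v j +
  chart_coord w j.
Proof. by rewrite /chart_coord mxE. Qed.

Lemma chart_coordZ (k : R) v j : chart_coord (k *: v) j = k * chart_coord v j.
Proof. by rewrite /chart_coord mxE. Qed.

Lemma chart_coord_comb u i : chart_coord (frame_comb u) i = u i.
Proof.
have E j : (u j *: frame j) (lift ord_max i) 0 = u j * (i == j)%:R.
  by rewrite mxE -chart_coord_frame.
rewrite /chart_coord /frame_comb summxE (bigD1 i)//= big1 => [|j ji].
  by rewrite E eqxx mulr1 addr0.
by rewrite E eq_sym (negbTE ji) mulr0.
Qed.

Lemma frame_tangent j : tangent (frame j).
Proof.
rewrite /tangent /=; under eq_bigr do rewrite !mxE eqxx !andbT.
rewrite sumrB (bigD1 (lift ord_max j))//= eqxx big1 => [|i /negbTE ->//].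
rewrite (bigD1 ord_max)//= eqxx big1 => [|i /negbTE ->//].
by rewrite !addr0 subrr.
Qed.

Lemma comb_tangent u : tangent (frame_comb u).
Proof.
rewrite /tangent /= /frame_comb.
under eq_bigr do rewrite summxE.
rewrite exchange_big /= big1// => j _.
under eq_bigr do rewrite mxE.
by rewrite -mulr_sumr (frame_tangent j) mulr0.
Qed.

(** The last coordinate of a tangent vector is recovered from the others by the vanishing sum. *)
Lemma tangent_chart_inj v w : tangent (v - w) ->
  (forall j, chart_coord v j = chart_coord w j) -> v = w.
Proof.
move=> vw vwE; apply/eqP; rewrite -subr_eq0; apply/eqP/matrixP => i k.
rewrite ord1 [RHS]mxE.
have E j : (v - w) (lift ord_max j) 0 = 0.
  by have := vwE j; rewrite /chart_coord !mxE => ->; rewrite subrr.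
have [j ->|->] := unliftP ord_max i; first exact: E.
move: vw; rewrite /tangent /= (bigD1 ord_max)//= big1 ?addr0// => j jm.
by have [l ->|] := unliftP ord_max j; [exact: E|move=> jE; rewrite jE eqxx in jm].
Qed.

Lemma tangent_comb v : tangent v -> v = frame_comb (chart_coord v).
Proof.
move=> tv; apply: tangent_chart_inj => [|j]; last by rewrite chart_coord_comb.
rewrite /tangent /=; under eq_bigr do rewrite mxE [X in _ + X]mxE.
by rewrite sumrB (comb_tangent _) tv subrr.
Qed.

Lemma simplex_tangent v w : simplex v -> simplex w -> tangent (v - w).
Proof.
move=> [_ sv] [_ sw]; rewrite /tangent /=.
by under eq_bigr do rewrite mxE [X in _ + X]mxE; rewrite sumrB sv sw subrr.
Qed.

Lemma simplex_comb v w : simplex v -> simplex w ->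
  v = w + frame_comb (fun j => chart_coord v j - chart_coord w j).
Proof.
move=> sv sw; rewrite addrC; apply/eqP; rewrite -subr_eq; apply/eqP.
rewrite [LHS]tangent_comb; last exact: simplex_tangent.
congr frame_comb; apply/funext => j.
by rewrite /chart_coord !mxE.
Qed.

Lemma norm_frame_le1 j i : `|frame j i 0| <= 1.
Proof.
rewrite !mxE eqxx !andbT; have [->|_] := eqVneq i (lift ord_max j).
  by rewrite eq_sym (negbTE (neq_lift _ _)) subr0 normr1.
by rewrite sub0r normrN; case: eqP => _; rewrite ?normr1 ?normr0.
Qed.

Lemma norm_comb_le u (d : R) i : (forall j, `|u j| <= d) ->
  `|frame_comb u i 0| <= m%:R * d.
Proof.
move=> ud; rewrite /frame_comb summxE (le_trans (ler_norm_sum _ _ _))//.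
have -> : m%:R * d = \sum_(j < m) d by rewrite sumr_const card_ord mulr_natl.
apply: ler_sum => j _; rewrite mxE normrM -[leRHS]mulr1.
by rewrite ler_pM// norm_frame_le1.
Qed.

(** In a cube of the chart each weight moves by at most [m * d], so positivity survives for small
    [d], and the sum is unchanged because frame combinations are tangent. *)
Lemma simplex_near w (h : 'cV[R]_m.+1 -> R) (e : R) : simplex w ->
  {within simplex, continuous h} -> 0 < e ->
  \forall d \near 0^'+, forall u, (forall j, `|u j| <= d) ->
    simplex (w + frame_comb u) /\ `|h (w + frame_comb u) - h w| <= e.
Proof.
move=> sw /within_cvgP ch e0.
have : \forall y \near w, simplex y -> `|h y - h w| <= e.
  move/cvgrPdist_le: (ch _ sw) => /(_ _ e0).
  rewrite /prop_near1 /within /= !nbhs_simpl /=.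
  by apply: filterS => y + sy; rewrite distrC; apply.
move=> /nbhs_ballP[r /= r0 hr].
have small (k : R) : 0 < k -> \forall d \near 0^'+, m%:R * d < k.
  (* [m + 1] instead of [m], which is 0 when there is a single asset. *)
  move=> k0; near=> d; have -> : k = (m%:R + 1) * (k / (m%:R + 1)).
    by rewrite mulrC divfK// gt_eqF// ltr_wpDl.
  have m1 : 0 < m%:R + 1 :> R by rewrite ltr_wpDl.
  apply: (@lt_trans _ _ ((m%:R + 1) * d)).
    by rewrite ltr_pM2r ?ltrDl//; near: d; exact: nbhs_right_gt.
  by rewrite ltr_pM2l//; near: d; apply: nbhs_right_lt; rewrite divr_gt0.
near=> d => u ud.
have wu i : `|frame_comb u i 0| <= m%:R * d by exact: norm_comb_le.
have su : simplex (w + frame_comb u).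
  split=> [i|].
    have wid : m%:R * d < w i 0.
      by move: i; near: d; apply: filter_forall => k; apply: small; exact: sw.1.
    by have := wu i; rewrite ler_norml mxE => /andP[lo _]; lra.
  under eq_bigr do rewrite mxE.
  by rewrite big_split /= (comb_tangent u) sw.2 addr0.
split=> //; apply: hr => //; split => // i j; rewrite ord1.
rewrite -ball_normE /ball_ /= !mxE opprD addrA subrr sub0r normrN.
by apply: le_lt_trans (wu i) _; near: d; exact: small.
Unshelve. all: by end_near. Qed.

Definition C1_simplex (f : 'cV[R]_m.+1 -> R) (Df : 'I_m -> 'cV[R]_m.+1 -> R) :=
  {within simplex, continuous f} /\ forall j,
  {within simplex, continuous (Df j)} /\
  forall w, simplex w -> is_derive w (frame j) f (Df j w).

End Chart.

(** * Chain rule on the simplex *)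

Section ChainRule.
Context {R : realType} {m : nat}.
Implicit Types (w v : 'cV[R]_m.+1) (u x : 'I_m -> R).
Local Notation frame := (@chart_frame R m).

Lemma sum_delta (j0 : 'I_m) (F : 'I_m -> R) :
  \sum_j (j == j0)%:R * F j = F j0.
Proof.
rewrite (bigD1 j0)//= eqxx mul1r big1 ?addr0// => j /negbTE ->.
by rewrite mul0r.
Qed.

Lemma frame_combD u x : frame_comb (fun j => u j + x j) = frame_comb u +
  frame_comb x.
Proof. by rewrite -big_split /=; apply: eq_bigr => j _; rewrite scalerDl. Qed.

Lemma frame_comb0 : frame_comb (fun=> 0 : R) = 0 :> 'cV[R]_m.+1.
Proof. by rewrite /frame_comb big1// => j _; rewrite scale0r. Qed.

Lemma frame_comb_delta (j0 : 'I_m) (k : R) :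
  frame_comb (fun j => (j == j0)%:R * k) = k *: frame j0.
Proof.
rewrite /frame_comb (bigD1 j0)//= eqxx mul1r big1 ?addr0// => j /negbTE ->.
by rewrite mul0r scale0r.
Qed.

(* Mean value theorem along one frame direction at a time. *)
Lemma C1_simplex_expansion (f : 'cV[R]_m.+1 -> R) Df w (e : R) :
  C1_simplex f Df -> simplex w -> 0 < e ->
  \forall d \near 0^'+, forall u, (forall j, `|u j| <= d) ->
    `|f (w + frame_comb u) - f w - \sum_j u j * Df j w| <= e * \sum_j `|u j|.
Proof.
move=> [cf fDf] sw e0; near=> d => u ud.
have d0 : 0 <= d by near: d; exact: nbhs_right_ge.
have Dd : forall j u, (forall j, `|u j| <= d) ->
    simplex (w + frame_comb u) /\ `|Df j (w + frame_comb u) - Df j w| <= e.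
  near: d; apply: filter_forall => j.
  by apply: simplex_near => //; have [] := fDf j.
(* [cut k] retains the first [k] coordinates of [u] and stays in the cube; passing to [k.+1] moves
   along a single frame vector. *)
pose cut k (j : 'I_m) := if (j < k)%N then u j else 0.
have cutd k j : `|cut k j| <= d by rewrite /cut; case: ifP; rewrite ?normr0.
have cutm j : cut m j = u j by rewrite /cut ltn_ord.
have -> : u = cut m by apply/funext => j; rewrite cutm.
suff : forall k, (k <= m)%N -> `|f (w + frame_comb (cut k)) - f w -
    \sum_j cut k j * Df j w| <= e * \sum_j `|cut k j| by exact.
elim=> [_|k IH km].
  have -> : cut 0%N = fun=> 0 by apply/funext => j; rewrite /cut ltn0.
  rewrite frame_comb0 addr0 subrr !big1 ?subrr ?normr0 ?mulr0// => j _;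
    by rewrite ?mul0r ?normr0.
pose j0 := Ordinal km; pose z := w + frame_comb (cut k).
have cutS j : cut k.+1 j = cut k j + (j == j0)%:R * u j0.
  rewrite /cut ltnS leq_eqVlt; have [->|jj0] := eqVneq j j0.
    by rewrite /= eqxx ltnn /= mul1r add0r.
  have : (val j == k) = false by rewrite -(negbTE jj0).
  by move=> ->; rewrite /= mul0r addr0.
have ncutS j : `|cut k.+1 j| = `|cut k j| + (j == j0)%:R * `|u j0|.
  rewrite cutS; have [->|_] := eqVneq j j0; last by rewrite !mul0r !addr0.
  by rewrite /cut /= ltnn !mul1r add0r normr0 add0r.
have zE t : z + (t * u j0) *: frame j0 =
    w + frame_comb (fun j => cut k j + (j == j0)%:R * (t * u j0)).
  by rewrite frame_combD frame_comb_delta addrA.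
have zd t : 0 <= t <= 1 -> forall j, `|cut k j + (j == j0)%:R * (t * u j0)| <= d.
  move=> /andP[t0 t1] j; have [->|_] := eqVneq j j0; last first.
    by rewrite mul0r addr0.
  rewrite /cut /= ltnn add0r mul1r normrM ger0_norm//.
  by rewrite (le_trans _ (ud j0))// ler_piMl.
have dphi (t : R) : 0 <= t <= 1 -> is_derive t (1 : R)
    (fun t => f (z + (t * u j0) *: frame j0))
    (Df j0 (z + (t * u j0) *: frame j0) * u j0).
  move=> t01.
  apply: (@is_derive1_comp R (fun s => f (z + s *: frame j0)) (fun t => t * u
    j0)).
    apply: is_derive_line; have [_ [_]] := (cf, fDf j0); apply.
    by rewrite zE; have [] := Dd j0 _ (zd _ t01).
  have := is_deriveZ (u j0) (is_derive_id t (1 : R)).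
  rewrite [u j0 *: 1]mulr1; congr is_derive.
  by apply/funext => s /=; rewrite /GRing.scale /= mulrC.
have [t t01||c] := @MVT_segment R (fun t => f (z + (t * u j0) *: frame j0))
  (fun t => Df j0 (z + (t * u j0) *: frame j0) * u j0) 0 1 ler01.
- apply: dphi; move: t01; rewrite in_itv /= => /andP[t0 t1]; rewrite !ltW//.
- apply: derivable_within_continuous => s; rewrite in_itv /= => s01.
  exact: (@ex_derive _ _ _ _ _ _ _ (dphi s s01)).
rewrite in_itv /= => c01; rewrite mul1r mul0r scale0r addr0 subr0 mulr1 => fE.
have -> : w + frame_comb (cut k.+1) = z + u j0 *: frame j0.
  by rewrite -[u j0]mul1r zE; congr (_ + frame_comb _); apply/funext => j;
    rewrite mul1r.
have -> : \sum_j cut k.+1 j * Df j w =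
    \sum_j cut k j * Df j w + u j0 * Df j0 w.
  rewrite -(sum_delta j0 (fun j => u j0 * Df j w)) -big_split /=.
  by apply: eq_bigr => j _; rewrite cutS mulrDl mulrA.
have -> : \sum_j `|cut k.+1 j| = \sum_j `|cut k j| + `|u j0|.
  rewrite -(sum_delta j0 (fun=> `|u j0|)) -big_split /=.
  by apply: eq_bigr => j _; rewrite ncutS.
rewrite mulrDr; set P := f (z + _); set S := \sum_j _ * _.
have -> : P - f w - (S + u j0 * Df j0 w) = (f z - f w - S) +
    (Df j0 (z + (c * u j0) *: frame j0) - Df j0 w) * u j0.
  by rewrite mulrBl -fE /P; ring.
apply: le_trans (ler_normD _ _) _; apply: lerD; first by apply: IH; exact: ltnW.
rewrite normrM ler_wpM2r//.
by rewrite zE; have [] := Dd j0 _ (zd _ c01).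
Unshelve. all: by end_near. Qed.

(** Off the simplex [f] is arbitrary, so it has no total derivative in the ambient space to compose
    with. The increment of the curve is a frame combination with coordinates [u j h], and the
    first-order expansion is applied to it. *)
Lemma C1_simplex_chain (f : 'cV[R]_m.+1 -> R) Df (c : R -> 'cV[R]_m.+1)
    (t : R) (x : 'I_m -> R) :
  C1_simplex f Df -> (\forall s \near t, simplex (c s)) ->
  (forall j, is_derive t (1 : R) (fun s => chart_coord (c s) j) (x j)) ->
  is_derive t (1 : R) (f \o c) (\sum_j x j * Df j (c t)).
Proof.
move=> fDf sc dc; have sct : simplex (c t) by exact: nbhs_singleton sc.
pose u j (h : R) := chart_coord (c (h + t)) j - chart_coord (c t) j.
have uh j : h^-1 * u j h @[h --> 0^'] --> x j.
  have := @ex_derive _ _ _ _ _ _ _ (dc j).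
  rewrite -(@derive_val _ _ _ _ _ _ _ (dc j)) /derive => /cvg_ex [l hl].
  rewrite (cvg_lim _ hl)//; apply: cvg_trans hl; apply: near_eq_cvg.
  by near=> h; rewrite /u /= /shift /= [h *: 1]mulr1.
have u0 j : u j h @[h --> 0^'] --> 0.
  have : h * (h^-1 * u j h) @[h --> 0^'] --> 0 * x j.
    by apply: cvgM; [apply: cvg_within; exact: cvg_id|exact: uh].
  rewrite mul0r; apply: cvg_trans; apply: near_eq_cvg; near=> h.
  by rewrite mulrA divff ?mul1r//; near: h; exact: nbhs_dnbhs_neq.
have key : h^-1 * (f (c (h + t)) - f (c t)) @[h --> 0^'] --> \sum_j x j * Df j
  (c t).
  pose r h := f (c (h + t)) - f (c t) - \sum_j u j h * Df j (c t).
  have r0 : h^-1 * r h @[h --> 0^'] --> 0.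
    apply/cvgr0Pnorm_le => e e0.
    (* Bounds the sum of the difference quotients of the coordinates for small [h]; the last 1 keeps
       it positive when [m = 0]. *)
    pose K := \sum_j (`|x j| + 1) + 1.
    have K0 : 0 < K by rewrite ltr_wpDl// sumr_ge0// => j _; rewrite addr_ge0.
    have /(C1_simplex_expansion fDf sct) : 0 < e / K by rewrite divr_gt0.
    move=> H; have [d d0 Hd] : exists2 d : R, 0 < d & forall u, (forall j, `|u
      j| <= d) ->
        `|f (c t + frame_comb u) - f (c t) - \sum_j u j * Df j (c t)| <= e / K
          * \sum_j `|u j|.
      near (0 : R)^'+ => d; exists d; first by near: d; exact: nbhs_right_gt.
      by near: d; exact: H.
    have ud : \forall h \near 0^', forall j, `|u j h| <= d.
      apply: filter_forall => j; have /cvgr0Pnorm_le := u0 j; exact.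
    have uK : \forall h \near 0^', forall j, `|h^-1 * u j h| <= `|x j| + 1.
      apply: filter_forall => j; have /cvgrPdist_le := uh j => /(_ _ ltr01).
      apply: filterS => h; rewrite -lerBlDl; apply: le_trans.
      by rewrite distrC; exact: lerB_dist.
    have sch : \forall h \near 0^', simplex (c (h + t)).
      apply: nbhs_dnbhs; have ht : h + t @[h --> (0 : R)] --> t.
        rewrite -[X in _ --> X]add0r; apply: cvgD; [exact: cvg_id|exact: cvg_cst].
      exact: (ht _ sc).
    near=> h; rewrite normrM.
    have ch : c (h + t) = c t + frame_comb (u ^~ h).
      apply: simplex_comb => //; by near: h.
    have : `|r h| <= e / K * \sum_j `|u j h|.
      by rewrite /r ch; apply: Hd; near: h.
    move=> /(ler_wpM2l (normr_ge0 h^-1)) /le_trans; apply.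
    rewrite mulrCA mulr_sumr -mulrA ler_piMr ?(ltW e0)//.
    rewrite mulrC ler_pdivrMr// mul1r.
    apply: (@le_trans _ _ (\sum_j (`|x j| + 1))); last by rewrite lerDl.
    apply: ler_sum => j _; rewrite -normrM.
    by move: j; near: h.
  have : h^-1 * r h + \sum_j (h^-1 * u j h) * Df j (c t) @[h --> 0^'] -->
      0 + \sum_j x j * Df j (c t).
    apply: cvgD => //; apply: cvg_bigsum => j.
    by apply: cvgM; [exact: uh|exact: cvg_cst].
  rewrite add0r; apply: cvg_trans; apply: near_eq_cvg; near=> h.
  rewrite /r mulrBr mulr_sumr; under [X in _ - X + _]eq_bigr do rewrite mulrA.
  by rewrite subrK.
apply: DeriveDef.
  rewrite /derivable; apply/cvg_ex; exists (\sum_j x j * Df j (c t)).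
  apply: cvg_trans key; apply: near_eq_cvg; near=> h.
  by rewrite /= /shift /= [h *: 1]mulr1.
rewrite /derive; apply: cvg_lim => //.
apply: cvg_trans key; apply: near_eq_cvg; near=> h.
by rewrite /= /shift /= [h *: 1]mulr1.
Unshelve. all: by end_near. Qed.

End ChainRule.

(** * The metric in the chart *)

Section Metric.
Context {R : realType} {m : nat} (G : 'cV[R]_m.+1 -> 'M[R]_m.+1).
Hypothesis hG : risk_metric G.
Implicit Types (w v : 'cV[R]_m.+1) (x y : 'I_m -> R).
Local Notation frame := (@chart_frame R m).

Definition metric w x y : R :=
  \sum_i \sum_j chart_metric G w i j * x i * y j.

Lemma chart_metricE w i j : chart_metric G w i j =
  \sum_b \sum_a (frame i a 0 * frame j b 0) * G w a b.
Proof.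
rewrite mxE mxE; apply: eq_bigr => b _.
rewrite mxE mulr_suml; apply: eq_bigr => a _.
by rewrite mxE; ring.
Qed.

Lemma qform_comb w x : qform (G w) (frame_comb x) = metric w x x.
Proof.
rewrite /qform /metric /frame_comb [(\sum_j _)^T]raddf_sum /= mulmx_suml
  mulmx_suml summxE.
apply: eq_bigr => i _; rewrite mulmx_sumr summxE; apply: eq_bigr => j _.
by rewrite -scalemxAr [(_ *: _)^T]linearZ /= -!scalemxAl /chart_metric !mxE; ring.
Qed.

Lemma chart_metric_sym w i j : simplex w ->
  chart_metric G w i j = chart_metric G w j i.
Proof.
move=> sw; have [GT _] := hG.2 w sw.
rewrite !chart_metricE exchange_big /=.
apply: eq_bigr => a _; apply: eq_bigr => b _.
have -> : G w a b = G w b a by rewrite -[in LHS]GT mxE.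
by ring.
Qed.

Lemma metricC w x y : simplex w -> metric w x y = metric w y x.
Proof.
move=> sw; rewrite /metric exchange_big /=.
apply: eq_bigr => j _; apply: eq_bigr => i _.
by rewrite chart_metric_sym//; ring.
Qed.

Lemma metric_gt0 w x : simplex w -> (exists j, x j != 0) -> 0 < metric w x x.
Proof.
move=> sw [j xj]; rewrite -qform_comb; apply: (hG.2 w sw).2.
apply: contra_neq xj => x0; rewrite -(chart_coord_comb x) x0.
by rewrite /chart_coord mxE.
Qed.

Lemma metric_eq0 w x : simplex w -> metric w x x = 0 -> forall j, x j = 0.
Proof.
move=> sw x0 j; apply/eqP; apply: contraT => xj.
by have := metric_gt0 sw (ex_intro _ j xj); rewrite x0 ltxx.
Qed.

Lemma metric_ge0 w x : simplex w -> 0 <= metric w x x.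
Proof.
move=> sw; have [/existsP xj|] := boolP [exists j, x j != 0].
  exact/ltW/metric_gt0.
rewrite negb_exists => /forallP x0; rewrite /metric big1// => i _.
by rewrite big1// => j _; have := x0 i; rewrite negbK => /eqP ->; ring.
Qed.

Lemma metricD w x1 x2 y :
  metric w (fun j => x1 j + x2 j) y = metric w x1 y + metric w x2 y.
Proof.
rewrite -big_split; apply: eq_bigr => i _ /=; rewrite -big_split.
by apply: eq_bigr => j _ /=; ring.
Qed.

Lemma metricZ w k x y : metric w (fun j => k * x j) y = k * metric w x y.
Proof.
rewrite mulr_sumr; apply: eq_bigr => i _ /=; rewrite mulr_sumr.
by apply: eq_bigr => j _ /=; ring.
Qed.

(** A vector in the kernel has square 0 for [metric], so it vanishes by positive definiteness. *)
Lemma chart_metric_unit w : simplex w -> chart_metric G w \in unitmx.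
Proof.
move=> sw; rewrite -row_free_unit -kermx_eq0; apply/rowV0P => v /sub_kermxP vM.
apply/matrixP => i j; rewrite ord1 [RHS]mxE.
apply: (@metric_eq0 w (v 0)) => //; rewrite /metric exchange_big big1// => k _ /=.
rewrite -mulr_suml; under eq_bigr do rewrite mulrC.
by have := congr1 (fun M : 'rV_m => M 0 k) vM; rewrite !mxE => ->; rewrite mul0r.
Qed.

Lemma C1_simplex_chart_metric (i j : 'I_m) :
  C1_simplex (fun w => chart_metric G w i j) (fun l => d_metric G l i j).
Proof.
have [/(_ 1%N) [cG DG] _] := hG.
have cGe a b : {within simplex, continuous (fun w => G w a b)}.
  by move/within_continuous_mxP: cG; exact.
have E : (fun w => chart_metric G w i j) =
    (fun w => \sum_b \sum_a (frame i a 0 * frame j b 0) * G w a b).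
  by apply/funext => w; rewrite chart_metricE.
have [dG _] : (forall l w, simplex w -> derivable G w (frame l)) /\ True.
  by split=> // l; have [] := DG _ (frame_tangent l).
have dE l w : simplex w -> is_derive w (frame l) (fun w => chart_metric G w i j)
    (\sum_b \sum_a (frame i a 0 * frame j b 0) * ('D_(frame l) G w) a b).
  move=> sw; rewrite E.
  have dGe a b : is_derive w (frame l) (fun w => G w a b) (('D_(frame l) G w) a
    b).
    by move/is_derive_mxP: (derivableP (dG l w sw)); exact.
  by apply: is_derive_bigsum => b; apply: is_derive_bigsum.
split.
  rewrite E; apply: within_continuous_sum => b; apply: within_continuous_sum => a.
  by apply: within_continuousM; [exact: within_continuous_cst|].
move=> l; split=> [|w sw]; last first.
  by have H := dE l w sw; have := derivableP (@ex_derive _ _ _ _ _ _ _ H).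
apply: (@eq_within_continuous 'cV[R]_m.+1 simplex R (fun w =>
    \sum_b \sum_a (frame i a 0 * frame j b 0) * ('D_(frame l) G w) a b)).
  by move=> w sw; rewrite /d_metric (@derive_val _ _ _ _ _ _ _ (dE l w sw)).
have [_ [cDG _]] := DG _ (frame_tangent l).
apply: within_continuous_sum => b; apply: within_continuous_sum => a.
apply: within_continuousM; first exact: within_continuous_cst.
by move/within_continuous_mxP: cDG; exact.
Qed.

Lemma within_continuous_det (T : topologicalType) (A : set T) n
    (M : T -> 'M[R]_n) : (forall i j, {within A, continuous (fun z => M z i
      j)}) ->
  {within A, continuous (fun z => \det (M z))}.
Proof.
move=> cM; apply: within_continuous_sum => s.
apply: within_continuousM; first exact: within_continuous_cst.
exact: within_continuous_prod.
Qed.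

(** Cramer's rule: cofactors over a determinant without zeros on the simplex. *)
Lemma within_continuous_invmx (i j : 'I_m) :
  {within simplex, continuous (fun w => invmx (chart_metric G w) i j)}.
Proof.
have cM a b : {within simplex, continuous (fun w => chart_metric G w a b)}.
  by have [] := C1_simplex_chart_metric a b.
apply: (@eq_within_continuous 'cV[R]_m.+1 simplex R (fun w => (\det
  (chart_metric G w))^-1 *
    cofactor (chart_metric G w) j i)).
  by move=> w sw; rewrite /invmx chart_metric_unit// !mxE.
apply: within_continuousM.
  apply: within_continuousV; first exact: within_continuous_det.
  by move=> w /chart_metric_unit; rewrite unitmxE unitfE.
apply: within_continuousM; first exact: within_continuous_cst.
apply: within_continuous_det => a b.
by apply: eq_within_continuous (cM _ _) => w _; rewrite !mxE.
Qed.

Lemma within_continuous_christoffel (k i j : 'I_m) :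
  {within simplex, continuous (christoffel G k i j)}.
Proof.
have cd a b l : {within simplex, continuous (d_metric G l a b)}.
  by have [_ /(_ l) []] := C1_simplex_chart_metric a b.
apply: within_continuousM; first exact: within_continuous_cst.
apply: within_continuous_sum => l; apply: within_continuousM.
  exact: within_continuous_invmx.
by apply: within_continuous_sub => //; exact: within_continuous_add.
Qed.

End Metric.

(** * Bounds, comparison and limits of integrals *)

Section MoreCalculus.
Context {R : realType}.
Local Notation mu := (@lebesgue_measure R).
Implicit Types (a b : R) (f g : R -> R).

Lemma within_bounded (T : topologicalType) (A : set T) (f : T -> R) :
  compact A -> {within A, continuous f} ->
  \forall K \near +oo, forall x, A x -> `|f x| <= K.
Proof.
move=> cA cf; have := compact_bounded (continuous_compact cf cA).
rewrite /bounded_set /bounded_near.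
by apply: filterS => K H x Ax; exact: (H _ (imageP f Ax)).
Qed.

Lemma primD a b f g (k : R) : a <= b ->
  {within `[a, b], continuous f} -> {within `[a, b], continuous g} ->
  prim a (fun t => f t + k * g t) b = prim a f b + k * prim a g b.
Proof.
move=> ab cf cg.
rewrite (prim_FTC ab (C1_derivD (C1_deriv_prim ab cf) (C1_derivZ k
  (C1_deriv_prim ab cg)))).
by rewrite !prim_left mulr0 addr0 subr0.
Qed.

Lemma eq_prim a b f g : (forall t, a <= t <= b -> f t = g t) ->
  prim a f b = prim a g b.
Proof.
move=> fg; apply: eq_Rintegral => t; rewrite inE /= in_itv /=; exact: fg.
Qed.

Lemma le_prim a b f g : a <= b ->
  {within `[a, b], continuous f} -> {within `[a, b], continuous g} ->
  (forall t, a < t < b -> f t <= g t) -> prim a f b <= prim a g b.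
Proof.
move=> ab cf cg fg; rewrite -subr_ge0 -[leLHS](subrr 0).
rewrite -[X in X - _](prim_left a g) -[X in _ - X](prim_left a f).
have D := C1_derivB (C1_deriv_prim ab cg) (C1_deriv_prim ab cf).
by apply: (C1_deriv_ndecr D) => // t /fg; rewrite subr_ge0.
Qed.

Lemma prim_dominated_cvg (f_ : nat -> R -> R) f a b (K : R) :
  (forall n, {within `[a, b], continuous (f_ n)}) ->
  {within `[a, b], continuous f} ->
  (forall t, a <= t <= b -> f_ n t @[n --> \oo] --> f t) ->
  (forall n t, a <= t <= b -> `|f_ n t| <= K) ->
  prim a (f_ n) b @[n --> \oo] --> prim a f b.
Proof.
move=> cf_ cf f_f fK.
have iK : mu.-integrable `[a, b] (EFin \o (fun=> K)).
  by apply: continuous_integrable; exact: within_continuous_cst.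
have [||||_ _] := @dominated_convergence _ _ R mu _ (@measurable_itv R `[a, b])
  (fun n => EFin \o f_ n) (EFin \o f) (EFin \o (fun=> K)) _ _ _ iK _.
- by move=> n; apply: measurable_int (continuous_integrable (cf_ n)).
- exact: measurable_int (continuous_integrable cf).
- apply: aeW => t; rewrite /= in_itv /= => tab.
  by apply: cvg_EFin; [exact: nearW|exact: f_f].
- by apply: aeW => t n; rewrite /= in_itv /= => tab; rewrite lee_fin; exact: fK.
rewrite prim_integral//; under eq_fun do rewrite prim_integral//.
by move=> /fine_cvgP [].
Qed.

End MoreCalculus.

(** * Curves in the chart *)

Section ChartCurves.
Context {R : realType} {m : nat} (G : 'cV[R]_m.+1 -> 'M[R]_m.+1).
Hypothesis hG : risk_metric G.
Implicit Types (w v : 'cV[R]_m.+1) (x y : 'I_m -> R) (a b : R).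
Implicit Types (c : R -> 'cV[R]_m.+1) (xd : 'I_m -> R -> R).
Local Notation frame := (@chart_frame R m).

Lemma metric_cauchy w x y : simplex w ->
  metric G w x y ^+ 2 <= metric G w x x * metric G w y y.
Proof.
move=> sw; have [y0|y0] := eqVneq (metric G w y y) 0.
  have {}y0 := metric_eq0 hG sw y0.
  have -> : metric G w x y = 0.
    by rewrite /metric big1// => i _; rewrite big1// => j _; rewrite y0 mulr0.
  by rewrite expr0n /= mulr_ge0// metric_ge0.
(* The value of [k] that minimises the square of [x - k y], which is nonnegative. *)
pose k := metric G w x y / metric G w y y.
have yy : 0 < metric G w y y by rewrite lt_neqAle eq_sym y0 metric_ge0.
have := metric_ge0 hG (fun j => x j + (- k) * y j) sw.
rewrite metricD metricZ [metric G w x _](metricC hG)// [metric G w y _](metricC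
  hG)//.
rewrite !metricD !metricZ [metric G w y x](metricC hG)//.
set p := metric G w x x; set q := metric G w x y; set r := metric G w y y.
have -> : p + - k * q + - k * (q + - k * r) = (p * r - q ^+ 2) / r.
  by rewrite /k -/q -/r; field.
by rewrite pmulr_lge0 ?invr_gt0// subr_ge0.
Qed.

(** The coordinate [x i] is the product of [x] with the [i]-th column [r] of the inverse metric, and
    [r] has square [r i]; Cauchy-Schwarz concludes. This is how velocities are bounded by the
    speed. *)
Lemma coord_sq_le w x i : simplex w ->
  x i ^+ 2 <= invmx (chart_metric G w) i i * metric G w x x.
Proof.
move=> sw; pose r j := invmx (chart_metric G w) j i.
have xr z : metric G w z r = z i.
  rewrite /metric; under eq_bigr => a _.
    under eq_bigr do rewrite mulrAC.
    rewrite -mulr_suml.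
    have -> : \sum_j chart_metric G w a j * r j = (a == i)%:R.
      have := mulmxV (chart_metric_unit hG sw) => /matrixP /(_ a i).
      by rewrite !mxE.
    over.
  exact: sum_delta.
by rewrite -[x i]xr mulrC (le_trans (metric_cauchy _ _ sw))// xr.
Qed.

(** The velocity is stored through its chart coordinates, which reduces everything to scalar
    functions. At the endpoints [xd] holds the one-sided derivatives, where [derive1] may be
    meaningless. *)
Definition chart_C1 a b c xd : Prop :=
  (forall t, a <= t <= b -> simplex (c t)) /\
  forall j, C1_deriv `[a, b] (fun t => chart_coord (c t) j) (xd j).

Definition speed c xd (t : R) : R :=
  Num.sqrt (metric G (c t) (xd^~ t) (xd^~ t)).

Lemma within_continuous_affine (T : topologicalType) (A : set T) w
    (h : 'I_m -> T -> R) : (forall j, {within A, continuous (h j)}) ->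
  {within A, continuous (fun t => w + frame_comb (h^~ t))}.
Proof.
move=> ch; apply/within_continuous_mxP => i k; rewrite ord1.
apply: (@eq_within_continuous _ A _ (fun t => w i 0 + \sum_j h j t * frame j i
  0)).
  by move=> t _; rewrite mxE summxE; congr (_ + _); apply: eq_bigr => j _;
    rewrite [RHS]mxE.
apply: within_continuous_add; first exact: within_continuous_cst.
apply: within_continuous_sum => j; apply: within_continuousM => //.
exact: within_continuous_cst.
Qed.

Lemma chart_C1_comp a b c xd (f : 'cV[R]_m.+1 -> R) : a <= b ->
  chart_C1 a b c xd -> {within simplex, continuous f} ->
  {within `[a, b], continuous (fun t => f (c t))}.
Proof.
move=> ab [sc xc]; apply: within_continuous_comp => [|t]; last first.
  by rewrite /= in_itv; exact: sc.
apply: (@eq_within_continuous _ _ _ (fun t => c a + frame_comb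
    (fun j => chart_coord (c t) j - chart_coord (c a) j))).
  move=> t; rewrite /= in_itv /= => tab.
  by rewrite -simplex_comb//; apply: sc; rewrite ?lexx.
apply: (@within_continuous_affine _ _ _ (fun j t => chart_coord (c t) j -
  chart_coord (c a) j)).
move=> j; apply: within_continuous_sub; last exact: within_continuous_cst.
by have [] := xc j.
Qed.

Lemma chart_C1_chain a b c xd (f : 'cV[R]_m.+1 -> R) Df (t : R) :
  chart_C1 a b c xd -> C1_simplex f Df -> a < t < b ->
  is_derive t (1 : R) (fun s => f (c s)) (\sum_j xd j t * Df j (c t)).
Proof.
move=> [sc xc] fDf tab; apply: C1_simplex_chain => //; last first.
  by move=> j; exact: C1_deriv_derive (xc j) tab.
have : \near t, t \in `]a, b[ by apply: near_in_itvoo; rewrite in_itv.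
apply: filterS => s; rewrite in_itv /= => /andP[as_ sb].
by apply: sc; rewrite !ltW.
Qed.

Lemma within_continuous_metric a b c xd (x y : 'I_m -> R -> R) : a <= b ->
  chart_C1 a b c xd -> (forall j, {within `[a, b], continuous (x j)}) ->
  (forall j, {within `[a, b], continuous (y j)}) ->
  {within `[a, b], continuous (fun t => metric G (c t) (x^~ t) (y^~ t))}.
Proof.
move=> ab cx hx hy; apply: within_continuous_sum => i.
apply: within_continuous_sum => j; apply: within_continuousM => //.
apply: within_continuousM => //.
by have [cf _] := C1_simplex_chart_metric hG i j; exact: chart_C1_comp cx cf.
Qed.

Lemma chart_C1_cont a b c xd j : chart_C1 a b c xd ->
  {within `[a, b], continuous (xd j)}.
Proof. by case=> _ /(_ j) []. Qed.

Lemma within_continuous_speed a b c xd : a <= b -> chart_C1 a b c xd ->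
  {within `[a, b], continuous (speed c xd)}.
Proof.
move=> ab cx; apply: (@within_continuous_post _ _ _ _ Num.sqrt);
  last exact: sqrt_continuous.
by apply: (within_continuous_metric ab cx) => j; exact: chart_C1_cont cx.
Qed.

Lemma chart_C1_is_derive a b c xd (t : R) : chart_C1 a b c xd -> a < t < b ->
  is_derive t (1 : R) c (frame_comb (xd^~ t)).
Proof.
move=> [sc xc] tab; have [at_ tb] := andP tab.
have st : simplex (c t) by apply: sc; rewrite !ltW.
apply/is_derive_mxP => i k; rewrite ord1 summxE.
have : is_derive t (1 : R) (fun s => c t i 0 + \sum_j
    (chart_coord (c s) j - chart_coord (c t) j) * frame j i 0)
    (\sum_j (xd j t *: frame j) i 0).
  rewrite -[X in is_derive _ _ _ X]add0r.
  apply: is_deriveD; apply: is_derive_bigsum => j.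
  rewrite [X in is_derive _ _ _ X]mxE mulrC.
  have H := is_deriveB (C1_deriv_derive (xc j) tab)
    (is_derive_cst (chart_coord (c t) j) t (1 : R)).
  have := is_deriveZ (frame j i 0) H; rewrite subr0; congr is_derive.
  by apply/funext => s; rewrite [RHS]mulrC.
apply: near_eq_is_derive.
have : \near t, t \in `]a, b[ by apply: near_in_itvoo; rewrite in_itv.
apply: filterS => s; rewrite in_itv /= => /andP[as_ sb].
have ss : simplex (c s) by apply: sc; rewrite !ltW.
rewrite [in RHS](simplex_comb ss st) mxE summxE; congr (_ + _).
by apply: eq_bigr => j _; rewrite [RHS]mxE.
Qed.

(** [derive1 c] is the velocity in the open interval only; the endpoints are removed from both
    integrals as null sets. *)
Lemma risk_chart a b c xd : a < b -> chart_C1 a b c xd ->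
  risk_on G `[a, b] c = (prim a (speed c xd) b)%:E.
Proof.
move=> ab cx; rewrite /risk_on -(prim_integral (within_continuous_speed (ltW
  ab) cx)).
have E t : t \in `]a, b[%R -> Num.sqrt (qform (G (c t)) (derive1 c t)) = speed
  c xd t.
  rewrite in_itv /= => tab; have H := chart_C1_is_derive cx tab.
  by rewrite derive1E (@derive_val _ _ _ _ _ _ _ H) qform_comb.
have cs := within_continuous_speed (ltW ab) cx.
have ms := measurable_funS (measurable_itv `[a, b]) (@subset_itv_oo_cc _ _ a b)
  (measurable_int _ (continuous_integrable cs)).
rewrite integral_itv_bndoo; last first.
  apply: eq_measurable_fun ms => t; rewrite inE => tab.
  by rewrite E.
rewrite [RHS]integral_itv_bndoo//; apply: eq_integral => t; rewrite inE => tab.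
by rewrite E.
Qed.

End ChartCurves.

(** * First variation of the length *)

Section Majorized.
Context {R : realType} {T : Type} (A : set T).
Implicit Types f g p q : T -> R.

(** [f = O(p)] uniformly on [A]. With the speed or its square as [p], it records how fast a quantity
    vanishes where the curve pauses. *)
Definition majorized p f : Prop :=
  exists2 K : R, 0 <= K & forall x, A x -> `|f x| <= K * p x.

Lemma majorizedD p f g : majorized p f -> majorized p g ->
  majorized p (fun x => f x + g x).
Proof.
move=> [K K0 fK] [M M0 gM]; exists (K + M); first exact: addr_ge0.
move=> x Ax; rewrite (le_trans (ler_normD _ _))// mulrDl.
by apply: lerD; [exact: fK|exact: gM].
Qed.

Lemma majorizedM p q f g : majorized p f -> majorized q g ->
  majorized (fun x => p x * q x) (fun x => f x * g x).
Proof.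
move=> [K K0 fK] [M M0 gM]; exists (K * M); first exact: mulr_ge0.
move=> x Ax; rewrite normrM mulrACA.
by apply: ler_pM => //; [exact: fK|exact: gM].
Qed.

Lemma majorizedMl p f g : majorized (fun=> 1) f -> majorized p g ->
  majorized p (fun x => f x * g x).
Proof.
by move=> hf /(majorizedM hf) [K K0 H]; exists K => // x /H; rewrite mul1r.
Qed.

Lemma majorized_cst (k : R) : majorized (fun=> 1) (fun=> k).
Proof. by exists `|k| => // x _; rewrite mulr1. Qed.

Lemma majorized_sum p (I : Type) (r : seq I) (F : I -> T -> R) :
  (forall i, majorized p (F i)) -> majorized p (fun x => \sum_(i <- r) F i x).
Proof.
move=> hF; elim: r => [|i r IH].
  by exists 0 => // x _; rewrite big_nil normr0 mul0r.
under [X in majorized _ X]eq_fun do rewrite big_cons.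
exact: majorizedD.
Qed.

End Majorized.

Lemma majorized_compact (R : realType) (T : topologicalType) (A : set T)
    (f : T -> R) : compact A -> {within A, continuous f} -> majorized A (fun=>
      1) f.
Proof.
move=> cA cf; have := within_bounded cA cf => H.
near +oo_R => K; exists K.
  by near: K; exact: nbhs_pinfty_ge.
by move=> x Ax; rewrite mulr1; move: x Ax; near: K.
Unshelve. all: by end_near. Qed.

(** * Momentum and force along a curve, and their bounds by the speed *)

Section Variation.
Context {R : realType} {m : nat} (G : 'cV[R]_m.+1 -> 'M[R]_m.+1).
Hypothesis hG : risk_metric G.

Definition momentum (c : R -> 'cV[R]_m.+1) (xd : 'I_m -> R -> R) (j : 'I_m) (t
  : R) :=
  \sum_i chart_metric G (c t) i j * xd i t.

(** Derivative of the squared speed in the [l]-th chart direction, the velocity being held fixed. *)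
Definition metric_variation (c : R -> 'cV[R]_m.+1) (xd : 'I_m -> R -> R) (l :
  'I_m) (t : R) :=
  \sum_i \sum_j d_metric G l i j (c t) * xd i t * xd j t.

(* Equal to 0 where the speed vanishes, since x / 0 = 0; this is also its limit. *)
Definition force (c : R -> 'cV[R]_m.+1) (xd : 'I_m -> R -> R) (l : 'I_m) (t :
  R) :=
  2^-1 * metric_variation c xd l t / speed G c xd t.

Context (c : R -> 'cV[R]_m.+1) (xd : 'I_m -> R -> R).
Hypothesis cx : chart_C1 0 1 c xd.
Local Notation sigma := (speed G c xd).
Local Notation D := [set t : R | 0 <= t <= 1].

Lemma unit_itvE : `[0, 1]%classic = D.
Proof. by apply/seteqP; split=> t; rewrite /= in_itv. Qed.

Let cc t (tD : D t) : simplex (c t) := cx.1 t tD.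

Let c_comp (f : 'cV[R]_m.+1 -> R) : {within simplex, continuous f} ->
  {within `[0, 1], continuous (fun t => f (c t))}.
Proof. exact: chart_C1_comp ler01 cx. Qed.

Let c_sigma : {within `[0, 1], continuous sigma}.
Proof. exact: within_continuous_speed ler01 cx. Qed.

Let c_xd j : {within `[0, 1], continuous (xd j)}.
Proof. exact: chart_C1_cont cx. Qed.

Let c_Gam i j : {within simplex, continuous (fun w => chart_metric G w i j)}.
Proof. by have [] := C1_simplex_chart_metric hG i j. Qed.

Let c_dGam l i j : {within simplex, continuous (d_metric G l i j)}.
Proof. by have [_ /(_ l) []] := C1_simplex_chart_metric hG i j. Qed.

Let maj1 (f : R -> R) : {within `[0, 1], continuous f} -> majorized D (fun=> 1) f.
Proof. by rewrite -unit_itvE; apply: majorized_compact;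
  exact: segment_compact. Qed.

Lemma speed_sq t : D t -> sigma t ^+ 2 = metric G (c t) (xd^~ t) (xd^~ t).
Proof. by move=> /cc sc; rewrite sqr_sqrtr// metric_ge0. Qed.

Lemma speed_ge0 t : 0 <= sigma t.
Proof. exact: sqrtr_ge0. Qed.

(** The diagonal entries of the inverse metric are bounded along the curve, by compactness of the
    parameter interval. *)
Lemma majorized_velocity j : majorized D sigma (xd j).
Proof.
have [K K0 KE] := maj1 (c_comp (@within_continuous_invmx _ _ _ hG j j)).
(* [K <= (K + 1) ^+ 2] replaces the square root of [K]. *)
exists (K + 1); first exact: addr_ge0.
move=> t tD; have := coord_sq_le hG (xd^~ t) j (cc tD).
rewrite -speed_sq// => H.
rewrite -[leLHS]ger0_norm// -ler_sqr ?nnegrE ?mulr_ge0 ?addr_ge0 ?speed_ge0//;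
  last first.
rewrite normr_id real_normK ?num_real// (le_trans H)// exprMn ler_wpM2r
  ?sqr_ge0//.
have := KE _ tD; rewrite mulr1 => /(le_trans (ler_norm _)) /le_trans; apply.
by rewrite expr2 mulrDr mulrDl !mulr1 mul1r; nra.
Qed.

Lemma majorized_momentum j : majorized D sigma (momentum c xd j).
Proof.
apply: majorized_sum => i; apply: majorizedMl; last exact: majorized_velocity.
exact: (maj1 (c_comp (@c_Gam i j))).
Qed.

Lemma within_continuous_momentum j : {within `[0, 1], continuous (momentum c xd
  j)}.
Proof.
by apply: within_continuous_sum => i; apply: within_continuousM => //;
  exact: (c_comp (@c_Gam i j)).
Qed.

Lemma majorized_sq (f : R -> R) : majorized D (fun t => sigma t * sigma t) f ->
  exists K, forall t, D t -> `|f t| <= K * sigma t ^+ 2.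
Proof. by move=> [K _ H]; exists K => t /H; rewrite expr2. Qed.

Lemma majorized_metric_variation l :
  majorized D (fun t => sigma t * sigma t) (metric_variation c xd l).
Proof.
apply: majorized_sum => i; apply: majorized_sum => j; apply: majorizedM.
  by apply: majorizedMl;
    [exact: (maj1 (c_comp (@c_dGam l i j)))|exact: majorized_velocity].
exact: majorized_velocity.
Qed.

Lemma within_continuous_metric_variation l :
  {within `[0, 1], continuous (metric_variation c xd l)}.
Proof.
apply: within_continuous_sum => i; apply: within_continuous_sum => j.
by apply: within_continuousM => //; apply: within_continuousM => //;
  exact: (c_comp (@c_dGam l i j)).
Qed.

Lemma within_continuous_over_speed (f : R -> R) :
  {within `[0, 1], continuous f} -> majorized D (fun t => sigma t * sigma t) f ->
  {within `[0, 1], continuous (fun t => f t / sigma t)}.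
Proof.
move=> cf /majorized_sq [K fK]; apply: within_continuous_ratio cf c_sigma _.
by move=> t; rewrite unit_itvE; exact: fK.
Qed.

Lemma within_continuous_force l : {within `[0, 1], continuous (force c xd l)}.
Proof.
apply: within_continuous_over_speed.
  apply: within_continuousM; first exact: within_continuous_cst.
  exact: within_continuous_metric_variation.
by apply: majorizedMl; [exact: majorized_cst|exact: majorized_metric_variation].
Qed.

(** Each weight attains a positive minimum along the curve, so one [d] serves for all times. *)
Lemma simplex_tube : exists2 d : R, 0 < d &
  forall t, D t -> forall u, (forall j, `|u j| <= d) -> simplex (c t +
    frame_comb u).
Proof.
have lower i : exists2 k : R, 0 < k & forall t, D t -> k <= c t i 0.
  have ci : {within `[0, 1], continuous (fun t => c t i 0)}.
    apply: (c_comp (f := fun w => w i 0)); apply: continuous_subspaceT => w.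
    exact: coord_continuous.
  have [s sD ms] := EVT_min ler01 ci; exists (c s i 0).
    by apply: (cc _).1; move: sD; rewrite in_itv.
  by move=> t tD; apply: ms; rewrite in_itv.
near (0 : R)^'+ => d; exists d; first by near: d; exact: nbhs_right_gt.
move=> t tD u ud; split=> [i|]; last first.
  under eq_bigr do rewrite mxE.
  by rewrite big_split /= (comb_tangent u) (cc tD).2 addr0.
have wid : forall i t, D t -> m%:R * d < c t i 0.
  near: d; apply: filter_forall => k; have [e e0 He] := lower k.
  near=> d => s sD; apply: lt_le_trans (He _ sD).
  have m1 : 0 < m%:R + 1 :> R by rewrite ltr_wpDl.
  have d0 : 0 < d by near: d; exact: nbhs_right_gt.
  have : d < e / (m%:R + 1) by near: d; apply: nbhs_right_lt; rewrite divr_gt0.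
  by rewrite ltr_pdivlMr// => /(le_lt_trans _); apply;
    rewrite mulrC mulrDr lerDl mulr1 ltW.
have := norm_comb_le i ud; have := wid i _ tD;
  rewrite ler_norml mxE => ? /andP[lo _].
by lra.
Unshelve. all: by end_near. Qed.

End Variation.

(** * Variations of a minimising curve and the first variation inequality *)

Section EulerLagrange.
Context {R : realType} {m : nat} (G : 'cV[R]_m.+1 -> 'M[R]_m.+1).
Hypothesis hG : risk_metric G.
Context (c : R -> 'cV[R]_m.+1) (xd : 'I_m -> R -> R).
Hypothesis cx : chart_C1 0 1 c xd.
Local Notation sigma := (speed G c xd).
Local Notation D := [set t : R | 0 <= t <= 1].

Context (y yd : 'I_m -> R -> R).
Hypothesis y_C1 : forall j, C1_deriv `[0, 1] (y j) (yd j).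
Hypothesis yd_maj : forall j, majorized D sigma (yd j).

Let c_yd j : {within `[0, 1], continuous (yd j)}.
Proof. by have [] := y_C1 j. Qed.

Let c_y j : {within `[0, 1], continuous (y j)}.
Proof. by have [] := y_C1 j. Qed.

(** Affine in [e], and in the simplex for small [e]. As [yd] is majorized by the speed of [c], the
    varied curve pauses wherever [c] does, so energies may be divided by the speed of [c]. *)
Definition variation (e t : R) := c t + frame_comb (fun j => e * y j t).
Definition variation_velocity (e : R) j t := xd j t + e * yd j t.
Definition variation_energy (e t : R) :=
  metric G (variation e t) ((variation_velocity e)^~ t) ((variation_velocity
    e)^~ t).
Definition variation_energy_deriv (e t : R) :=
  \sum_i \sum_j ((\sum_l y l t * d_metric G l i j (variation e t)) *
      variation_velocity e i t * variation_velocity e j t +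
    chart_metric G (variation e t) i j *
      (yd i t * variation_velocity e j t + variation_velocity e i t * yd j t)).
Local Notation X := variation_energy.
Local Notation dX := variation_energy_deriv.

Lemma chart_coord_variation e t j :
  chart_coord (variation e t) j = chart_coord (c t) j + e * y j t.
Proof. by rewrite chart_coordD chart_coord_comb. Qed.

Lemma variation_simplex : exists2 e0 : R, 0 < e0 &
  forall e t, `|e| <= e0 -> D t -> simplex (variation e t).
Proof.
have [d d0 tube] := simplex_tube cx.
have : \forall e0 \near 0^'+, forall j t, D t -> e0 * `|y j t| <= d.
  apply: filter_forall => j.
  have [K K0 HK] := majorized_compact (@segment_compact _ 0 1) (@c_y j).
  have K1 : 0 < K + 1 by rewrite ltr_wpDl.
  near=> e0 => t tD; have e00 : 0 <= e0 by near: e0; exact: nbhs_right_ge.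
  apply: (@le_trans _ _ (e0 * (K + 1))).
    rewrite ler_wpM2l//; have := HK t; rewrite unit_itvE mulr1 => /(_ tD).
    by move/le_trans; apply; rewrite lerDl.
  by rewrite -ler_pdivlMr// ltW//; near: e0; apply: nbhs_right_lt;
    exact: divr_gt0.
move=> H; near (0 : R)^'+ => e0; exists e0; first by near: e0;
  exact: nbhs_right_gt.
move=> e t ee0 tD; apply: tube => // j; rewrite normrM.
apply: (@le_trans _ _ (e0 * `|y j t|)); first by rewrite ler_wpM2r.
by move: j t tD {ee0}; near: e0; exact: H.
Unshelve. all: by end_near. Qed.

Section SmallParameter.
Context (e0 : R) (e00 : 0 < e0).
Hypothesis sV : forall e t, `|e| <= e0 -> D t -> simplex (variation e t).

Lemma chart_C1_variation e : `|e| <= e0 ->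
  chart_C1 0 1 (variation e) (variation_velocity e).
Proof.
move=> ee0; split=> [t tD|j]; first exact: sV.
apply: (@eq_C1_deriv _ _ _ (fun t => chart_coord (c t) j + e * y j t) _
    (fun t => xd j t + e * yd j t)).
- by move=> t _; rewrite chart_coord_variation.
- by [].
by apply: C1_derivD; [exact: cx.2|exact: C1_derivZ].
Qed.

Lemma speed_variation e t : `|e| <= e0 -> D t ->
  speed G (variation e) (variation_velocity e) t ^+ 2 = X e t.
Proof. by move=> ee0 tD; apply: (speed_sq hG (chart_C1_variation ee0)). Qed.

Lemma variation_energy_is_derive e t : `|e| < e0 -> D t ->
  is_derive e (1 : R) (X^~ t) (dX e t).
Proof.
move=> ee0 tD; apply: is_derive_bigsum => i; apply: is_derive_bigsum => j.
have dG : is_derive e (1 : R) (fun s => chart_metric G (variation s t) i j)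
    (\sum_l y l t * d_metric G l i j (variation e t)).
  apply: (C1_simplex_chain (C1_simplex_chart_metric hG i j)).
    have : \near e, `|e| < e0.
      have /cvgr_lt : `|s| @[s --> e] --> `|e| by apply: cvg_norm; exact: cvg_id.
      by apply.
    by apply: filterS => s /ltW se0; exact: sV.
  move=> l; have := is_deriveD (is_derive_cst (chart_coord (c t) l) e (1 : R))
    (is_deriveZ (y l t) (is_derive_id e (1 : R))).
  rewrite add0r [_ *: 1]mulr1; congr is_derive.
  by apply/funext => s; rewrite chart_coord_variation mulrC.
have dv k : is_derive e (1 : R) (fun s => variation_velocity s k t) (yd k t).
  have := is_deriveD (is_derive_cst (xd k t) e (1 : R))
    (is_deriveZ (yd k t) (is_derive_id e (1 : R))).
  rewrite add0r [_ *: 1]mulr1; congr is_derive.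
  by apply/funext => s; rewrite /variation_velocity mulrC.
apply: (is_derive_eq (is_derive_mul (is_derive_mul dG (dv i)) (dv j))).
by ring.
Qed.

(** Each term is quadratic in functions majorized by the speed, with coefficients jointly continuous
    in [(e, t)]. Compactness of the rectangle makes [K] independent of [e], as dominated convergence
    demands. *)
Lemma variation_energy_deriv_le : exists2 K : R, 0 <= K &
  forall e t, `|e| <= e0 -> D t -> `|dX e t| <= K * sigma t ^+ 2.
Proof.
pose Q : set (R * R) := `[- e0, e0] `*` `[0, 1].
have cQ : compact Q by apply: compact_setX; exact: segment_compact.
have QE p : Q p <-> `|p.1| <= e0 /\ D p.2.
  by rewrite /Q /= !in_itv /= ler_norml.
have cfst : {within Q, continuous (fun p : R * R => p.1)}.
  by apply: continuous_subspaceT => p; exact: cvg_fst.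
have csnd (f : R -> R) : {within `[0, 1], continuous f} ->
    {within Q, continuous (fun p : R * R => f p.2)}.
  move=> cf; apply: within_continuous_comp cf.
    by apply: continuous_subspaceT => p; exact: cvg_snd.
  by move=> p [].
have cV (f : 'cV[R]_m.+1 -> R) : {within simplex, continuous f} ->
    {within Q, continuous (fun p : R * R => f (variation p.1 p.2))}.
  move=> cf; apply: within_continuous_comp cf; last first.
    by move=> p /QE [? ?]; exact: sV.
  apply: (@eq_within_continuous _ _ _ (fun p : R * R => c 0 + frame_comb
     (fun j => chart_coord (c p.2) j - chart_coord (c 0) j + p.1 * y j p.2))).
    move=> p /QE [_ pD]; rewrite frame_combD addrA -simplex_comb//.
      exact: cx.1.
    by apply: cx.1; rewrite lexx ler01.
  apply: (@within_continuous_affine _ _ _ _ _ (fun j (p : R * R) =>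
      chart_coord (c p.2) j - chart_coord (c 0) j + p.1 * y j p.2)) => j.
  apply: within_continuous_add.
    apply: within_continuous_sub; last exact: within_continuous_cst.
    by apply: (csnd (fun t => chart_coord (c t) j)); have [] := cx.2 j.
  by apply: within_continuousM => //; exact: csnd.
pose s (p : R * R) := sigma p.2.
have lift_maj (f : R -> R) : majorized D sigma f -> majorized Q s (fun p => f
  p.2).
  by move=> [K K0 H]; exists K => // p /QE [_ /H].
have mvel j : majorized Q s (fun p : R * R => variation_velocity p.1 j p.2).
  apply: majorizedD; first exact/lift_maj/majorized_velocity.
  by apply: majorizedMl; [exact: majorized_compact|exact: lift_maj].
have c_dG l i j : {within simplex, continuous (d_metric G l i j)}.
  by have [_ /(_ l) []] := C1_simplex_chart_metric hG i j.
have c_G i j : {within simplex, continuous (fun w => chart_metric G w i j)}.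
  by have [] := C1_simplex_chart_metric hG i j.
have [K K0 H] : majorized Q (fun p => s p * s p) (fun p => dX p.1 p.2).
  apply: majorized_sum => i; apply: majorized_sum => j; apply: majorizedD.
    apply: majorizedM => //; apply: majorizedMl => //.
    apply: majorized_compact => //; apply: within_continuous_sum => l.
    by apply: within_continuousM; [exact: csnd|exact: (cV _ (c_dG l i j))].
  apply: majorizedMl.
    by apply: majorized_compact => //; exact: (cV _ (c_G i j)).
  by apply: majorizedD; apply: majorizedM => //; exact: lift_maj.
exists K => // e t ee0 tD; rewrite expr2.
by apply: (H (e, t)); apply/QE.
Qed.

Lemma variation0 t : variation 0 t = c t.
Proof.
rewrite /variation; have -> : (fun j => 0 * y j t) = fun=> 0.
  by apply/funext => j; rewrite mul0r.
by rewrite frame_comb0 addr0.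
Qed.

Lemma variation_energy0 t : D t -> X 0 t = sigma t ^+ 2.
Proof.
move=> tD; rewrite (speed_sq hG cx tD) /variation_energy variation0.
by congr (metric _ _ _ _); apply/funext => j;
  rewrite /variation_velocity mul0r addr0.
Qed.

Lemma variation_energy_deriv0 t : D t -> dX 0 t =
  \sum_l y l t * metric_variation G c xd l t +
  2 * \sum_j momentum G c xd j t * yd j t.
Proof.
move=> tD; have sc := cx.1 t tD.
rewrite /variation_energy_deriv variation0.
have v0 j : variation_velocity 0 j t = xd j t.
  by rewrite /variation_velocity mul0r addr0.
under eq_bigr do under eq_bigr do rewrite !v0.
under eq_bigr do rewrite big_split /=.
rewrite big_split /=; congr (_ + _).
  under [RHS]eq_bigr do rewrite mulr_sumr.
  rewrite [RHS]exchange_big /=; apply: eq_bigr => i _.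
  under [RHS]eq_bigr do rewrite mulr_sumr.
  rewrite [RHS]exchange_big /=; apply: eq_bigr => j _.
  by rewrite !mulr_suml; apply: eq_bigr => l _; rewrite !mulrA.
under eq_bigr do under eq_bigr do rewrite mulrDr.
under eq_bigr do rewrite big_split /=.
rewrite big_split /= [X in _ + X]exchange_big /= -big_split /= mulr_sumr.
apply: eq_bigr => j _; rewrite mulr_suml mulr_sumr -big_split /=.
apply: eq_bigr => i _; rewrite (chart_metric_sym hG j i sc).
by ring.
Qed.

(** The factor [sigma t ^+ 2] has two uses: it dominates the difference quotients divided by the
    speed, and it shows that the varied energy vanishes where [c] pauses. *)
Lemma variation_energy_lip : exists2 K : R, 0 <= K &
  forall e t, `|e| < e0 -> D t -> `|X e t - X 0 t| <= `|e| * (K * sigma t ^+ 2).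
Proof.
have [K K0 HK] := variation_energy_deriv_le; exists K => // e t ee0 tD.
have bound a b : a <= b -> `|a| < e0 -> `|b| < e0 ->
    `|X b t - X a t| <= `|b - a| * (K * sigma t ^+ 2).
  move=> ab ae be.
  have abe s : a <= s <= b -> `|s| < e0.
    move: ae be; rewrite !ltr_norml => /andP[a1 a2] /andP[b1 b2] /andP[s1 s2].
    by rewrite (lt_le_trans a1)//= (le_lt_trans s2).
  have [s sab||s] := @MVT_segment R (X^~ t) (dX^~ t) a b ab.
  - apply: variation_energy_is_derive => //; apply: abe.
    by move: sab; rewrite in_itv /= => /andP[? ?]; rewrite !ltW.
  - apply: derivable_within_continuous => s; rewrite in_itv /= => sab.
    have H := variation_energy_is_derive (abe _ sab) tD.
    exact: (@ex_derive _ _ _ _ _ _ _ H).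
  rewrite in_itv /= => sab ->; rewrite normrM mulrC ler_wpM2l//.
  by apply: HK => //; exact/ltW/abe.
have [e_ge0|/ltW e_le0] := leP 0 e.
  by have := bound _ _ e_ge0; rewrite normr0 subr0; apply.
by rewrite distrC; have := bound _ _ e_le0; rewrite normr0 sub0r normrN; apply.
Qed.

Hypothesis y0 : forall j, y j 0 = 0.
Hypothesis y1 : forall j, y j 1 = 0.
Hypothesis c_min : forall c' xd', chart_C1 0 1 c' xd' -> c' 0 = c 0 -> c' 1 = c
  1 ->
  prim 0 sigma 1 <= prim 0 (speed G c' xd') 1.

Let quotient e t := (X e t - X 0 t) / e / sigma t.

Let c_quotient e : `|e| < e0 -> {within `[0, 1], continuous (quotient e)}.
Proof.
move=> ee0; have [K K0 HK] := variation_energy_lip.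
have cX s : `|s| < e0 -> {within `[0, 1], continuous (X s)}.
  move=> /ltW se0; have cs := chart_C1_variation se0.
  by apply: (within_continuous_metric hG ler01 cs) => j; exact: chart_C1_cont cs.
apply: (within_continuous_ratio (K := `|e| * K * `|e^-1|)).
- apply: within_continuousM; last exact: within_continuous_cst.
  by apply: within_continuous_sub; apply: cX => //; rewrite normr0.
- exact: within_continuous_speed ler01 cx.
move=> t; rewrite unit_itvE => tD; rewrite normrM mulrAC ler_wpM2r//.
by rewrite -mulrA; exact: HK.
Qed.

(* sqrt X <= (X / s + s) / 2, with equality at the unperturbed curve, turns the
   minimality of the length into an inequality for the energy. *)
Let quotient_le0 e : - e0 < e < 0 -> prim 0 (quotient e) 1 <= 0.
Proof.
move=> /andP[e1 e2]; have ee0 : `|e| < e0 by rewrite ltr0_norm// ltrNl.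
have ce := chart_C1_variation (ltW ee0).
have end_ t : (forall j, y j t = 0) -> variation e t = c t.
  move=> yt; rewrite /variation; have -> : (fun j => e * y j t) = fun=> 0.
    by apply/funext => j; rewrite yt mulr0.
  by rewrite frame_comb0 addr0.
have cs := within_continuous_speed hG ler01 cx.
have cse := within_continuous_speed hG ler01 ce.
have cq := c_quotient ee0.
have cr : {within `[0, 1], continuous (fun t => sigma t + e / 2 * quotient e t)}.
  apply: within_continuous_add => //; apply: within_continuousM => //.
  exact: within_continuous_cst.
have pt t : 0 < t < 1 -> speed G (variation e) (variation_velocity e) t <=
    sigma t + e / 2 * quotient e t.
  move=> /andP[t0 t1]; have tD : D t by rewrite /= !ltW.
  have X0 := variation_energy0 tD; have Xe := speed_variation (ltW ee0) tD.
  set se := speed G _ _ t in Xe *.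
  (* Where [c] pauses, the varied speed is 0 as well and [x / 0 = 0] makes both sides 0. *)
  have [s0|s0] := eqVneq (sigma t) 0.
    have [K K0 /(_ e t ee0 tD)] := variation_energy_lip.
    rewrite X0 s0 expr0n /= subr0 !mulr0 normr_le0 -Xe sqrf_eq0 => /eqP ->.
    by rewrite /quotient s0 invr0 !mulr0 addr0.
  have sp : 0 < sigma t by rewrite lt_neqAle eq_sym s0 speed_ge0.
  have -> : sigma t + e / 2 * quotient e t = (se ^+ 2 + sigma t ^+ 2) / (2 *
    sigma t).
    by rewrite /quotient -Xe X0; field; rewrite s0 lt_eqF.
  rewrite ler_pdivlMr ?mulr_gt0//.
  by have := sqr_ge0 (se - sigma t); nra.
(* Minimality bounds the length by itself plus [e / 2] times the integral of the quotient; since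
   [e < 0], that integral is at most 0. *)
have := le_trans (c_min ce (end_ 0 y0) (end_ 1 y1)) (le_prim ler01 cse cr pt).
by rewrite primD// lerDl nmulr_rge0// pmulr_llt0 ?invr_gt0.
Qed.

(** Negative [e] alone gives this inequality, and it suffices: for the test field chosen below, the
    integral is that of a nonnegative function, up to a boundary term equal to 0. *)
Lemma first_variation : prim 0 (fun t => dX 0 t / sigma t) 1 <= 0.
Proof.
(* The index [n.+2] keeps every [e_ n] strictly between [- e0] and 0, including [n = 0]. *)
pose e_ n := - (e0 / n.+2%:R) : R.
have e_lt n : - e0 < e_ n < 0.
  rewrite /e_ ltrN2 oppr_lt0 divr_gt0 ?ltr0n// andbT.
  by rewrite ltr_pdivrMr ?ltr0n// ltr_pMr// ltr1n.
have e_small n : `|e_ n| < e0.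
  by have /andP[? ?] := e_lt n; rewrite ltr0_norm// ltrNl.
have e_0 : e_ n @[n --> \oo] --> 0^'.
  have H : e_ n @[n --> \oo] --> 0.
    rewrite -oppr0 -[X in - X](mulr0 e0); apply: cvgN; apply: cvgM;
      first exact: cvg_cst.
    have := @cvg_harmonic R; rewrite -(@cvg_shiftS _ (@harmonic R)).
    exact.
  move=> U; rewrite /dnbhs /within /= => /H.
  rewrite /= !nbhs_simpl /=; apply: filterS => n; apply.
  by have /andP[_ /lt_eqF ->] := e_lt n.
have [K K0 HK] := variation_energy_lip.
have [Ks Ks0 HKs] := majorized_compact (@segment_compact _ 0 1)
  (within_continuous_speed hG ler01 cx).
have cdX : {within `[0, 1], continuous (dX 0)}.
  apply: (@eq_within_continuous _ _ _ (fun t => \sum_l y l t * metric_variation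
    G c xd l t +
      2 * \sum_j momentum G c xd j t * yd j t)).
    by move=> t; rewrite unit_itvE => tD; rewrite variation_energy_deriv0.
  apply: within_continuous_add.
    apply: within_continuous_sum => l; apply: within_continuousM => //.
    exact: (@within_continuous_metric_variation _ _ _ hG _ _ cx l).
  apply: within_continuousM; first exact: within_continuous_cst.
  apply: within_continuous_sum => j; apply: within_continuousM => //.
  exact: (@within_continuous_momentum _ _ _ hG _ _ cx j).
have cl : {within `[0, 1], continuous (fun t => dX 0 t / sigma t)}.
  have [M M0 HM] := variation_energy_deriv_le.
  apply: (within_continuous_ratio (K := M)) => //.
    exact: within_continuous_speed ler01 cx.
  by move=> t; rewrite unit_itvE => tD; apply: HM => //; rewrite normr0 ltW.
have lim : prim 0 (quotient (e_ n)) 1 @[n --> \oo] --> prim 0 (fun t => dX 0 t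
  / sigma t) 1.
  (* The quotient is at most [K * sigma t] in absolute value, and [Ks] bounds the speed. *)
  apply: (prim_dominated_cvg (K := K * Ks)) => //.
  - by move=> n; exact: c_quotient.
  - move=> t tD; apply: cvgM; last exact: cvg_cst.
    have H := variation_energy_is_derive (e := 0) (t := t).
    rewrite normr0 in H; have {}H := H e00 tD.
    have := @ex_derive _ _ _ _ _ _ _ H.
    rewrite /derivable; have := @derive_val _ _ _ _ _ _ _ H.
    rewrite /derive => -> H2; have {H2} := cvg_comp _ _ e_0 H2.
    apply: cvg_trans; apply: near_eq_cvg; near=> n.
    by rewrite /= /shift /= addr0 [e_ n *: 1]mulr1 mulrC.
  move=> n t tD; rewrite /quotient normrM normrM.
  have en0 : `|e_ n| != 0.
    by have /andP[_ /lt_eqF e_neq0] := e_lt n; rewrite normr_eq0 e_neq0.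
  apply: (@le_trans _ _ (`|e_ n| * (K * sigma t ^+ 2) * `|(e_ n)^-1| * `|(sigma
    t)^-1|)).
    by rewrite !ler_wpM2r//; exact: HK.
  rewrite normfV [X in X * _ <= _]mulrAC mulfV// mul1r expr2 normfV (ger0_norm
    (speed_ge0 _ _ _ _)).
  have [->|s0] := eqVneq (sigma t) 0;
    first by rewrite !mul0r mulr0 mul0r mulr_ge0.
  rewrite mulrA mulfK// ler_wpM2l//.
  by have := HKs t; rewrite unit_itvE mulr1 => /(_ tD);
    exact: le_trans (ler_norm _).
apply: (cvgr_to_le lim); apply: nearW => n; exact: quotient_le0.
Unshelve. all: by end_near. Qed.

End SmallParameter.
End EulerLagrange.

(** * The Euler-Lagrange equation in integrated form *)

Section EulerLagrangeEquation.
Context {R : realType} {m : nat} (G : 'cV[R]_m.+1 -> 'M[R]_m.+1).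
Hypothesis hG : risk_metric G.
Context (c : R -> 'cV[R]_m.+1) (xd : 'I_m -> R -> R).
Hypothesis cx : chart_C1 0 1 c xd.
Local Notation sigma := (speed G c xd).
Local Notation D := [set t : R | 0 <= t <= 1].
Local Notation q := (momentum G c xd).
Hypothesis c_length : 0 < prim 0 sigma 1.
Hypothesis c_min : forall c' xd', chart_C1 0 1 c' xd' -> c' 0 = c 0 -> c' 1 = c
  1 ->
  prim 0 sigma 1 <= prim 0 (speed G c' xd') 1.

Let P l := prim 0 (force G c xd l).
Let C l := prim 0 (fun t => q l t - sigma t * P l t) 1 / prim 0 sigma 1.
(* The momentum defect, divided by the speed, is the du Bois-Reymond test field;
   the constant C makes its primitive vanish at both ends. *)
Let yd l t := q l t - sigma t * (P l t + C l).
Let y l := prim 0 (yd l).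

Let c_sigma : {within `[0, 1], continuous sigma}.
Proof. exact: within_continuous_speed ler01 cx. Qed.

Let c_q l : {within `[0, 1], continuous (q l)}.
Proof. exact: (@within_continuous_momentum _ _ _ hG _ _ cx l). Qed.

Let P_C1 l : C1_deriv `[0, 1] (P l) (force G c xd l).
Proof. by apply: C1_deriv_prim ler01 _;
  exact: (@within_continuous_force _ _ _ hG _ _ cx l). Qed.

Let c_P l : {within `[0, 1], continuous (P l)}.
Proof. by have [] := P_C1 l. Qed.

Let c_yd l : {within `[0, 1], continuous (yd l)}.
Proof.
apply: within_continuous_sub => //; apply: within_continuousM => //.
by apply: within_continuous_add => //; exact: within_continuous_cst.
Qed.

Let y_C1 l : C1_deriv `[0, 1] (y l) (yd l).
Proof. exact: C1_deriv_prim ler01 (@c_yd l). Qed.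

Let y_0 l : y l 0 = 0.
Proof. exact: prim_left. Qed.

Let y_1 l : y l 1 = 0.
Proof.
have -> : y l 1 = prim 0 (fun t => (q l t - sigma t * P l t) + (- C l) * sigma
  t) 1.
  by apply: eq_prim => t _; rewrite /yd; ring.
rewrite primD//; last first.
  by apply: within_continuous_sub => //; exact: within_continuousM.
by rewrite mulNr divfK ?subrr// gt_eqF.
Qed.

Let yd_maj l : majorized D sigma (yd l).
Proof.
have c1 : {within `[0, 1], continuous (fun t => (-1) * (P l t + C l))}.
  apply: within_continuousM; first exact: within_continuous_cst.
  by apply: within_continuous_add => //; exact: within_continuous_cst.
have -> : yd l = fun t => q l t + (-1) * (P l t + C l) * sigma t.
  by apply/funext => t; rewrite /yd; ring.
apply: majorizedD; first exact: (majorized_momentum hG cx).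
apply: majorizedMl; last by exists 1 => // t _;
  rewrite mul1r ger0_norm// speed_ge0.
by rewrite -unit_itvE; apply: majorized_compact => //; exact: segment_compact.
Qed.

Let defect t := \sum_l yd l t * yd l t / sigma t.

Let c_defect : {within `[0, 1], continuous defect}.
Proof.
apply: within_continuous_sum => l.
apply: (within_continuous_over_speed hG cx); first exact: within_continuousM.
exact: majorizedM.
Qed.

(** The first variation splits into [2 * defect] and [2 * power]. The second term is an exact
    derivative, and [work] vanishes with [y] at both ends. *)
Let work t := \sum_l (P l t + C l) * y l t.
Let power t := \sum_l ((P l t + C l) * yd l t + y l t * (force G c xd l t + 0)).

Let work_C1 : C1_deriv `[0, 1] work power.
Proof.
apply: C1_deriv_sum => l; apply: C1_derivM => //.
by apply: C1_derivD => //; exact: C1_deriv_cst.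
Qed.

(** Integrated form of [(q / sigma)' = force]: it makes sense for a curve that is merely C^1, and
    also at the zeros of the speed. *)
Lemma euler_lagrange : exists C : 'I_m -> R, forall t, 0 < t < 1 ->
  forall l, q l t = sigma t * (prim 0 (force G c xd l) t + C l).
Proof.
exists C => t t01 l.
have [e0 e00 sV] := variation_simplex cx y_C1.
have := first_variation hG cx y_C1 yd_maj e00 sV y_0 y_1 c_min.
have -> : prim 0 (fun t => variation_energy_deriv G c xd y yd 0 t / sigma t) 1 =
    prim 0 (fun t => 2 * defect t + 2 * power t) 1.
  apply: eq_prim => s sD; rewrite (variation_energy_deriv0 hG cx y yd sD).
  rewrite mulrDl mulr_suml !mulr_sumr mulr_suml -!big_split /=.
  apply: eq_bigr => k _; rewrite /force.
  (* At a zero of the speed [yd] vanishes too, being majorized by the speed, and both sides are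
     0. *)
  have [s0|s0] := eqVneq (sigma s) 0; last first.
    rewrite (_ : q k s = yd k s + sigma s * (P k s + C k));
      last by rewrite /yd; ring.
    by field.
  have yd0 : yd k s = 0.
    by have [K _ /(_ s sD)] := yd_maj k; rewrite s0 mulr0 normr_le0 => /eqP.
  by rewrite s0 yd0 invr0; ring.
have c2d : {within `[0, 1], continuous (fun t => 2 * defect t)}.
  by apply: within_continuousM => //; exact: within_continuous_cst.
have [_ c_power _] := work_C1.
rewrite primD// (prim_FTC ler01 work_C1).
have -> : work 1 - work 0 = 0.
  by rewrite /work !big1 ?subrr// => k _; rewrite ?y_0 ?y_1 mulr0.
rewrite mulr0 addr0 => /(prim_ge0_eq0 ltr01 c2d) H.
have tD : 0 <= t <= 1 by have /andP[? ?] := t01; rewrite !ltW.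
have d0 k s : 0 <= yd k s * yd k s / sigma s.
  by rewrite divr_ge0 ?speed_ge0// -expr2 sqr_ge0.
have /eqP : 2 * defect t = 0.
  by apply: H => // s _; rewrite mulr_ge0// sumr_ge0.
rewrite mulf_eq0 pnatr_eq0 /= psumr_eq0// => /allP /(_ l (mem_index_enum l)) /=.
(* Either [yd] vanishes, which is the claim, or the speed does, and then so does the momentum. *)
rewrite mulf_eq0 mulf_eq0 orbb invr_eq0 => /orP[/eqP|/eqP s0].
  by rewrite /yd => /eqP; rewrite subr_eq0 => /eqP.
have [K _ /(_ t tD)] := majorized_momentum hG cx l.
by rewrite s0 mulr0 mul0r normr_le0 => /eqP.
Qed.

End EulerLagrangeEquation.

(** * Arc length and the geodesic equation *)

Section Reparametrization.
Context {R : realType}.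
Implicit Types (f g k : R -> R) (a b : R).

(** The increment of the product is the moved value of [f] times the increment of [g], so continuity
    of [f] is enough. It serves with an entry of the inverse metric as [f]. *)
Lemma is_derive_mul0 f g (t dg : R) : {for t, continuous f} -> g t = 0 ->
  is_derive t (1 : R) g dg ->
  is_derive t (1 : R) (fun s => f s * g s) (f t * dg).
Proof.
move=> cf g0 hg.
have key : h^-1 *: (f (h *: 1 + t) * g (h *: 1 + t) - f t * g t) @[h --> 0^']
  --> f t * dg.
  have H := @ex_derive _ _ _ _ _ _ _ hg; have E := @derive_val _ _ _ _ _ _ _ hg.
  rewrite /derivable in H; rewrite /derive in E; rewrite E in H.
  have ht : (h *: 1 : R) + t @[h --> (0 : R)^'] --> t.
    rewrite -[X in _ --> X]add0r; apply: cvgD; last exact: cvg_cst.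
    apply: cvg_within_filter; under eq_fun do rewrite [_ *: _]mulr1.
    exact: cvg_id.
  have fc : f (h *: 1 + t) @[h --> 0^'] --> f t by exact: (cvg_comp _ _ ht cf).
  apply: cvg_trans (cvgM fc H); apply: near_eq_cvg; near=> h.
  rewrite /= /shift /= g0 !mulr0 !subr0.
  by rewrite [in LHS]/GRing.scale /= mulrCA.
apply: DeriveDef; last exact: cvg_lim key.
by apply/cvg_ex; exists (f t * dg).
Unshelve. all: by end_near. Qed.

(** Interior points must be sent to interior points because [f] has a two-sided derivative only
    there. *)
Lemma C1_deriv_comp a b a' b' f g (h dh : R -> R) :
  C1_deriv `[a', b'] f g -> C1_deriv `[a, b] h dh ->
  (forall t, a <= t <= b -> a' <= h t <= b') ->
  (forall t, a < t < b -> a' < h t < b') ->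
  C1_deriv `[a, b] (fun t => f (h t)) (fun t => g (h t) * dh t).
Proof.
move=> fg hh hab hoo; have [cf cg _] := fg; have [ch cdh _] := hh.
have into t : `[a, b]%classic t -> `[a', b']%classic (h t).
  by rewrite /= !in_itv; exact: hab.
apply: mkC1_deriv.
- exact: within_continuous_comp cf.
- by apply: within_continuousM => //; exact: within_continuous_comp cg.
move=> t tab; apply: (@is_derive1_comp R f h).
  by apply: C1_deriv_derive fg _; exact: hoo.
exact: C1_deriv_derive hh tab.
Qed.

Definition clamp (s : R) : R := Num.max 0 (Num.min 1 s).

Lemma clamp_itv s : 0 <= clamp s <= 1.
Proof. by rewrite /clamp le_max lexx ge_max ler01 ge_min lexx. Qed.

Lemma clampK s : 0 <= s <= 1 -> clamp s = s.
Proof. by move=> /andP[s0 s1]; rewrite /clamp min_r// max_r. Qed.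

Lemma clamp_lip s t : `|clamp s - clamp t| <= `|s - t|.
Proof.
have clampE u : [\/ u <= 0 /\ clamp u = 0, 0 <= u <= 1 /\ clamp u = u |
    1 <= u /\ clamp u = 1].
  have [u0|u0] := leP u 0.
    by apply: Or31; rewrite /clamp min_r ?max_l// (le_trans u0).
  have [u1|/ltW u1] := leP u 1.
    by apply: Or32; rewrite clampK (ltW u0) ?u1.
  by apply: Or33; rewrite /clamp min_l// max_r.
have H1 := ler_norm (s - t); have H2 := ler_norm (t - s).
rewrite distrC in H2; rewrite ler_norml.
by case: (clampE s) => -[] => [? ->|/andP[? ?] ->|? ->];
  case: (clampE t) => -[] => [? ->|/andP[? ?] ->|? ->]; apply/andP; split; lra.
Qed.

Lemma lipschitz_within a b f (K : R) :
  (forall s t, a <= s <= b -> a <= t <= b -> `|f s - f t| <= K * `|s - t|) ->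
  {within `[a, b], continuous f}.
Proof.
move=> fK; apply/within_cvgP => s; rewrite /= in_itv /= => sab.
apply/cvgrPdist_lt => e e0; have K1 : 0 < `|K| + 1 by rewrite ltr_wpDl.
rewrite /prop_near1 /within /= !nbhs_simpl /=.
have : \forall t \near s, `|s - t| < e / (`|K| + 1).
  have /cvgrPdist_lt : t @[t --> s] --> s by exact: cvg_id.
  by apply; rewrite divr_gt0.
apply: filterS => t; rewrite ltr_pdivlMr// => st; rewrite in_itv /= => tab.
apply: le_lt_trans (fK _ _ sab tab) _; apply: le_lt_trans st; rewrite mulrC.
by rewrite ler_wpM2l// (le_trans (ler_norm _))// lerDl.
Qed.

(* Two-sided derivatives at 0 and 1 are needed: arc length may take these values
   at interior times. *)
Lemma primitive_itv k : {within `[0, 1], continuous k} ->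
  exists K : R -> R, forall s : R, 0 <= s <= 1 -> is_derive s (1 : R) K (k s).
Proof.
move=> ck; exists (prim (-1) (k \o clamp)) => s s01;
  rewrite -[in k s](clampK s01).
have cc : {within `[-1, 2], continuous (k \o clamp)}.
  apply: (within_continuous_comp _ _ ck).
    apply: (lipschitz_within (K := 1)) => u v _ _; rewrite mul1r.
    exact: clamp_lip.
  by move=> u _; rewrite /= in_itv /= clamp_itv.
have n12 : -1 <= 2 :> R by lra.
by apply: C1_deriv_derive (C1_deriv_prim n12 cc) _; lra.
Qed.

End Reparametrization.

(** * Factoring functions through arc length *)

Section ArcLength.
Context {R : realType} {m : nat} (G : 'cV[R]_m.+1 -> 'M[R]_m.+1).
Hypothesis hG : risk_metric G.
Implicit Types (a b : R) (f : R -> R).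
Local Notation frame := (@chart_frame R m).

Lemma momentumK w (x : 'I_m -> R) k : simplex w ->
  \sum_l invmx (chart_metric G w) k l * (\sum_i chart_metric G w i l * x i) = x k.
Proof.
move=> sw; under eq_bigr => l _.
  rewrite mulr_sumr; under eq_bigr do rewrite mulrA (chart_metric_sym hG _ _ sw).
  over.
rewrite exchange_big /= -[RHS](sum_delta k x); apply: eq_bigr => i _.
rewrite -mulr_suml; congr (_ * _).
have := mulVmx (chart_metric_unit hG sw) => /matrixP /(_ k i).
by rewrite !mxE [i == k]eq_sym.
Qed.

Lemma momentumVK w (p : 'I_m -> R) l : simplex w ->
  \sum_i chart_metric G w i l * (\sum_j invmx (chart_metric G w) i j * p j) = p l.
Proof.
move=> sw; under eq_bigr => i _.
  rewrite mulr_sumr; under eq_bigr do rewrite mulrA (chart_metric_sym hG _ _ sw).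
  over.
rewrite exchange_big /= -[RHS](sum_delta l p); apply: eq_bigr => j _.
rewrite -mulr_suml; congr (_ * _).
have := mulmxV (chart_metric_unit hG sw) => /matrixP /(_ l j).
by rewrite !mxE [j == l]eq_sym.
Qed.

Lemma C1_deriv_chart a b (c : R -> 'cV[R]_m.+1) xd : a <= b ->
  chart_C1 a b c xd -> C1_deriv `[a, b] c (fun t => frame_comb (xd^~ t)).
Proof.
move=> ab cx; split.
- apply/within_continuous_mxP => i j.
  apply: (chart_C1_comp (f := fun w => w i j) ab cx).
  by apply: continuous_subspaceT => w; exact: coord_continuous.
- apply: (@eq_within_continuous _ _ _ (fun t => 0 + frame_comb (xd^~ t))).
    by move=> t _; rewrite add0r.
  by apply: within_continuous_affine => j; exact: chart_C1_cont cx.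
by move=> t; rewrite interior_itv /= in_itv /=; exact: chart_C1_is_derive cx.
Qed.

Lemma C1_deriv_frame_comb (D : set R) (w dw : 'I_m -> R -> R) :
  (forall j, C1_deriv D (w j) (dw j)) ->
  C1_deriv D (fun t => frame_comb (w^~ t)) (fun t => frame_comb (dw^~ t)).
Proof.
move=> hw; apply/C1_deriv_mxP => i k; rewrite ord1.
apply: (@eq_C1_deriv _ _ _ (fun t => \sum_j frame j i 0 * w j t) _
    (fun t => \sum_j frame j i 0 * dw j t)).
- by move=> t _; rewrite summxE; apply: eq_bigr => j _; rewrite [RHS]mxE mulrC.
- by move=> t _; rewrite summxE; apply: eq_bigr => j _; rewrite [RHS]mxE mulrC.
by apply: C1_deriv_sum => j; exact: C1_derivZ.
Qed.

Context (c : R -> 'cV[R]_m.+1) (xd : 'I_m -> R -> R).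
Hypothesis cx : chart_C1 0 1 c xd.
Local Notation sigma := (speed G c xd).
Local Notation q := (momentum G c xd).
Local Notation L := (prim 0 sigma 1).
Local Notation ell := (prim 0 sigma).
Hypothesis c_length : 0 < L.

Let c_sigma : {within `[0, 1], continuous sigma}.
Proof. exact: within_continuous_speed ler01 cx. Qed.

Let ell_C1 : C1_deriv `[0, 1] ell sigma.
Proof. exact: C1_deriv_prim ler01 c_sigma. Qed.

Lemma ell_ndecr s t : 0 <= s -> s <= t -> t <= 1 -> ell s <= ell t.
Proof. by apply: (C1_deriv_ndecr ell_C1) => u _; exact: speed_ge0. Qed.

Lemma ell_itv t : 0 <= t <= 1 -> 0 <= ell t / L <= 1.
Proof.
move=> /andP[t0 t1]; rewrite ler_pdivrMr// mul1r ell_ndecr// andbT.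
have := ell_ndecr (lexx 0) t0 t1; rewrite prim_left => e0.
by rewrite divr_ge0 ?(ltW c_length).
Qed.

(** The range condition sits under the existential so that choice yields a function on all of [R].
    Existence is the intermediate value theorem. *)
Lemma ell_surj s : exists t, 0 <= s <= 1 -> 0 <= t <= 1 /\ ell t = L * s.
Proof.
have [s01|ns] := boolP (0 <= s <= 1); last by exists 0.
have [ce _ _] := ell_C1.
have [|t] := IVT (v := L * s) ler01 ce.
  rewrite prim_left; have /andP[s0 s1] := s01.
  rewrite ge_min le_max (mulr_ge0 (ltW c_length) s0)/=.
  by rewrite ler_piMr ?orbT// ltW.
by rewrite in_itv /= => t01 ts; exists t.
Qed.

(** An arbitrary right inverse of normalised arc length; it may jump where the curve pauses. *)
Definition arc_inv (s : R) : R := sval (cid (ell_surj s)).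
Local Notation T := arc_inv.

Lemma arc_invP s : 0 <= s <= 1 -> 0 <= T s <= 1 /\ ell (T s) = L * s.
Proof. by rewrite /arc_inv; case: cid. Qed.

(** Both [K * ell - f] and [K * ell + f] are nondecreasing. Consequently [f] takes a single value on
    each level set of [ell], whichever time [arc_inv] selects. *)
Lemma level_lip f df : C1_deriv `[0, 1] f df ->
  (exists2 K, 0 <= K & forall t, 0 < t < 1 -> `|df t| <= K * sigma t) ->
  exists2 K, 0 <= K & forall s t, 0 <= s <= 1 -> 0 <= t <= 1 ->
    `|f s - f t| <= K * `|ell s - ell t|.
Proof.
move=> hf [K K0 HK]; exists K => // s t.
wlog st : s t / s <= t.
  move=> H s01 t01; have [st|/ltW ts] := leP s t; first exact: H.
  by rewrite distrC [`|ell s - _|]distrC; exact: H.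
move=> /andP[s0 s1] /andP[t0 t1].
have bnd (e : R) : `|e| = 1 -> e * (f t - f s) <= K * (ell t - ell s).
  move=> e1; rewrite -subr_ge0.
  have H := C1_derivB (C1_derivZ K ell_C1) (C1_derivZ e hf).
  have : K * ell s - e * f s <= K * ell t - e * f t.
    apply: (C1_deriv_ndecr H) => // u u01; rewrite subr_ge0.
    by rewrite (le_trans (ler_norm _))// normrM e1 mul1r HK.
  by move=> ?; lra.
rewrite distrC [`|ell s - _|]distrC (ger0_norm (_ : 0 <= ell t - ell s)).
  rewrite ler_norml -lerNl -mulN1r bnd ?normrN ?normr1//=.
  by rewrite -[X in X <= _]mul1r bnd// normr1.
by rewrite subr_ge0 ell_ndecr.
Qed.

Lemma level_quotient f df : C1_deriv `[0, 1] f df ->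
  (exists2 K, 0 <= K & forall t, 0 < t < 1 -> `|df t| <= K * sigma t) ->
  {within `[0, 1], continuous (fun s => f (T s))} /\
  forall t, 0 <= t <= 1 -> f (T (ell t / L)) = f t.
Proof.
move=> hf H; have [K K0 HK] := level_lip hf H; split.
  apply: (lipschitz_within (K := K * L)) => s t s01 t01.
  have [Ts eTs] := arc_invP s01; have [Tt eTt] := arc_invP t01.
  apply: (le_trans (HK _ _ Ts Tt)).
  by rewrite eTs eTt -mulrBr normrM (gtr0_norm c_length) mulrA.
move=> t t01; have [Tt eTt] := arc_invP (ell_itv t01).
apply/eqP; rewrite -subr_eq0 -normr_le0 (le_trans (HK _ _ Tt t01))//.
by rewrite eTt [L * _]mulrC divfK ?gt_eqF// subrr normr0 mulr0.
Qed.

(** [arc_inv] is never differentiated. If [K] is a primitive of [k], then [f] and [L * K (ell / L)]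
    have the same derivative and differ by a constant; composition with [arc_inv] turns [ell / L]
    into the parameter itself. *)
Lemma level_C1 f df (k : R -> R) : C1_deriv `[0, 1] f df ->
  {within `[0, 1], continuous k} ->
  (forall t, 0 < t < 1 -> df t = sigma t * k (ell t / L)) ->
  C1_deriv `[0, 1] (fun s => f (T s)) (fun s => L * k s).
Proof.
move=> hf ck fk; have [K KE] := primitive_itv ck.
have L0 : L != 0 by rewrite gt_eqF.
have KC1 : C1_deriv `[0, 1] K k.
  apply: mkC1_deriv => //; last by move=> t /andP[t0 t1]; apply: KE; rewrite !ltW.
  apply: derivable_within_continuous => t; rewrite in_itv /= => t01.
  exact: (@ex_derive _ _ _ _ _ _ _ (KE t t01)).
have KL : C1_deriv `[0, 1] (fun t => L * K (ell t / L)) (fun t => sigma t * k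
  (ell t / L)).
  have into t : `[0, 1]%classic t -> `[0, 1]%classic (ell t / L).
    by rewrite /= !in_itv; exact: ell_itv.
  have cel : {within `[0, 1], continuous (fun t => ell t / L)}.
    by apply: within_continuousM;
      [have [] := ell_C1|exact: within_continuous_cst].
  have [cK _ _] := KC1.
  apply: mkC1_deriv.
  - apply: within_continuousM; first exact: within_continuous_cst.
    exact: within_continuous_comp cK.
  - by apply: within_continuousM => //; exact: within_continuous_comp ck.
  move=> t t01; have t01' : 0 <= t <= 1 by have /andP[? ?] := t01; rewrite !ltW.
  have H1 : is_derive t (1 : R) (fun u => ell u / L) (sigma t / L).
    have := is_derive_mul (C1_deriv_derive ell_C1 t01) (is_derive_cst L^-1 t (1
      : R)).
    by rewrite mulr0 addr0.
  have H2 := @is_derive1_comp R K (fun u => ell u / L) t _ _ (KE _ (ell_itv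
    t01')) H1.
  apply: (is_derive_eq (is_deriveZ L H2)).
  rewrite (_ : L *: _ = L * (k (ell t / L) * (sigma t / L)))//.
  by field.
have fE t : 0 <= t <= 1 -> f t = L * K (ell t / L) + (f 0 - L * K 0).
  move=> t01; have := C1_deriv_const (C1_derivB hf KL).
  have H u : 0 < u < 1 -> df u - sigma u * k (ell u / L) = 0.
    by move=> u01; rewrite fk// subrr.
  move=> /(_ H t 0 t01); rewrite lexx ler01 prim_left mul0r => /(_ isT) E.
  by lra.
apply: (@eq_C1_deriv _ _ _ (fun s => L * K s + (f 0 - L * K 0)) _ (fun s => L *
  k s + 0)).
- move=> s; rewrite /= in_itv /= => /arc_invP [Ts eTs].
  by rewrite [RHS]fE// eTs [L * s / L]mulrAC divff// mul1r.
- by move=> s _; rewrite addr0.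
by apply: C1_derivD; [exact: C1_derivZ|exact: C1_deriv_cst].
Qed.

End ArcLength.

(** * The geodesic equation for the arc length quotient of a minimiser *)

Section GeodesicOfMinimiser.
Context {R : realType} {m : nat} (G : 'cV[R]_m.+1 -> 'M[R]_m.+1).
Hypothesis hG : risk_metric G.
Context (c : R -> 'cV[R]_m.+1) (xd : 'I_m -> R -> R).
Hypothesis cx : chart_C1 0 1 c xd.
Local Notation sigma := (speed G c xd).
Local Notation q := (momentum G c xd).
Local Notation L := (prim 0 sigma 1).
Local Notation ell := (prim 0 sigma).
Hypothesis c_length : 0 < L.
Context (C : 'I_m -> R).
Local Notation P := (fun l => prim 0 (force G c xd l)).
Hypothesis q_eq : forall t, 0 < t < 1 -> forall l, q l t = sigma t * (P l t + C
  l).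
Local Notation T := (arc_inv hG cx c_length).

(** [d] is the curve as a function of normalised arc length, [p] its momentum and [V] its velocity,
    both per unit of arc length, [V] being [p] with the index raised; [W] is the force rewritten in
    [V]. Factors [L] appear below because the parameter runs over [[0, 1]]. *)
Let d s := c (T s).
Let p l s := P l (T s) + C l.
Let V k s := \sum_l invmx (chart_metric G (d s)) k l * p l s.
Let W l s := 2^-1 * \sum_i \sum_j d_metric G l i j (d s) * V i s * V j s.

Let d_simplex s : 0 <= s <= 1 -> simplex (d s).
Proof. by move=> /(arc_invP hG cx c_length) [Ts _]; exact: cx.1. Qed.

Let oo_cc (t : R) : 0 < t < 1 -> 0 <= t <= 1.
Proof. by move=> /andP[? ?]; rewrite !ltW. Qed.

Let d_coord j : {within `[0, 1], continuous (fun s => chart_coord (d s) j)} /\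
  forall t, 0 <= t <= 1 -> chart_coord (d (ell t / L)) j = chart_coord (c t) j.
Proof.
apply: (level_quotient hG cx c_length (cx.2 j)).
have [K K0 H] := majorized_velocity hG cx j.
by exists K => // t /oo_cc; exact: H.
Qed.

Let d_ell t : 0 <= t <= 1 -> d (ell t / L) = c t.
Proof.
move=> t01; apply: tangent_chart_inj => [|j]; last exact: (d_coord j).2.
apply: simplex_tangent; last exact: cx.1.
by apply: d_simplex; exact: ell_itv.
Qed.

Let P_C1 l : C1_deriv `[0, 1] (P l) (force G c xd l).
Proof. by apply: C1_deriv_prim ler01 _;
  exact: (@within_continuous_force _ _ _ hG _ _ cx l). Qed.

Let p_level l : {within `[0, 1], continuous (fun s => P l (T s))} /\
  forall t, 0 <= t <= 1 -> P l (T (ell t / L)) = P l t.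
Proof.
apply: (level_quotient hG cx c_length (P_C1 l)).
have [K K0 H] := majorized_metric_variation hG cx l.
exists (2^-1 * K) => [|t t01]; first by rewrite mulr_ge0.
rewrite /force !normrM !normfV normr_nat (ger0_norm (speed_ge0 G c xd t)).
have [->|s0] := eqVneq (sigma t) 0; first by rewrite invr0 !mulr0.
rewrite -!mulrA ler_wpM2l// ler_pdivrMr ?lt_neqAle ?speed_ge0 1?eq_sym ?s0//.
by rewrite -mulrA; apply: H; exact: oo_cc.
Qed.

Let c_p l : {within `[0, 1], continuous (p l)}.
Proof.
by apply: within_continuous_add;
  [have [] := p_level l|exact: within_continuous_cst].
Qed.

Let c_comp (f : 'cV[R]_m.+1 -> R) : {within simplex, continuous f} ->
  {within `[0, 1], continuous (fun s => f (d s))}.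
Proof.
apply: within_continuous_comp => [|s]; last by rewrite /= in_itv;
  exact: d_simplex.
apply: (@eq_within_continuous _ _ _ (fun s => c 0 + frame_comb
    (fun j => chart_coord (d s) j - chart_coord (c 0) j))).
  move=> s; rewrite /= in_itv /= => s01.
  rewrite -simplex_comb//; first exact: d_simplex.
  by apply: cx.1; rewrite lexx ler01.
apply: (@within_continuous_affine _ _ _ _ _ (fun j s => chart_coord (d s) j -
  chart_coord (c 0) j)).
move=> j; apply: within_continuous_sub; last exact: within_continuous_cst.
by have [] := d_coord j.
Qed.

Let c_V k : {within `[0, 1], continuous (V k)}.
Proof.
apply: within_continuous_sum => l; apply: within_continuousM => //.
exact: (c_comp (@within_continuous_invmx _ _ _ hG k l)).
Qed.

Let c_dG l i j : {within `[0, 1], continuous (fun s => d_metric G l i j (d s))}.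
Proof.
by have [_ /(_ l) [H _]] := C1_simplex_chart_metric hG i j; exact: c_comp H.
Qed.

Let c_W l : {within `[0, 1], continuous (W l)}.
Proof.
apply: within_continuousM; first exact: within_continuous_cst.
apply: within_continuous_sum => i; apply: within_continuous_sum => j.
by apply: within_continuousM => //; exact: within_continuousM.
Qed.

(** The integrated Euler-Lagrange equation with its index raised. *)
Let velocityE t : 0 < t < 1 -> forall k, xd k t = sigma t * V k (ell t / L).
Proof.
move=> t01 k; have t01' := oo_cc t01; have sc := cx.1 t t01'.
rewrite -(momentumK hG (xd^~ t) k sc) /V d_ell// mulr_sumr.
apply: eq_bigr => l _; rewrite -[X in _ * X]/(q l t) q_eq// /p (p_level l).2//.
by rewrite mulrCA.
Qed.

Let d_C1 : chart_C1 0 1 d (fun j s => L * V j s).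
Proof.
split=> [s|j]; first exact: d_simplex.
by apply: (level_C1 hG cx c_length (cx.2 j) (@c_V j)) => t /velocityE; exact.
Qed.

Let p_C1 l : C1_deriv `[0, 1] (p l) (fun s => L * W l s).
Proof.
apply: (@eq_C1_deriv _ _ _ (fun s => P l (T s) + C l) _ (fun s => L * W l s +
  0)) => //.
  by move=> s _; rewrite addr0.
apply: C1_derivD; last exact: C1_deriv_cst.
apply: (level_C1 hG cx c_length (P_C1 l) (@c_W l)) => t t01.
rewrite /force /metric_variation /W (d_ell (oo_cc t01)).
have [s0|s0] := eqVneq (sigma t) 0; first by rewrite s0 invr0 mulr0 mul0r.
rewrite (_ : \sum_i \sum_j _ = sigma t ^+ 2 *
  \sum_i \sum_j d_metric G l i j (c t) * V i (ell t / L) * V j (ell t / L)).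
  by field.
rewrite mulr_sumr; apply: eq_bigr => i _; rewrite mulr_sumr;
  apply: eq_bigr => j _.
by rewrite !velocityE//; ring.
Qed.

Let DV k s := \sum_l invmx (chart_metric G (d s)) k l * (L * W l s -
   \sum_i (\sum_j (L * V j s) * d_metric G j i l (d s)) * V i s).

Let V_is_derive k (s : R) : 0 < s < 1 -> is_derive s (1 : R) (V k) (DV k s).
Proof.
move=> s01; have ss := d_simplex (oo_cc s01).
pose r l u := p l u - \sum_i chart_metric G (d u) i l * V i s.
have VE u : 0 <= u <= 1 ->
    V k s + \sum_l invmx (chart_metric G (d u)) k l * r l u = V k u.
  move=> u01; rewrite /r; under eq_bigr do rewrite mulrBr.
  rewrite sumrB (momentumK hG (V^~ s) k (d_simplex u01)).
  by rewrite addrC subrK.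
have r0 l : r l s = 0 by rewrite /r (momentumVK hG (p^~ s) l ss) subrr.
have dr l : is_derive s (1 : R) (r l) (L * W l s -
    \sum_i (\sum_j (L * V j s) * d_metric G j i l (d s)) * V i s).
  apply: is_deriveB; first exact: C1_deriv_derive (p_C1 l) s01.
  apply: is_derive_bigsum => i.
  have H := chart_C1_chain d_C1 (C1_simplex_chart_metric hG i l) s01.
  apply: (is_derive_eq (is_derive_mul H (is_derive_cst (V i s) s (1 : R)))).
  by rewrite mulr0 addr0.
have : is_derive s (1 : R)
    (fun u => V k s + \sum_l invmx (chart_metric G (d u)) k l * r l u) (DV k s).
  rewrite -[DV k s]add0r; apply: is_deriveD; apply: is_derive_bigsum => l.
  apply: is_derive_mul0 => //.
  apply: (within_continuous_continuous ltr01 (c_comp (@within_continuous_invmx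
    _ _ _ hG k l))).
  by rewrite in_itv.
apply: near_eq_is_derive.
have : \near s, s \in `]0, 1[ by apply: near_in_itvoo; rewrite in_itv.
by apply: filterS => u; rewrite in_itv /= => /oo_cc; exact: VE.
Qed.

Let acceleration k s := - \sum_i \sum_j christoffel G k i j (d s) *
  (L * V i s) * (L * V j s).

(** [S1] comes from differentiating the metric along the curve. Written once in each order of its
    summation indices, it gives the two positive terms of the Christoffel symbol; [S2], which comes
    from the force, gives the negative one. *)
Let DV_christoffel k (s : R) : L * DV k s = acceleration k s.
Proof.
rewrite /acceleration /DV.
pose S1 l := \sum_i \sum_j d_metric G j i l (d s) * V i s * V j s.
have E l : L * W l s - \sum_i (\sum_j L * V j s * d_metric G j i l (d s)) * V i
  s =
    L * W l s - L * S1 l.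
  congr (_ - _); rewrite mulr_sumr; apply: eq_bigr => i _.
  by rewrite mulr_suml mulr_sumr; apply: eq_bigr => j _; ring.
under eq_bigr do rewrite E.
pose S2 l := \sum_i \sum_j d_metric G l i j (d s) * V i s * V j s.
have H : \sum_i \sum_j christoffel G k i j (d s) * (L * V i s) * (L * V j s) =
    \sum_l invmx (chart_metric G (d s)) k l * (2^-1 * L ^+ 2 * (S1 l + S1 l -
      S2 l)).
  have S1E l : S1 l = \sum_i \sum_j d_metric G i j l (d s) * V i s * V j s.
    rewrite /S1 exchange_big /=; apply: eq_bigr => i _; apply: eq_bigr => j _.
    by rewrite mulrAC.
  transitivity (\sum_i \sum_j \sum_l invmx (chart_metric G (d s)) k l *
    (2^-1 * L ^+ 2 * ((d_metric G i j l (d s) + d_metric G j i l (d s) -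
       d_metric G l i j (d s)) * V i s * V j s))).
    apply: eq_bigr => i _; apply: eq_bigr => j _.
    rewrite /christoffel mulr_sumr !mulr_suml; apply: eq_bigr => l _.
    by ring.
  under eq_bigr do rewrite exchange_big /=.
  rewrite exchange_big /=; apply: eq_bigr => l _.
  rewrite [X in X + _ - _]S1E /S1 /S2 -big_split -sumrB /= !mulr_sumr.
  apply: eq_bigr => i _; rewrite -big_split -sumrB /= !mulr_sumr.
  by apply: eq_bigr => j _; rewrite mulrA; ring.
rewrite H -sumrN mulr_sumr; apply: eq_bigr => l _.
by rewrite /W -/(S2 l); field.
Qed.

Lemma geodesic_of_minimiser : exists e : R -> 'cV[R]_m.+1, geodesic G e /\
  forall t, 0 <= t <= 1 -> c t = e (ell t / L).
Proof.
exists d; split; last by move=> t /d_ell.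
split=> [s|]; first by rewrite in_itv; exact: d_simplex.
exists (fun s => frame_comb (fun j => L * V j s)).
exists (fun s => frame_comb (fun k => acceleration k s)); split.
- exact: C1_deriv_chart ler01 d_C1.
- apply: C1_deriv_frame_comb => k.
  apply: mkC1_deriv.
  + by apply: within_continuousM => //; exact: within_continuous_cst.
  + rewrite /acceleration; apply: (@eq_within_continuous _ _ _ (fun s =>
      (-1) * \sum_i \sum_j christoffel G k i j (d s) * (L * V i s) * (L * V j
        s))).
      by move=> s _; rewrite mulN1r.
    apply: within_continuousM; first exact: within_continuous_cst.
    apply: within_continuous_sum => i; apply: within_continuous_sum => j.
    apply: within_continuousM; last first.
      by apply: within_continuousM => //; exact: within_continuous_cst.
    apply: within_continuousM; last first.
      by apply: within_continuousM => //; exact: within_continuous_cst.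
    exact: (c_comp (@within_continuous_christoffel _ _ _ hG k i j)).
  move=> s s01; rewrite -DV_christoffel.
  exact: is_deriveZ (V_is_derive k s01).
move=> s s01 k; rewrite chart_coord_comb /acceleration.
under [X in _ + X]eq_bigr do under eq_bigr do rewrite !chart_coord_comb.
by rewrite addrC subrr.
Qed.

End GeodesicOfMinimiser.

(** * Piecewise C^1 curves *)

Section Gluing.
Context {R : realType}.
Implicit Types (a b x : R).

Lemma itv_split a x b : a <= x <= b ->
  `[a, b]%classic = `[a, x]%classic `|` `[x, b]%classic.
Proof.
move=> /andP[ax xb]; apply/seteqP; split=> t; rewrite /= !in_itv /=.
  by move=> /andP[at_ tb]; have [tx|/ltW xt] := leP t x; [left|right]; apply/andP.
case=> /andP[h1 h2]; apply/andP; split=> //; first exact: le_trans xb.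
exact: le_trans h1.
Qed.

Lemma within_continuous_glue (S : topologicalType) a x b (f : R -> S) :
  a <= x <= b -> {within `[a, x], continuous f} -> {within `[x, b], continuous
    f} ->
  {within `[a, b], continuous f}.
Proof.
move=> axb c1 c2; rewrite (itv_split axb).
by apply: withinU_continuous => //; exact: interval_closed.
Qed.

(** On both pieces [f] differs from one primitive of [g] by the same constant, and that primitive is
    differentiable at the junction. *)
Lemma C1_deriv_glue a x b (f g : R -> R) : a <= x <= b ->
  C1_deriv `[a, x] f g -> C1_deriv `[x, b] f g -> C1_deriv `[a, b] f g.
Proof.
move=> axb f1 f2; have /andP[ax xb] := axb; have ab := le_trans ax xb.
have [_ g1 _] := f1; have [_ g2 _] := f2.
have cg := within_continuous_glue axb g1 g2.
have pg := C1_deriv_prim ab cg.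
have sub1 : `[a, x]%classic `<=` `[a, b]%classic by rewrite (itv_split axb) =>
  t; left.
have sub2 : `[x, b]%classic `<=` `[a, b]%classic by rewrite (itv_split axb) =>
  t; right.
have E1 t : a <= t <= x -> f t - prim a g t = f a.
  move=> tax; have := C1_deriv_const (C1_derivB f1 (C1_derivW sub1 pg)).
  have z u : a < u < x -> g u - g u = 0 by rewrite subrr.
  move=> /(_ z t a tax); rewrite lexx ax prim_left subr0; exact.
have E2 t : x <= t <= b -> f t - prim a g t = f a.
  move=> txb; have := C1_deriv_const (C1_derivB f2 (C1_derivW sub2 pg)).
  have z u : x < u < b -> g u - g u = 0 by rewrite subrr.
  by move=> /(_ z t x txb); rewrite lexx xb => -> //; rewrite E1// ax lexx.
apply: (@eq_C1_deriv _ _ _ (fun t => prim a g t + f a) _ (fun t => g t + 0)).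
- move=> t; rewrite /= in_itv /= => /andP[at_ tb].
  have : f t - prim a g t = f a.
    by have [tx|/ltW xt] := leP t x; [apply: E1|apply: E2]; apply/andP.
  by move=> <-; rewrite addrC subrK.
- by move=> t _; rewrite addr0.
by apply: C1_derivD => //; exact: C1_deriv_cst.
Qed.

Definition glue (V : Type) x (f g : R -> V) (t : R) : V := if t <= x then f t
  else g t.

Lemma glue_le (V : Type) x (f g : R -> V) t : t <= x -> glue x f g t = f t.
Proof. by rewrite /glue => ->. Qed.

Lemma glue_ge (V : Type) x (f g : R -> V) t : f x = g x -> x <= t -> glue x f g
  t = g t.
Proof.
move=> fg; rewrite /glue le_eqVlt => /predU1P[<-|xt]; first by rewrite lexx.
by rewrite leNgt xt.
Qed.

(** The cubic [3 u^2 - 2 u^3] transported from [[0, 1]] to [[a, x]]: an increasing bijection whose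
    derivative vanishes at both ends. *)
Definition smoothstep a x (t : R) : R :=
  a + (x - a) * (3 * ((t - a) / (x - a)) ^+ 2 - 2 * ((t - a) / (x - a)) ^+ 3).

Definition smoothstep_deriv a x (t : R) : R :=
  6 * ((t - a) / (x - a)) * (1 - (t - a) / (x - a)).

Lemma C1_deriv_id (D : set R) : C1_deriv D (fun t => t) (fun=> 1 : R).
Proof.
split; last by move=> t _; exact: is_derive_id.
  by apply: continuous_subspaceT => t; exact: cvg_id.
exact: within_continuous_cst.
Qed.

Lemma smoothstep_C1 a x (D : set R) : a < x ->
  C1_deriv D (smoothstep a x) (smoothstep_deriv a x).
Proof.
move=> ax; have xa0 : x - a != 0 by rewrite subr_eq0 gt_eqF.
pose u t := (x - a)^-1 * (t - a).
have u1 : C1_deriv D u (fun=> (x - a)^-1 * (1 - 0)).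
  by apply: C1_derivZ; apply: C1_derivB; [exact: C1_deriv_id|exact: C1_deriv_cst].
have u2 := C1_derivM u1 u1; have u3 := C1_derivM u2 u1.
have := C1_derivD (C1_deriv_cst D a) (C1_derivZ (x - a) (C1_derivB (C1_derivZ 3
  u2) (C1_derivZ 2 u3))).
apply: eq_C1_deriv => t _; rewrite /smoothstep /smoothstep_deriv /u;
  first by field.
by field.
Qed.

Lemma smoothstep_left a x : smoothstep a x a = a.
Proof. by rewrite /smoothstep subrr mul0r !expr0n /=; ring. Qed.

Lemma smoothstep_right a x : a < x -> smoothstep a x x = x.
Proof.
move=> ax; rewrite /smoothstep divff ?subr_eq0 ?gt_eqF// !expr1n; ring.
Qed.

Lemma smoothstep_deriv_ge0 a x t : a < x -> a <= t <= x -> 0 <=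
  smoothstep_deriv a x t.
Proof.
move=> ax /andP[at_ tx]; have xa0 : 0 < x - a by rewrite subr_gt0.
rewrite /smoothstep_deriv !mulr_ge0 ?invr_ge0 ?subr_ge0 ?(ltW ax)//.
by rewrite ler_pdivrMr// mul1r lerD2r.
Qed.

Lemma smoothstep_deriv_left a x : smoothstep_deriv a x a = 0.
Proof. by rewrite /smoothstep_deriv subrr mul0r mulr0 mul0r. Qed.

Lemma smoothstep_deriv_right a x : a < x -> smoothstep_deriv a x x = 0.
Proof. by move=> ax; rewrite /smoothstep_deriv divff ?subr_eq0 ?gt_eqF// subrr
  mulr0. Qed.

Lemma smoothstep_ndecr a x : a < x -> forall s t, a <= s -> s <= t -> t <= x ->
  smoothstep a x s <= smoothstep a x t.
Proof.
move=> ax; apply: (C1_deriv_ndecr (smoothstep_C1 _ ax)) => t /andP[at_ tx].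
by rewrite smoothstep_deriv_ge0// !ltW.
Qed.

Lemma smoothstep_itv a x t : a < x -> a <= t <= x -> a <= smoothstep a x t <= x.
Proof.
move=> ax /andP[at_ tx].
have := smoothstep_ndecr ax (lexx a) at_ tx.
have := smoothstep_ndecr ax at_ tx (lexx x).
by rewrite smoothstep_left smoothstep_right// => -> ->.
Qed.

Lemma smoothstep_oo a x t : a < x -> a < t < x -> a < smoothstep a x t < x.
Proof.
move=> ax /andP[at_ tx]; have xa0 : 0 < x - a by rewrite subr_gt0.
have H := C1_deriv_lt (smoothstep_C1 `[a, x] ax).
have pos u : a < u < x -> 0 < smoothstep_deriv a x u.
  move=> /andP[au ux]; rewrite /smoothstep_deriv !mulr_gt0 ?invr_gt0 ?subr_gt0//.
  by rewrite ltr_pdivrMr// mul1r ltrD2r.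
have := H pos a t (lexx a) at_ (ltW tx); have := H pos t x (ltW at_) tx (lexx x).
by rewrite smoothstep_left smoothstep_right// => -> ->.
Qed.

End Gluing.

(** * Reparametrisation, gluing and additivity of the risk *)

Section Smoothing.
Context {R : realType} {m : nat} (G : 'cV[R]_m.+1 -> 'M[R]_m.+1).
Hypothesis hG : risk_metric G.
Implicit Types (a b x : R) (c : R -> 'cV[R]_m.+1) (xd : 'I_m -> R -> R).

Lemma metricZZ w k (x y : 'I_m -> R) :
  metric G w (fun j => k * x j) (fun j => k * y j) = k ^+ 2 * metric G w x y.
Proof.
rewrite mulr_sumr; apply: eq_bigr => i _; rewrite mulr_sumr.
by apply: eq_bigr => j _; ring.
Qed.

Lemma speed_reparam c xd (th dth : R -> R) t : 0 <= dth t ->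
  speed G (fun t => c (th t)) (fun j t => dth t * xd j (th t)) t =
  dth t * speed G c xd (th t).
Proof.
by move=> d0; rewrite /speed metricZZ sqrtrM ?sqr_ge0// sqrtr_sqr ger0_norm.
Qed.

Lemma chart_C1_reparam a b a' b' c xd (th dth : R -> R) :
  chart_C1 a' b' c xd -> C1_deriv `[a, b] th dth ->
  (forall t, a <= t <= b -> a' <= th t <= b') ->
  (forall t, a < t < b -> a' < th t < b') ->
  chart_C1 a b (fun t => c (th t)) (fun j t => dth t * xd j (th t)).
Proof.
move=> [sc xc] hth hcc hoo; split=> [t /hcc|j]; first exact: sc.
have := C1_deriv_comp (xc j) hth hcc hoo.
by apply: eq_C1_deriv => // t _; rewrite mulrC.
Qed.

Lemma C1_on_chart a b c : C1_on `[a, b] c ->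
  (forall t, a <= t <= b -> simplex (c t)) -> exists xd, chart_C1 a b c xd.
Proof.
move=> [g /C1_deriv_mxP cg] sc; exists (fun j t => chart_coord (g t) j).
by split=> // j; exact: cg.
Qed.

Lemma chart_C1_glue a x b c xd : a <= x <= b ->
  chart_C1 a x c xd -> chart_C1 x b c xd -> chart_C1 a b c xd.
Proof.
move=> axb [s1 x1] [s2 x2]; split=> [t /andP[at_ tb]|j].
  by have [tx|/ltW xt] := leP t x; [apply: s1|apply: s2]; apply/andP.
exact: C1_deriv_glue axb (x1 j) (x2 j).
Qed.

Lemma eq_chart_C1 a b c c' xd xd' : (forall t, a <= t <= b -> c t = c' t) ->
  (forall j t, a <= t <= b -> xd j t = xd' j t) ->
  chart_C1 a b c xd -> chart_C1 a b c' xd'.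
Proof.
move=> cc xx [sc xc]; split=> [t tab|j]; first by rewrite -cc//; exact: sc.
apply: eq_C1_deriv (xc j) => t; rewrite /= in_itv /= => tab; last exact: xx.
by rewrite cc.
Qed.

Lemma prim_glue a x b (f : R -> R) t : a <= x <= t -> t <= b ->
  {within `[a, b], continuous f} ->
  prim a f t = prim a f x + prim x f t.
Proof.
move=> /andP[ax xt] tb cf; have xb := le_trans xt tb; have ab := le_trans ax xb.
have sub : `[x, t]%classic `<=` `[a, b]%classic.
  move=> u; rewrite /= !in_itv /= => /andP[h1 h2].
  by rewrite (le_trans ax h1) (le_trans h2 tb).
by rewrite (prim_FTC xt (C1_derivW sub (C1_deriv_prim ab cf))) addrC subrK.
Qed.

Definition speed_integrand c (t : R) : \bar R :=
  (Num.sqrt (qform (G (c t)) (derive1 c t)))%:E.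

Definition measurable_speed a b c : Prop :=
  measurable_fun `[a, b] (speed_integrand c).

Lemma chart_measurable_speed a b c xd : a < b -> chart_C1 a b c xd ->
  measurable_speed a b c.
Proof.
move=> ab cx; have cs := within_continuous_speed hG (ltW ab) cx.
have ms := measurable_funS (measurable_itv `[a, b]) (@subset_itv_oo_cc _ _ a b)
  (measurable_int _ (continuous_integrable cs)).
apply: (@emeasurable_fun_itv_cc _ a b false true);
  apply: eq_measurable_fun ms => t.
rewrite inE /= in_itv /= => tab; have H := chart_C1_is_derive cx tab.
by rewrite /speed_integrand derive1E (@derive_val _ _ _ _ _ _ _ H) qform_comb.
Qed.

(** Additivity of the integral requires a measurable integrand, so measurability is passed on to the
    glued interval for the induction over pieces. *)
Lemma risk_on_split a x b c : a <= x <= b ->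
  measurable_speed a x c -> measurable_speed x b c ->
  measurable_speed a b c /\
  risk_on G `[a, b] c = (risk_on G `[a, x] c + risk_on G `[x, b] c)%E.
Proof.
move=> axb m1 m2; have mab : measurable_speed a b c.
  by rewrite /measurable_speed (itv_split axb); apply/measurable_funU.
split=> //; have /andP[ax xb] := axb.
have s0 t : (0 <= speed_integrand c t)%E by rewrite lee_fin sqrtr_ge0.
rewrite /risk_on -!/(speed_integrand c _).
rewrite (_ : `[a, b]%classic = `[a, x]%classic `|` `]x, b]%classic); last first.
  by rewrite -itv_bndbnd_setU// bnd_simp.
rewrite ge0_integral_setU//=; last 2 first.
- apply: measurable_funS mab => //.
  by rewrite -itv_bndbnd_setU ?bnd_simp.
- by apply/disj_setPLR => t /=; rewrite !in_itv /= => /andP[_ tx];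
  rewrite ltNge tx.
congr (_ + _)%E; apply: integral_itv_obnd_cbnd.
by apply: measurable_funS m2 => //; exact: subset_itv_oc_cc.
Qed.

End Smoothing.

(** * Removal of corners *)

Section Corners.
Context {R : realType} {m : nat} (G : 'cV[R]_m.+1 -> 'M[R]_m.+1).
Hypothesis hG : risk_metric G.
Implicit Types (a b x : R) (c : R -> 'cV[R]_m.+1) (xd : 'I_m -> R -> R).

Lemma eq_speed c c' xd xd' t : c t = c' t -> (forall j, xd j t = xd' j t) ->
  speed G c xd t = speed G c' xd' t.
Proof.
move=> ct xt; rewrite /speed ct; congr (Num.sqrt (metric G _ _ _));
  by apply/funext => j.
Qed.

Lemma prim_speed_reparam a b c xd (th dth : R -> R) : a <= b ->
  chart_C1 a b c xd -> C1_deriv `[a, b] th dth -> th a = a ->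
  (forall t, a <= t <= b -> 0 <= dth t) ->
  (forall t, a <= t <= b -> a <= th t <= b) ->
  (forall t, a < t < b -> a < th t < b) ->
  forall t, a <= t <= b -> prim a (speed G c xd) (th t) =
    prim a (speed G (fun t => c (th t)) (fun j t => dth t * xd j (th t))) t.
Proof.
move=> ab cx hth tha d0 hcc hoo t tab.
have cs := within_continuous_speed hG ab cx.
have cx' := chart_C1_reparam cx hth hcc hoo.
have cs' := within_continuous_speed hG ab cx'.
have H := C1_derivB (C1_deriv_comp (C1_deriv_prim ab cs) hth hcc hoo)
  (C1_deriv_prim ab cs').
apply/eqP; rewrite -subr_eq0; apply/eqP.
rewrite (C1_deriv_const H _ (t := a) _ _) ?tha ?prim_left ?subrr ?lexx//.
move=> u /andP[au ub]; rewrite speed_reparam; first by rewrite mulrC subrr.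
by apply: d0; rewrite !ltW.
Qed.

(* Traversing each smooth piece with vanishing velocity at its ends makes the
   curve C^1 across the corners. *)
Lemma resolve_corners (s : seq R) a b c : itv_partition a b s ->
  (forall i, (i < size s)%N -> C1_on `[nth b (a :: s) i, nth b s i] c) ->
  (forall t, a <= t <= b -> simplex (c t)) ->
  exists (th : R -> R) xd (ell : R -> R),
  [/\ a <= b, th a = a, th b = b,
      (forall t, a <= t <= b -> a <= th t <= b) &
  [/\ (forall u t, a <= u -> u <= t -> t <= b -> th u <= th t),
      (forall u, a <= u <= b -> exists2 t, a <= t <= b & th t = u),
      chart_C1 a b (fun t => c (th t)) xd,
      (forall j, xd j a = 0 /\ xd j b = 0) &
  [/\ {within `[a, b], continuous ell},
      (forall i, (i < size s)%N -> C1_on `[nth b (a :: s) i, nth b s i] ell),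
      (forall t, a <= t <= b ->
         ell (th t) = prim a (speed G (fun t => c (th t)) xd) t),
      measurable_speed G a b c & risk_on G `[a, b] c = (ell b)%:E]]].
Proof.
elim: s a => [|x s IH] a part c1 sc.
  have ab := itv_partition_nil part; subst b.
  have oneP t : a <= t <= a -> t = a by move=> /andP[? ?]; apply/eqP;
    rewrite eq_le; apply/andP.
  exists id, (fun _ _ => 0), (fun=> 0); split => //; split => //.
  - by move=> u uaa; exists u.
  - split=> // j; apply: mkC1_deriv.
    + by rewrite set_itv1; exact: continuous_subspace1.
    + exact: within_continuous_cst.
    + by move=> t /andP[at_ ta]; have := lt_trans at_ ta; rewrite ltxx.
  - split=> //.
    + exact: within_continuous_cst.
    + by move=> t /oneP ->; rewrite prim_left.
    + by rewrite /measurable_speed set_itv1; exact: measurable_fun_set1.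
    + by rewrite /risk_on set_itv1 integral_set1.
have [/= /andP[ax pxs] lastb] := part.
have xs := order_path_min lt_trans pxs.
have partx : itv_partition x b s by exact: itv_partition_cons part.
have xb : x <= b.
  move/eqP: lastb => /= <-; have := mem_last x s; rewrite inE => /predU1P[->//|].
  by move/allP: xs => H /H /ltW.
have cx1 i : (i < size s)%N -> C1_on `[nth b (x :: s) i, nth b s i] c.
  by move=> si; apply: (c1 i.+1).
have scx t : x <= t <= b -> simplex (c t).
  by move=> /andP[xt tb]; apply: sc; rewrite tb (le_trans (ltW ax)).
have [th2 [xd2 [ell2 [_ th2x th2b th2itv [th2nd th2sur chart2 xd20
  [c_ell2 c1_ell2 ell2th m2 risk2]]]]]] := IH x partx cx1 scx.
have sca t : a <= t <= x -> simplex (c t).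
  by move=> /andP[at_ tx]; apply: sc; rewrite at_ (le_trans tx).
have [xd0 chart0] : exists xd, chart_C1 a x c xd := C1_on_chart (c1 0%N isT) sca.
have hth := smoothstep_C1 `[a, x] ax.
pose th1 := smoothstep a x.
pose xd1 j t := smoothstep_deriv a x t * xd0 j (th1 t).
have th1cc t : a <= t <= x -> a <= th1 t <= x by exact: smoothstep_itv.
have th1oo t : a < t < x -> a < th1 t < x by exact: smoothstep_oo.
have chart1 : chart_C1 a x (fun t => c (th1 t)) xd1.
  exact: chart_C1_reparam chart0 hth th1cc th1oo.
have th1a : th1 a = a by exact: smoothstep_left.
have th1x : th1 x = x by exact: smoothstep_right.
have axb : a <= x <= b by rewrite ltW.
have ab : a <= b := le_trans (ltW ax) xb.
(* Length is also measured in the original parameter: as a function of it, it is C^1 on each piece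
   of [c], and after normalisation it becomes the reparametrisation. *)
pose ell1 := prim a (speed G c xd0).
have ell1_C1 : C1_deriv `[a, x] ell1 (speed G c xd0).
  exact: C1_deriv_prim (ltW ax) (within_continuous_speed hG (ltW ax) chart0).
have ell1th t : a <= t <= x -> ell1 (th1 t) = prim a (speed G (fun t => c (th1
  t)) xd1) t.
  apply: (prim_speed_reparam (ltW ax) chart0 hth th1a _ th1cc th1oo) => u.
  exact: smoothstep_deriv_ge0.
have ell2x : ell2 x = 0.
  by have := ell2th x; rewrite th2x lexx xb prim_left; apply.
have xd1a j : xd1 j a = 0 by rewrite /xd1 smoothstep_deriv_left mul0r.
(* Both velocities are 0 at the junction, so the glued velocity is continuous whatever the corner of
   [c]. *)
have xd1x j : xd1 j x = xd2 j x.
  by rewrite /xd1 smoothstep_deriv_right// mul0r (xd20 j).1.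
pose th := glue x th1 th2; pose xd j := glue x (xd1 j) (xd2 j).
pose ell := glue x ell1 (fun t => ell1 x + ell2 t).
have thL t : t <= x -> th t = th1 t by exact: glue_le.
have thR t : x <= t -> th t = th2 t by apply: glue_ge; rewrite th1x th2x.
have xdL j t : t <= x -> xd j t = xd1 j t by exact: glue_le.
have xdR j t : x <= t -> xd j t = xd2 j t by apply: glue_ge; exact: xd1x.
have ellL t : t <= x -> ell t = ell1 t by exact: glue_le.
have ellR t : x <= t -> ell t = ell1 x + ell2 t.
  by apply: (glue_ge (g := fun t => ell1 x + ell2 t)); rewrite ell2x addr0.
have chartL : chart_C1 a x (fun t => c (th t)) xd.
  by apply: eq_chart_C1 chart1 => [t /andP[_ tx]|j t /andP[_ tx]];
    rewrite ?thL ?xdL.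
have chartR : chart_C1 x b (fun t => c (th t)) xd.
  by apply: eq_chart_C1 chart2 => [t /andP[xt _]|j t /andP[xt _]];
    rewrite ?thR ?xdR.
have chart := chart_C1_glue axb chartL chartR.
have cs := within_continuous_speed hG ab chart.
have ellLE t : a <= t <= x -> ell (th t) = prim a (speed G (fun t => c (th t))
  xd) t.
  move=> tax; have /andP[at_ tx] := tax; have /andP[_ th1tx] := th1cc _ tax.
  rewrite thL// ellL// ell1th//; apply: eq_prim => u /andP[au ut].
  by apply: eq_speed => [|j]; rewrite ?thL ?xdL// (le_trans ut).
have m1 := chart_measurable_speed hG ax chart0.
have [mab riskE] := risk_on_split axb m1 m2.
exists th, xd, ell; split=> //.
- by rewrite thL ?th1a// ltW.
- by rewrite thR.
- move=> t /andP[at_ tb]; have [tx|/ltW xt] := leP t x.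
    by rewrite thL//; have /andP[-> h] := th1cc t (introT andP (conj at_ tx));
      exact: le_trans xb.
  by rewrite thR//; have /andP[h ->] := th2itv t (introT andP (conj xt tb));
    rewrite (le_trans _ h)// ltW.
split=> //.
- move=> u t au ut tb; have [tx|/ltW xt] := leP t x.
    by rewrite !thL// ?(le_trans ut)//; exact: smoothstep_ndecr.
  have [ux|/ltW xu] := leP u x; last by rewrite !thR//; exact: th2nd.
  rewrite thL// thR//; apply: (@le_trans _ _ x).
    by have /andP[] := th1cc u (introT andP (conj au ux)).
  by have /andP[] := th2itv t (introT andP (conj xt tb)).
- move=> u /andP[au ub]; have [ux|/ltW xu] := leP u x; last first.
    have [t /andP[xt tb] <-] := th2sur u (introT andP (conj xu ub)).
    by exists t; rewrite ?thR// tb (le_trans (ltW ax)).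
  have [cth _ _] := hth.
  have [|t] := IVT (v := u) (ltW ax) cth.
    by rewrite -/(th1 _) th1a -/(th1 _) th1x ge_min le_max au ux orbT.
  rewrite in_itv /= => /andP[at_ tx] tu; exists t; last by rewrite thL.
  by rewrite at_ (le_trans tx).
- by move=> j; rewrite xdL ?(ltW ax)// xd1a xdR// (xd20 j).2.
have c1L : C1_on `[a, x] ell.
  exists (speed G c xd0); apply: eq_C1_deriv ell1_C1 => // t.
  by rewrite /= in_itv /= => /andP[_ tx]; rewrite ellL.
split=> //.
- apply: within_continuous_glue axb _ _; first by have [? []] := c1L.
  apply: (@eq_within_continuous _ _ _ (fun t => ell1 x + ell2 t)).
    by move=> t; rewrite /= in_itv /= => /andP[xt _]; rewrite ellR.
  by apply: within_continuous_add => //; exact: within_continuous_cst.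
- move=> [_|i si]; first exact: c1L.
  have [g gE] := c1_ell2 i si; exists g.
  apply: (@eq_C1_deriv _ _ _ (fun t => ell1 x + ell2 t) _ (fun t => 0 + g t)).
  + move=> t; rewrite /= in_itv /= => /andP[it _]; rewrite ellR//.
    apply: le_trans it; case: (i) si => [|k] si //=.
    by move/all_nthP: xs => /(_ b k (ltnW si)) /ltW.
  + by move=> t _; rewrite add0r.
  by apply: C1_derivD => //; exact: C1_deriv_cst.
- move=> t /andP[at_ tb]; have [tx|/ltW xt] := leP t x.
    by apply: ellLE; rewrite at_.
  have /andP[xth _] := th2itv t (introT andP (conj xt tb)).
  rewrite thR// ellR// ell2th ?xt//.
  rewrite [RHS](prim_glue (x := x) (b := b)) ?(ltW ax)//; congr (_ + _).
    by rewrite -ellLE ?lexx ?ltW// thL// th1x ellL.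
  apply: eq_prim => u /andP[xu ut].
  by apply: eq_speed => [|j]; rewrite ?thR ?xdR.
by rewrite riskE risk2 (risk_chart hG ax chart0) -/(ell1 x) ellR.
Qed.

End Corners.

(** * Minimisers are geodesics up to reparametrisation *)

Section Minimisers.
Context {R : realType} {m : nat} (G : 'cV[R]_m.+1 -> 'M[R]_m.+1).
Hypothesis hG : risk_metric G.
Implicit Types (A B w : 'cV[R]_m.+1) (c : R -> 'cV[R]_m.+1).

Lemma itv_partition01 : itv_partition (0 : R) 1 [:: 1].
Proof. by split; rewrite //= ltr01. Qed.

Lemma piecewise_C1_id : piecewise_C1 (0 : R) 1 (fun t : R => t).
Proof.
have H := @C1_deriv_id R `[0, 1]; split; first by have [] := H.
by exists [:: 1]; split; [exact: itv_partition01|case=> // _; exists (fun=> 1)].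
Qed.

Lemma chart_admissible c xd : chart_C1 0 1 c xd -> admissible (c 0) (c 1) c.
Proof.
move=> cx; have C := C1_deriv_chart ler01 cx; split=> //; last first.
  by move=> t; rewrite in_itv; exact: cx.1.
split; first by have [] := C.
exists [:: 1]; split; first exact: itv_partition01.
by case=> // _; exists (fun t => frame_comb (xd^~ t)).
Qed.

Lemma chart_risk c xd : chart_C1 0 1 c xd -> risk G c = (prim 0 (speed G c xd)
  1)%:E.
Proof. exact: risk_chart ltr01. Qed.

Lemma geodesic_cst w : simplex w -> geodesic G (fun=> w).
Proof.
move=> sw; split=> //; exists (fun=> 0), (fun=> 0).
have C (v : 'cV[R]_m.+1) : C1_deriv `[0, 1] (fun=> v) (fun _ : R => 0).
  by split; [move=> t; exact: cvg_cst|move=> t; exact: cvg_cst|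
    move=> t _; exact: (is_derive_cst v t (1 : R))].
split=> // t _ k; rewrite big1 ?addr0 => [|i _];
  first by rewrite /chart_coord mxE.
by rewrite big1// => j _; rewrite /chart_coord !mxE mulr0.
Qed.

Lemma chart_C1_const c xd : chart_C1 0 1 c xd -> prim 0 (speed G c xd) 1 <= 0 ->
  forall t, 0 <= t <= 1 -> c t = c 0.
Proof.
move=> cx L0 t t01; have cs := within_continuous_speed hG ler01 cx.
have s0 := prim_ge0_eq0 ltr01 cs (fun t _ => speed_ge0 G c xd t) L0.
have O01 : (0 <= (0 : R)) && ((0 : R) <= 1) by rewrite lexx ler01.
apply: tangent_chart_inj; first by apply: simplex_tangent; exact: cx.1.
move=> j; apply: (C1_deriv_const (cx.2 j)) => // u u01.
have uD : 0 <= u <= 1 by have /andP[? ?] := u01; rewrite !ltW.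
apply: (metric_eq0 hG (cx.1 u uD) (x := xd^~ u)).
by rewrite -(speed_sq hG cx)// s0// expr0n.
Qed.

(** There are two alternatives because a zero length cannot be normalised. In that case [c] is
    constant and [e] is taken constant, so any parameter is allowed. *)
Lemma C1_minimiser_geodesic c xd : chart_C1 0 1 c xd ->
  (forall c', admissible (c 0) (c 1) c' -> (risk G c <= risk G c')%E) ->
  exists e, [/\ geodesic G e,
    0 < prim 0 (speed G c xd) 1 -> forall t, 0 <= t <= 1 ->
      c t = e (prim 0 (speed G c xd) t / prim 0 (speed G c xd) 1) &
    prim 0 (speed G c xd) 1 <= 0 -> forall s t, 0 <= s <= 1 -> 0 <= t <= 1 ->
      c t = e s].
Proof.
move=> cx cmin; have [L0|L0] := leP (prim 0 (speed G c xd) 1) 0.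
  exists (fun=> c 0); split=> //.
    by apply: geodesic_cst; apply: cx.1; rewrite lexx ler01.
  by move=> _ s t _; exact: chart_C1_const cx L0 t.
have [c' xd' cx' e0 e1|C qE] := euler_lagrange hG cx L0.
  rewrite -lee_fin -(chart_risk cx) -(chart_risk cx'); apply: cmin.
  by rewrite -e0 -e1; exact: chart_admissible cx'.
by have [e [ge eE]] := geodesic_of_minimiser hG cx L0 qE; exists e; split.
Qed.

(** The smoothed curve has the same ends and the same risk, so it minimises too. Its geodesic is
    carried back to [c] because [th] is onto [[0, 1]]. *)
Lemma admissible_minimiser_geodesic A B c : admissible A B c ->
  (forall c', admissible A B c' -> (risk G c <= risk G c')%E) ->
  geodesic_up_to_reparam G c.
Proof.
move=> [[_ [s [part cs]]] sc cA cB] cmin.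
have sc' t : 0 <= t <= 1 -> simplex (c t) by move=> t01; apply: sc;
  rewrite in_itv.
have [th [xd [ell [_ th0 th1 thitv [thnd thsur chart _ [cell c1ell ellth _
  rE]]]]]] :=
  resolve_corners hG part cs sc'.
have E01 : (0 <= (1 : R)) && ((1 : R) <= 1) by rewrite lexx ler01.
have O01 : (0 <= (0 : R)) && ((0 : R) <= 1) by rewrite lexx ler01.
have riskE : risk G c = risk G (fun t => c (th t)).
  by rewrite (chart_risk chart) -ellth// th1.
have [|e [ge epos enull]] := C1_minimiser_geodesic chart.
  by rewrite -riskE th0 th1 cA cB.
have ell0 : ell 0 = 0 by have := ellth 0 O01; rewrite th0 prim_left.
have ell1 : ell 1 = prim 0 (speed G (fun t => c (th t)) xd) 1.
  by have := ellth 1 E01; rewrite th1.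
have [L0|L0] := leP (prim 0 (speed G (fun t => c (th t)) xd) 1) 0.
  exists e, id; split; first exact: ge.
  - exact: piecewise_C1_id.
  - by move=> u v _ _.
  - by split.
  - move=> t; rewrite in_itv /= => t01; have [u u01 <-] := thsur t t01.
    exact: enull L0 _ _ (thitv u u01) u01.
exists e, (fun t => ell t / ell 1); split; first exact: ge.
- split; first by apply: within_continuousM;
  [exact: cell|exact: within_continuous_cst].
  exists s; split=> [|i]; first exact: part.
  move=> /c1ell [g gE]; exists (fun t => (ell 1)^-1 * g t).
  by apply: eq_C1_deriv (C1_derivZ (ell 1)^-1 gE) => t _; [rewrite mulrC|].
- move=> u v; rewrite !in_itv /= => u01 v01 uv.
  rewrite ler_pM2r; last by rewrite invr_gt0 ell1.
  have [a a01 uE] := thsur u u01; have [b b01 vE] := thsur v v01.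
  have /andP[a0 a1] := a01; have /andP[b0 b1] := b01.
  (* Preimages in the right order reduce to monotonicity of arc length; the wrong order forces
     [u = v], since [th] is nondecreasing. *)
  have [ab|ba] := leP a b.
    rewrite -uE -vE (ellth _ a01) (ellth _ b01);
      have cs' := within_continuous_speed hG ler01 chart.
    apply: (C1_deriv_ndecr (C1_deriv_prim ler01 cs') _ a0 ab b1) => t _.
    exact: speed_ge0.
  have vu : v <= u by rewrite -uE -vE; exact: thnd b0 (ltW ba) a1.
  by have -> : u = v by apply/eqP; rewrite eq_le uv.
- by split; [rewrite ell0 mul0r|rewrite ell1; exact: divff (lt0r_neq0 L0)].
- move=> t; rewrite in_itv /= => t01; have [u u01 <-] := thsur t t01.
  rewrite (ellth _ u01) ell1; exact: epos L0 u u01.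
Qed.

End Minimisers.

(** * Paths on an infinite time interval *)

Section HalfLine.
Context {R : realType}.
Implicit Types (f g : R -> R).

Lemma C1_deriv_halfline (f g : R -> R) (t : R) : C1_deriv `[0, +oo[ f g -> 0 <
  t ->
  is_derive t (1 : R) f (g t).
Proof. by case=> _ _; rewrite interior_itv => + t0; apply;
  rewrite /= in_itv /= t0. Qed.

Lemma is_derive_inv f (t df : R) : f t != 0 -> is_derive t (1 : R) f df ->
  is_derive t (1 : R) (fun s => (f s)^-1) (- df / f t ^+ 2).
Proof.
move=> n0 H; apply: (is_derive_eq (@is_deriveV _ _ _ _ _ n0 H)).
by rewrite scaleNr [_ *: _]mulrC mulNr.
Qed.

(** With [of_halfline], inverse bijections between [[0, 1[] and [[0, +oo[]. The derivative of
    [to_halfline] is [(1 + t) ^+ 2] at the image point [t], whence the weight in the decay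
    conditions below. *)
Definition to_halfline (s : R) : R := s / (1 - s).
Definition of_halfline (t : R) : R := t / (1 + t).

Lemma to_halfline_ge0 s : 0 <= s -> s < 1 -> 0 <= to_halfline s.
Proof. by move=> s0 s1; rewrite divr_ge0// subr_ge0 ltW. Qed.

Lemma to_halfline_gt0 s : 0 < s -> s < 1 -> 0 < to_halfline s.
Proof. by move=> s0 s1; rewrite divr_gt0// subr_gt0. Qed.

Lemma to_halflineD1 s : s < 1 -> 1 + to_halfline s = (1 - s)^-1.
Proof. by move=> s1; rewrite /to_halfline; field; rewrite subr_eq0 gt_eqF. Qed.

Lemma of_halfline_itv t : 0 <= t -> 0 <= of_halfline t < 1.
Proof.
move=> t0; have t1 : 0 < 1 + t by rewrite ltr_wpDr.
by rewrite divr_ge0 ?(ltW t1)//= ltr_pdivrMr// mul1r ltrDr.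
Qed.

Lemma of_halflineK t : 0 <= t -> to_halfline (of_halfline t) = t.
Proof.
move=> t0; have t1 : 1 + t != 0 by rewrite gt_eqF// ltr_wpDr.
by rewrite /to_halfline /of_halfline; field; rewrite t1 addrK oner_eq0.
Qed.

Lemma of_halfline_ndecr s t : 0 <= s -> s <= t -> of_halfline s <= of_halfline t.
Proof.
move=> s0 st; have s1 : 0 < 1 + s by rewrite ltr_wpDr.
have t1 : 0 < 1 + t by rewrite ltr_wpDr// (le_trans s0).
rewrite /of_halfline ler_pdivrMr// mulrAC ler_pdivlMr//.
by rewrite !mulrDr !mulr1 [t * s]mulrC lerD2r.
Qed.

Lemma is_derive_to_halfline (s : R) : s < 1 ->
  is_derive s (1 : R) to_halfline ((1 + to_halfline s) ^+ 2).
Proof.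
move=> s1; have n0 : 1 - s != 0 by rewrite subr_eq0 gt_eqF.
have H := is_deriveB (is_derive_cst (1 : R) s (1 : R)) (is_derive_id s (1 : R)).
have H2 := @is_derive_inv (fun s => 1 - s) s _ n0 H.
apply: (is_derive_eq (is_derive_mul (is_derive_id s (1 : R)) H2)).
by rewrite to_halflineD1//; field.
Qed.

Lemma of_halfline_C1 : C1_deriv `[0, +oo[ of_halfline (fun t => (1 + t) ^- 2).
Proof.
have t1 (t : R) : 0 <= t -> 1 + t != 0 by move=> t0; rewrite gt_eqF// ltr_wpDr.
have c1t : {within `[0, +oo[, continuous (fun t : R => 1 + t)}.
  apply: within_continuous_add; first exact: within_continuous_cst.
  by apply: continuous_subspaceT => t; exact: cvg_id.
have t0 (t : R) : `[0, +oo[%classic t -> 0 <= t by rewrite /= in_itv /= andbT.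
split.
- apply: within_continuousM.
    by apply: continuous_subspaceT => t; exact: cvg_id.
  by apply: within_continuousV => // t /t0 /t1.
- apply: within_continuousV => [|t /t0 /t1]; last by rewrite expf_eq0.
  by apply: (within_continuousM c1t c1t).
move=> t; rewrite interior_itv /= in_itv /= andbT => /ltW /t1 n0.
have H := is_deriveD (is_derive_cst (1 : R) t (1 : R)) (is_derive_id t (1 : R)).
have H2 := @is_derive_inv (fun s => 1 + s) t _ n0 H.
by apply: (is_derive_eq (is_derive_mul (is_derive_id t (1 : R)) H2)); field.
Qed.

Definition compactify (V : Type) (f : R -> V) (l : V) (s : R) : V :=
  if s < 1 then f (to_halfline s) else l.

Lemma within_continuous_compactify f (l : R) :
  {within `[0, +oo[, continuous f} -> f t @[t --> +oo] --> l ->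
  {within `[0, 1], continuous (compactify f l)}.
Proof.
move=> cf fl; apply/within_cvgP => s; rewrite /= in_itv /= => /andP[s0].
rewrite le_eqVlt => /predU1P[->|s1]; last first.
  have ch : {within `[0, 1[, continuous to_halfline}.
    apply: within_continuousM.
      by apply: continuous_subspaceT => t; exact: cvg_id.
    apply: within_continuousV.
      apply: within_continuous_sub; first exact: within_continuous_cst.
      by apply: continuous_subspaceT => t; exact: cvg_id.
    by move=> t; rewrite /= in_itv /= => /andP[_ t1]; rewrite subr_eq0 gt_eqF.
  have : {within `[0, 1[, continuous (fun t => f (to_halfline t))}.
    apply: within_continuous_comp ch _ cf => t; rewrite /= !in_itv /= andbT.
    by move=> /andP[? ?]; exact: to_halfline_ge0.
  move=> /within_cvgP /(_ s); rewrite /= in_itv /= s0 s1 => /(_ isT) H.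
  rewrite /compactify s1 => U /H; rewrite /= !nbhs_simpl /= /within /=.
  have : \forall t \near s, t < 1 by exact: lt_nbhsl.
  apply: filterS2 => t t1; rewrite !in_itv /= t1 andbT.
  by move=> + /andP[t0 _]; apply.
rewrite /compactify ltxx; apply/cvgrPdist_le => e e0.
have /cvgrPdist_le /(_ _ e0) := fl.
move=> [M [_ HM]]; rewrite /prop_near1 /within /= !nbhs_simpl /=.
(* To the left of 1 and within [(|M| + 2)^-1] of it, [to_halfline] exceeds [|M| + 1], hence [M]. *)
have M1 : 0 < 1 + `|M| + 1 by rewrite addr_gt0// ltr_pwDl.
have : \forall t \near (1 : R), 1 - (1 + `|M| + 1)^-1 < t.
  by apply: lt_nbhsr; rewrite ltrBlDr ltrDl invr_gt0.
apply: filterS => t tM; rewrite in_itv /= => /andP[t0 tle1].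
case: ifPn => [t1|_]; last by rewrite subrr normr0 ltW.
apply: HM; have t1' : 0 < 1 - t by rewrite subr_gt0.
have : 1 + `|M| + 1 < (1 - t)^-1.
  by rewrite -[X in X < _]invrK ltf_pV2 ?posrE ?invr_gt0//; lra.
rewrite -to_halflineD1// => ?; apply: (le_lt_trans (ler_norm _)).
by lra.
Qed.

(** The weighted decay of [g] says that the velocity in the new parameter tends to 0 at 1, so 0
    extends it continuously. *)
Lemma compactify_C1 f g (l : R) : C1_deriv `[0, +oo[ f g ->
  f t @[t --> +oo] --> l -> g t * (1 + t) ^+ 2 @[t --> +oo] --> (0 : R) ->
  C1_deriv `[0, 1] (compactify f l) (compactify (fun t => g t * (1 + t) ^+ 2) 0).
Proof.
move=> fg fl gl; have [cf cg _] := fg; apply: mkC1_deriv.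
- exact: within_continuous_compactify.
- apply: within_continuous_compactify => //; apply: within_continuousM => //.
  have c1t : {within `[0, +oo[, continuous (fun t : R => 1 + t)}.
    apply: within_continuous_add; first exact: within_continuous_cst.
    by apply: continuous_subspaceT => t; exact: cvg_id.
  by apply: (within_continuousM c1t c1t).
move=> s /andP[s0 s1]; rewrite {2}/compactify s1.
have := @is_derive1_comp R f to_halfline s _ _
  (C1_deriv_halfline fg (to_halfline_gt0 s0 s1)) (is_derive_to_halfline s1).
apply: near_eq_is_derive.
have : \forall t \near s, t < 1 by exact: lt_nbhsl.
by apply: filterS => t t1; rewrite /compactify t1.
Qed.

End HalfLine.

(** * Equality of the risk on the half-line and after compactification *)

Section InfiniteHorizon.
Context {R : realType} {m : nat} (G : 'cV[R]_m.+1 -> 'M[R]_m.+1).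
Hypothesis hG : risk_metric G.
Context (p : R -> 'cV[R]_m.+1) (yd : 'I_m -> R -> R) (B : 'cV[R]_m.+1).
Hypothesis p_simplex : forall t, 0 <= t -> simplex (p t).
Hypothesis B_simplex : simplex B.
Hypothesis p_C1 : forall j, C1_deriv `[0, +oo[ (fun t => chart_coord (p t) j)
  (yd j).
Hypothesis p_cvg : forall j, chart_coord (p t) j @[t --> +oo] --> chart_coord B j.
Hypothesis yd_cvg : forall j, yd j t * (1 + t) ^+ 2 @[t --> +oo] --> (0 : R).

Definition compact_velocity (j : 'I_m) : R -> R :=
  compactify (fun t => yd j t * (1 + t) ^+ 2) 0.

Local Notation c := (compactify p B).
Local Notation xd := compact_velocity.
Local Notation sigma := (speed G c xd).
Local Notation N := (fun t => prim 0 sigma (of_halfline t)).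

Lemma chart_C1_compactify : chart_C1 0 1 c xd.
Proof.
split=> [s /andP[s0 s1]|j].
  rewrite /compactify; case: ifP => // {}s1.
  by apply: p_simplex; exact: to_halfline_ge0.
apply: eq_C1_deriv (compactify_C1 (p_C1 j) (@p_cvg j) (@yd_cvg j)) => // s _.
by rewrite /compactify; case: ifP.
Qed.

Lemma compactify_of_halfline (V : Type) (f : R -> V) (l : V) t : 0 <= t ->
  compactify f l (of_halfline t) = f t.
Proof.
move=> t0; have /andP[_ k1] := of_halfline_itv t0.
by rewrite /compactify k1 of_halflineK.
Qed.

Lemma speed_halfline t : 0 <= t ->
  sigma (of_halfline t) * (1 + t) ^- 2 = speed G p yd t.
Proof.
move=> t0; have t1 : 1 + t != 0 by rewrite gt_eqF// ltr_wpDr.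
rewrite /speed compactify_of_halfline//.
rewrite (_ : (fun j => xd j (of_halfline t)) = (fun j => (1 + t) ^+ 2 * yd j t)).
  rewrite metricZZ sqrtrM ?sqr_ge0// sqrtr_sqr ger0_norm ?sqr_ge0//.
  by field.
by apply/funext => j; rewrite /compact_velocity compactify_of_halfline// mulrC.
Qed.

Let cs : {within `[0, 1], continuous sigma}.
Proof. exact: (within_continuous_speed hG ler01 chart_C1_compactify). Qed.

Lemma halfline_length_C1 : C1_deriv `[0, +oo[ N (speed G p yd).
Proof.
have [cP _ _] := C1_deriv_prim ler01 cs; have [ck ck' _] := @of_halfline_C1 R.
have into (t : R) : `[0, +oo[%classic t -> `[0, 1]%classic (of_halfline t).
  rewrite /= !in_itv /= andbT => /of_halfline_itv /andP[-> /ltW ->] //.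
split.
- exact: (within_continuous_comp ck into cP).
- apply: (@eq_within_continuous _ _ _ (fun t => sigma (of_halfline t) * (1 + t)
  ^- 2)).
    by move=> t; rewrite /= in_itv /= andbT => /speed_halfline.
  by apply: within_continuousM => //; exact: (within_continuous_comp ck into cs).
move=> t; rewrite interior_itv /= in_itv /= andbT => t0.
have k01 : 0 < of_halfline t < 1.
  by have /andP[_ ->] := of_halfline_itv (ltW t0);
    rewrite andbT divr_gt0// addr_gt0.
have := @is_derive1_comp R (prim 0 sigma) (@of_halfline R) t _ _
  (C1_deriv_derive (C1_deriv_prim ler01 cs) k01) (C1_deriv_halfline
    of_halfline_C1 t0).
by rewrite speed_halfline// ltW.
Qed.

Lemma of_halfline_cvg : @of_halfline R t @[t --> +oo] --> (1 : R).
Proof.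
apply/cvgrPdist_le => e e0; near=> t.
have t0 : 0 < t by near: t; exact: nbhs_pinfty_gt.
have t1 : 0 < 1 + t by rewrite addr_gt0.
have -> : 1 - of_halfline t = (1 + t)^-1 by rewrite /of_halfline; field;
  rewrite gt_eqF.
rewrite ger0_norm ?invr_ge0 ?(ltW t1)// -[leRHS]invrK lef_pV2 ?posrE ?invr_gt0//.
apply: (@le_trans _ _ t); last by rewrite lerDr.
by near: t; apply: nbhs_pinfty_ge; exact: num_real.
Unshelve. all: by end_near. Qed.

Lemma halfline_length_cvg : N t @[t --> +oo] --> prim 0 sigma 1.
Proof.
have [/within_cvgP cP _ _] := C1_deriv_prim ler01 cs.
have in1 : `[0, 1]%classic (1 : R) by rewrite /= in_itv /= ler01 lexx.
move=> U /(cP _ in1); rewrite /= !nbhs_simpl /= /within /= => /of_halfline_cvg.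
rewrite /= !nbhs_simpl /= => H.
have : \forall t \near +oo, (0 : R) <= t by exact: nbhs_pinfty_ge.
move: H; apply: filterS2 => t + t0; apply; rewrite in_itv /=.
by have /andP[-> /ltW ->] := of_halfline_itv t0.
Qed.

(** [N] is a primitive of the speed of [p] that starts at 0 and tends to the length of the
    compactified curve; the fundamental theorem on the half-line identifies the two risks. *)
Lemma risk_infty_compactify : risk_infty G p = risk G c.
Proof.
rewrite (chart_risk hG chart_C1_compactify).
have NC1 := halfline_length_C1; have [cN cp _] := NC1.
have der (t : R) : 0 < t -> is_derive t (1 : R) N (speed G p yd t).
  exact: C1_deriv_halfline NC1.
have N0 : N 0 = 0 by rewrite /of_halfline mul0r prim_left.
have -> : (prim 0 sigma 1)%:E = ((prim 0 sigma 1)%:E - (N 0)%:E)%E.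
  by rewrite N0 sube0.
rewrite -(@ge0_continuous_FTC2y R (speed G p yd) N 0 (prim 0 sigma 1)) //;
  first last.
- move=> t; rewrite in_itv /= andbT => t0.
  by rewrite derive1E (@derive_val _ _ _ _ _ _ _ (der t t0)).
- by have /continuous_within_itvcyP [_] := cN.
- by move=> t t0; exact: (@ex_derive _ _ _ _ _ _ _ (der t t0)).
- exact: halfline_length_cvg.
- by move=> t _; exact: speed_ge0.
rewrite /risk_infty /risk_on.
have E (t : R) : t \in `]0, +oo[%R ->
    (Num.sqrt (qform (G (p t)) (derive1 p t)))%:E = (speed G p yd t)%:E.
  rewrite in_itv /= andbT => t0.
  have pt : chart_C1 0 (t + 1) p yd.
    split=> [s /andP[s0 _]|j]; first exact: p_simplex.
    apply: C1_derivW (p_C1 j) => s; rewrite /= !in_itv /= andbT.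
    by case/andP.
  have tt : 0 < t < t + 1 by rewrite t0 ltrDl ltr01.
  have H := chart_C1_is_derive pt tt.
  by rewrite derive1E (@derive_val _ _ _ _ _ _ _ H) qform_comb.
have msp : measurable_fun (`]0, +oo[%classic : set R) (fun t : R => (speed G p
  yd t)%:E).
  apply/measurable_EFinP.
  have H : measurable_fun (`[0, +oo[%classic : set R) (speed G p yd : R -> R).
    by apply: subspace_continuous_measurable_fun.
  apply: measurable_funS H => // t.
  by rewrite /= !in_itv /= !andbT => /ltW.
rewrite -!integral_itv_obnd_cbnd//; last first.
  by apply: eq_measurable_fun msp => t; rewrite inE /= => /E.
by apply: eq_integral => t; rewrite inE /= => /E.
Qed.

End InfiniteHorizon.

(** * The gradient flow *)

Section GradientFlow.
Context {R : realType} {m : nat}.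
Implicit Types (x y v w : 'cV[R]_m.+1).

Definition bilin (M : 'M[R]_m.+1) x y : R := (x^T *m M *m y) 0 0.

Lemma bilinE M x y : bilin M x y = \sum_i x i 0 * (M *m y) i 0.
Proof.
by rewrite /bilin -mulmxA mxE; apply: eq_bigr => i _; rewrite mxE.
Qed.

Lemma bilinC M x y : M^T = M -> bilin M x y = bilin M y x.
Proof.
move=> MT; rewrite /bilin.
have -> : (x^T *m M *m y) 0 0 = (x^T *m M *m y)^T 0 0 by rewrite [RHS]mxE.
by rewrite !trmx_mul trmxK MT mulmxA.
Qed.

Lemma qform_line M x v t : M^T = M ->
  qform M (x + t *: v) = qform M x + 2 * t * bilin M v x + t ^+ 2 * qform M v.
Proof.
move=> MT; have qE z : qform M z = bilin M z z by [].
rewrite !qE !bilinE.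
have -> : \sum_i (x + t *: v) i 0 * (M *m (x + t *: v)) i 0 =
  \sum_i x i 0 * (M *m x) i 0 + t * (\sum_i x i 0 * (M *m v) i 0) +
  t * (\sum_i v i 0 * (M *m x) i 0) + t ^+ 2 * \sum_i v i 0 * (M *m v) i 0.
  rewrite !mulr_sumr -!big_split /=; apply: eq_bigr => i _.
  rewrite mulmxDr -scalemxAr [(x + t *: v) i 0]mxE [(t *: v) i 0]mxE.
  by rewrite [(M *m x + _) i 0]mxE [(t *: (M *m v)) i 0]mxE; ring.
have := bilinC x v MT; rewrite !bilinE => ->; ring.
Qed.

Lemma centeringE w i :
  (centering *m w) i 0 = w i 0 - m.+1%:R^-1 * \sum_k w k 0.
Proof.
rewrite /centering mulmxBl mul1mx mxE [X in _ + X]mxE; congr (_ - _).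
rewrite -scalemxAl mxE -mulmxA mxE; congr (_ * _).
rewrite big_ord_recl big_ord0 addr0 mxE mul1r mxE.
by apply: eq_bigr => k _; rewrite !mxE mul1r.
Qed.

Lemma tangent_dot_centering v w : tangent v ->
  \sum_i v i 0 * (centering *m w) i 0 = \sum_i v i 0 * w i 0.
Proof.
move=> tv; under eq_bigr do rewrite centeringE mulrBr.
by rewrite sumrB -mulr_suml tv mul0r subr0.
Qed.

Lemma smooth_simplex_cst (M : 'M[R]_m.+1) : smooth_simplex (fun _ : 'cV[R]_m.+1
  => M).
Proof.
move=> k; elim: k M => [|k IH] M /=.
  by split=> // w; exact: cvg_cst.
split=> [w|v _]; first exact: cvg_cst.
split=> [w _|]; first exact: derivable_cst.
have -> : (fun w => 'D_v (fun _ : 'cV[R]_m.+1 => M) w) = fun=> 0.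
  by apply/funext => w; exact: derive_cst.
exact: IH.
Qed.

(** The constant map with value [Sigma] is itself a risk metric, so the bound of coordinates by the
    inverse chart metric applies to it. *)
Lemma sympd_tangent_coercive (Sigma : 'M[R]_m.+1) w : sympd Sigma -> simplex w ->
  exists2 S : R, 0 < S &
    forall v, tangent v -> \sum_i v i 0 ^+ 2 <= S * qform Sigma v.
Proof.
move=> hS sw; pose G (_ : 'cV[R]_m.+1) := Sigma.
have hG : risk_metric G by split; [exact: smooth_simplex_cst|].
pose K j := invmx (chart_metric G w) j j.
pose S1 := \sum_j Num.sqrt (K j).
have S10 : 0 <= S1 by apply: sumr_ge0 => j _; exact: sqrtr_ge0.
exists (m.+1%:R * S1 ^+ 2 + 1); first by rewrite ltr_wpDl// mulr_ge0// sqr_ge0.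
move=> v tv; have Q0 : 0 <= qform Sigma v.
  by rewrite (tangent_comb tv) -[Sigma]/(G w) qform_comb metric_ge0.
apply: (@le_trans _ _ (m.+1%:R * S1 ^+ 2 * qform Sigma v)); last first.
  by rewrite ler_wpM2r// lerDl.
have -> : m.+1%:R * S1 ^+ 2 * qform Sigma v =
    \sum_(i < m.+1) S1 ^+ 2 * qform Sigma v.
  by rewrite sumr_const card_ord -[RHS]mulr_natl mulrA.
apply: ler_sum => i _.
have coord_le j : `|chart_coord v j| <= Num.sqrt (K j) * Num.sqrt (qform Sigma v).
  have := coord_sq_le hG (chart_coord v) j sw.
  rewrite -qform_comb -tangent_comb// -/(K j) => /ler_wsqrtr.
  rewrite sqrtr_sqr => /le_trans; apply; have [K0|K0] := leP 0 (K j).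
    by rewrite sqrtrM.
  (* [Num.sqrt] is 0 at nonpositive arguments, which settles this case without discussing the sign
     of [K j]. *)
  by rewrite ler0_sqrtr ?mulr_ge0 ?sqrtr_ge0// mulr_le0_ge0// ltW.
have vi : `|v i 0| <= S1 * Num.sqrt (qform Sigma v).
  rewrite {1}(tangent_comb tv) /frame_comb summxE (le_trans (ler_norm_sum _ _
    _))//.
  rewrite mulr_suml; apply: ler_sum => j _; rewrite mxE normrM.
  by rewrite (le_trans _ (coord_le j))// ler_piMr// norm_frame_le1.
rewrite -real_normK ?num_real// -[X in _ * X](sqr_sqrtr Q0) -exprMn.
by rewrite ler_sqr ?nnegrE ?mulr_ge0 ?sqrtr_ge0.
Qed.

Context (mu : 'cV[R]_m.+1) (Sigma : 'M[R]_m.+1) (lambda : R) (B : 'cV[R]_m.+1).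
Hypothesis hS : sympd Sigma.
Hypothesis hl : 0 < lambda.
Hypothesis hB : simplex B.
Hypothesis B_target : markowitz_target mu Sigma lambda B.

Let g := mu - (2 * lambda) *: (Sigma *m B).

Lemma ones_mul w : (ones^T *m w) 0 0 = \sum_i w i 0.
Proof. by rewrite mxE; apply: eq_bigr => i _; rewrite !mxE mul1r. Qed.

(** The target maximises over the whole hyperplane, so [B + t *: v] competes for every real [t]. The
    change of the objective, a quadratic polynomial in [t] without constant term, is never positive,
    which forces its linear coefficient [a] to vanish. *)
Lemma first_order_condition v : tangent v -> \sum_i v i 0 * g i 0 = 0.
Proof.
move=> tv; have [hB1 hmax] := B_target; have [ST Spos] := hS.
set a := \sum_i _; set b := qform Sigma v.
have b0 : 0 <= b.
  have [v0|v0] := eqVneq v 0; last exact/ltW/Spos.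
  by rewrite /b /qform v0 mulmx0 mxE.
have key t : t * a - lambda * t ^+ 2 * b <= 0.
  have := hmax (B + t *: v); rewrite !ones_mul in hB1 *.
  under eq_bigr do rewrite mxE [X in _ + X]mxE.
  rewrite big_split /= -mulr_sumr tv mulr0 addr0 => /(_ hB1).
  rewrite /markowitz_objective qform_line// -subr_le0; apply: le_trans.
  rewrite le_eqVlt; apply/orP; left; apply/eqP.
  have -> : (mu^T *m (B + t *: v)) 0 0 = (mu^T *m B) 0 0 + t * \sum_i v i 0 *
    mu i 0.
    rewrite mulmxDr mxE; congr (_ + _).
    rewrite -scalemxAr mxE; congr (_ * _); rewrite mxE.
    by apply: eq_bigr => i _; rewrite mxE mulrC.
  have -> : a = \sum_i v i 0 * mu i 0 - 2 * lambda * bilin Sigma v B.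
    rewrite bilinE mulr_sumr -sumrB; apply: eq_bigr => i _.
    by rewrite /g !mxE; ring.
  by rewrite /b; ring.
have K0 : 0 < lambda * b + 1 by rewrite ltr_wpDl// mulr_ge0// ltW.
(* The vertex of the parabola, with [lambda * b] increased by 1 so that the denominator is nonzero
   when [b = 0]; the value there is a positive multiple of [a ^+ 2]. *)
have := key (a / (2 * (lambda * b + 1))).
have -> : a / (2 * (lambda * b + 1)) * a - lambda * (a / (2 * (lambda * b +
  1))) ^+ 2 * b =
    a ^+ 2 * ((lambda * b + 2) / (2 * (lambda * b + 1)) ^+ 2).
  by field; rewrite gt_eqF.
rewrite pmulr_lle0; last first.
  by rewrite divr_gt0 ?exprn_gt0 ?mulr_gt0// ltr_wpDl// mulr_ge0// ltW.
by move=> a2; apply/eqP; rewrite -sqrf_eq0 eq_le a2 sqr_ge0.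
Qed.

(** Testing against the frame vectors shows that all entries of [g] are equal, and centering kills
    constant vectors. *)
Lemma centering_grad : centering *m g = 0.
Proof.
have gE i : g i 0 = g ord_max 0.
  have [j ->|->//] := unliftP ord_max i.
  have := first_order_condition (frame_tangent j).
  rewrite (bigD1 (lift ord_max j))//= (bigD1 ord_max) ?neq_lift//= big1 => [|k
    /andP[k1 k2]].
    rewrite !mxE !eqxx [lift _ _ == ord_max]eq_sym (negbTE (neq_lift _ _)) /=.
    by rewrite subr0 mul1r sub0r mulN1r addr0 => /eqP; rewrite subr_eq0 => /eqP.
  by rewrite !mxE (negbTE k1) (negbTE k2) !andFb subrr mul0r.
apply/matrixP => i j; rewrite ord1 centeringE [RHS]mxE.
under eq_bigr do rewrite gE.
rewrite sumr_const card_ord -[X in _ * X]mulr_natl mulrA mulVf ?pnatr_eq0// mul1r.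
by rewrite gE subrr.
Qed.

Context (A : 'cV[R]_m.+1) (p : R -> 'cV[R]_m.+1).
Hypothesis p_flow : gradient_flow mu Sigma lambda A p.
Hypothesis p_simplex : forall t, 0 <= t -> simplex (p t).

Definition flow_velocity (t : R) : 'cV[R]_m.+1 :=
  centering *m (mu - (2 * lambda) *: (Sigma *m p t)).

Let y i (t : R) := p t i 0 - B i 0.
Let yv (t : R) := p t - B.

Let yvE t i : yv t i 0 = y i t.
Proof. by rewrite /yv !mxE. Qed.

Let yv_tangent t : 0 <= t -> tangent (yv t).
Proof. by move=> t0; apply: simplex_tangent => //; exact: p_simplex. Qed.

(** The field vanishes at the target, so the velocity is linear in the deviation [y] and inherits
    its decay. *)
Lemma flow_velocityE t i : flow_velocity t i 0 =
  \sum_k (- (2 * lambda) * (centering *m Sigma) i k) * y k t.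
Proof.
have -> : flow_velocity t = - (2 * lambda) *: (centering *m Sigma *m yv t).
  rewrite /flow_velocity.
  have -> : mu - (2 * lambda) *: (Sigma *m p t) = g - (2 * lambda) *: (Sigma *m
    yv t).
    rewrite /g /yv mulmxBr scalerBr -addrA; congr (_ + _).
    by rewrite opprB addKr.
  by rewrite mulmxBr centering_grad sub0r -scalemxAr mulmxA scaleNr.
rewrite mxE [in LHS]mxE mulr_sumr; apply: eq_bigr => k _.
by rewrite yvE mulrA.
Qed.

Let y_C1 i : C1_deriv `[0, +oo[ (y i) (fun t => flow_velocity t i 0).
Proof.
have [_ /C1_deriv_mxP /(_ i 0) H] := p_flow.
have := C1_derivB H (C1_deriv_cst `[0, +oo[ (B i 0)).
by apply: eq_C1_deriv => // t _; rewrite subr0.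
Qed.

Let E (t : R) := \sum_i y i t * y i t.
Let dE (t : R) := \sum_i (y i t * flow_velocity t i 0 + y i t * flow_velocity t
  i 0).

Let E_C1 : C1_deriv `[0, +oo[ E dE.
Proof. by apply: C1_deriv_sum => i; exact: C1_derivM. Qed.

(** [E], the squared Euclidean distance to the target, is a Lyapunov function: against the tangent
    vector [yv t] the centering disappears, and the gradient [g] at the target contributes 0. *)
Let dE_eq t : 0 <= t -> dE t = - (4 * lambda) * qform Sigma (yv t).
Proof.
move=> t0; have ty := yv_tangent t0.
rewrite /dE big_split /=.
have -> : \sum_i y i t * flow_velocity t i 0 =
    \sum_i yv t i 0 * (centering *m (mu - (2 * lambda) *: (Sigma *m p t))) i 0.
  by apply: eq_bigr => i _; rewrite yvE.
rewrite tangent_dot_centering//.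
have -> : \sum_i yv t i 0 * (mu - (2 * lambda) *: (Sigma *m p t)) i 0 =
    \sum_i yv t i 0 * g i 0 - 2 * lambda * bilin Sigma (yv t) (yv t).
  rewrite bilinE mulr_sumr -sumrB; apply: eq_bigr => i _.
  rewrite [Sigma *m yv t]mulmxBr /g.
  rewrite [(mu - _) i 0]mxE [(- (_ *: (Sigma *m p t))) i 0]mxE [(_ *: (Sigma *m
    p t)) i 0]mxE.
  rewrite [(mu - _) i 0]mxE [(- (_ *: (Sigma *m B))) i 0]mxE [(_ *: (Sigma *m
    B)) i 0]mxE.
  by rewrite [(Sigma *m p t - _) i 0]mxE [(- (Sigma *m B)) i 0]mxE; ring.
rewrite first_order_condition// -[bilin _ _ _]/(qform Sigma (yv t)); ring.
Qed.

Let u1 (t : R) := 1 + t.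

Let u1_C1 : C1_deriv `[0, +oo[ u1 (fun=> 0 + 1 : R).
Proof. by apply: C1_derivD; [exact: C1_deriv_cst|exact: C1_deriv_id]. Qed.

(* Exponential decay holds, but this polynomial rate already makes the path C^1
   at infinity in the parameter t / (1 + t). *)
Lemma flow_decay : exists M T0 : R, 0 <= T0 /\ forall t, T0 <= t -> forall i,
  (y i t * (1 + t) ^+ 2) ^+ 2 <= M / (1 + t).
Proof.
have [S S0 HS] := sympd_tangent_coercive hS hB.
pose k := 4 * lambda / S; have k0 : 0 < k by rewrite divr_gt0// mulr_gt0.
(* Beyond [5 / k] the decay rate [k] of [E] outweighs the growth of [(1 + t) ^+ 5], whose
   logarithmic derivative is [5 / (1 + t)]. *)
pose T0 := 5 / k; have T00 : 0 <= T0 by rewrite divr_ge0// ltW.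
have Epos t : 0 <= E t by apply: sumr_ge0 => i _; rewrite -expr2 sqr_ge0.
have dEk t : 0 <= t -> dE t <= - k * E t.
  move=> t0; rewrite dE_eq// !mulNr lerN2 /k -[leLHS]mulrA -mulrA.
  rewrite -mulrA !ler_wpM2l ?(ltW hl)// ler_pdivrMl//.
  apply: le_trans (HS _ (yv_tangent t0)); apply: ler_sum => i _.
  by rewrite yvE expr2.
have u2 := C1_derivM u1_C1 u1_C1; have u4 := C1_derivM u2 u2.
(* Exponent 5: four for the square of the weight [(1 + t) ^+ 2], one more to force the limit 0. *)
pose F t := u1 t * u1 t * (u1 t * u1 t) * u1 t * E t.
pose dF t := u1 t ^+ 4 * (5 * E t + u1 t * dE t).
have F_C1 : C1_deriv `[0, +oo[ F dF.
  by apply: eq_C1_deriv (C1_derivM (C1_derivM u4 u1_C1) E_C1) => // t _;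
    rewrite /dF; ring.
have Fle t : T0 <= t -> F t <= F T0.
  move=> Tt; rewrite -lerN2 -mulN1r -[leRHS]mulN1r.
  have sub : `[T0, t]%classic `<=` `[0, +oo[%classic.
    by move=> s; rewrite /= !in_itv /= andbT => /andP[Ts _]; exact: le_trans Ts.
  have FN := C1_derivZ (-1) (C1_derivW sub F_C1).
  apply: (C1_deriv_ndecr FN) => // s /andP[Ts _].
  have s0 : 0 <= s := le_trans T00 (ltW Ts).
  have us : 0 < u1 s by rewrite /u1 ltr_wpDr.
  have -> : -1 * dF s = u1 s ^+ 4 * (- (5 * E s + u1 s * dE s)).
    by rewrite /dF; ring.
  rewrite mulr_ge0 ?exprn_ge0 ?(ltW us)// oppr_ge0.
  apply: (@le_trans _ _ (5 * E s + u1 s * (- k * E s))).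
    by rewrite lerD2l ler_wpM2l ?(ltW us)// dEk.
  have -> : 5 * E s + u1 s * (- k * E s) = (5 - k * u1 s) * E s by ring.
  rewrite mulr_le0_ge0// subr_le0 -ler_pdivrMl// mulrC -/T0 /u1.
  by rewrite (le_trans (ltW Ts))// lerDr.
exists (F T0), T0; split=> // t Tt i.
have t0 : 0 <= t := le_trans T00 Tt.
have ut : 0 < 1 + t by rewrite ltr_wpDr.
rewrite ler_pdivlMr//; apply: le_trans (Fle t Tt).
have -> : F t = (1 + t) ^+ 5 * E t by rewrite /F /u1; ring.
have -> : (y i t * (1 + t) ^+ 2) ^+ 2 * (1 + t) = (1 + t) ^+ 5 * (y i t * y i
  t) by ring.
rewrite ler_wpM2l ?exprn_ge0 ?(ltW ut)// /E (bigD1 i)//= lerDl.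
by apply: sumr_ge0 => j _; rewrite -expr2 sqr_ge0.
Qed.

Lemma flow_scaled_cvg i : y i t * (1 + t) ^+ 2 @[t --> +oo] --> (0 : R).
Proof.
have [M [T0 [T00 HM]]] := flow_decay.
apply/cvgr0Pnorm_le => e e0; near=> t.
have Tt : T0 <= t by near: t; apply: nbhs_pinfty_ge; exact: num_real.
have t0 : 0 <= t := le_trans T00 Tt.
have ut : 0 < 1 + t by rewrite ltr_wpDr.
rewrite -ler_sqr ?nnegrE ?(ltW e0)// real_normK ?num_real//.
apply: le_trans (HM t Tt i) _; rewrite ler_pdivrMr// -ler_pdivrMl ?exprn_gt0//.
apply: (@le_trans _ _ t); last by rewrite lerDr.
by near: t; apply: nbhs_pinfty_ge; exact: num_real.
Unshelve. all: by end_near. Qed.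

Lemma flow_cvg i : p t i 0 @[t --> +oo] --> B i 0.
Proof.
apply/cvgrPdist_le => e e0.
have /cvgr0Pnorm_le /(_ _ e0) := flow_scaled_cvg i.
have t_ge0 : \forall t \near +oo, (0 : R) <= t by exact: nbhs_pinfty_ge.
move=> H; near=> t; have t0 : 0 <= t by near: t.
have : `|y i t * (1 + t) ^+ 2| <= e by near: t; exact: H.
apply: le_trans; rewrite distrC -/(y i t) normrM ler_peMr// ger0_norm ?sqr_ge0//.
by rewrite -[leLHS](expr1n _ 2) ler_sqr ?nnegrE ?lerDl// addr_ge0.
Unshelve. all: by end_near. Qed.

Lemma flow_velocity_cvg i :
  flow_velocity t i 0 * (1 + t) ^+ 2 @[t --> +oo] --> (0 : R).
Proof.
pose a k := - (2 * lambda) * (centering *m Sigma) i k.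
have H : \sum_k a k * (y k t * (1 + t) ^+ 2) @[t --> +oo] --> \sum_k a k * 0.
  apply: cvg_bigsum => k; apply: cvgM; first exact: cvg_cst.
  exact: flow_scaled_cvg.
have a0 : \sum_k a k * 0 = 0 by rewrite big1// => k _; rewrite mulr0.
rewrite a0 in H; apply: cvg_trans H; apply: near_eq_cvg; apply: nearW => t.
by rewrite flow_velocityE mulr_suml; apply: eq_bigr => k _; rewrite mulrA.
Qed.

End GradientFlow.

(** * Minimality of geodesics *)

Section CompetingPaths.
Context {R : realType} {m : nat} (G : 'cV[R]_m.+1 -> 'M[R]_m.+1).
Hypothesis hG : risk_metric G.
Implicit Types (A B : 'cV[R]_m.+1).

Lemma straight_line_admissible A B : simplex A -> simplex B ->
  admissible A B (straight_line A B).
Proof.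
move=> sA sB.
have E j t : chart_coord (straight_line A B t) j =
    (1 - t) * chart_coord A j + t * chart_coord B j.
  by rewrite /straight_line chart_coordD !chart_coordZ.
have cx : chart_C1 0 1 (straight_line A B)
    (fun j _ => (0 - 1) * chart_coord A j + 1 * chart_coord B j).
  split=> [t /andP[t0 t1]|j].
    split=> [i|].
      rewrite !mxE; have [t_gt0|t_le0] := ltP 0 t.
        by rewrite ltr_wpDl ?mulr_ge0 ?mulr_gt0 ?subr_ge0 ?(ltW (sA.1 i))//
          (sB.1 i).
      have -> : t = 0 by apply/eqP; rewrite eq_le t_le0.
      by rewrite subr0 mul1r mul0r addr0; exact: sA.1.
    under eq_bigr do rewrite !mxE.
    by rewrite big_split /= -!mulr_sumr sA.2 sB.2 !mulr1 subrK.
  apply: (@eq_C1_deriv _ _ _ (fun t => chart_coord A j * (1 - t) + chart_coord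
    B j * t) _
      (fun=> chart_coord A j * (0 - 1) + chart_coord B j * 1)).
  - by move=> t _; rewrite E; ring.
  - by move=> t _; ring.
  apply: C1_derivD; apply: C1_derivZ; last exact: C1_deriv_id.
  by apply: C1_derivB; [exact: C1_deriv_cst|exact: C1_deriv_id].
have := chart_admissible cx.
by rewrite /straight_line subr0 subrr !scale0r !scale1r addr0 add0r.
Qed.

Section FlowPath.
Context (A B : 'cV[R]_m.+1) (p : R -> 'cV[R]_m.+1) (yd : 'I_m -> R -> R).
Hypothesis B_simplex : simplex B.
Hypothesis p_simplex : forall t, 0 <= t -> simplex (p t).
Hypothesis p0 : p 0 = A.
Hypothesis p_C1 : forall j, C1_deriv `[0, +oo[ (fun t => chart_coord (p t) j)
  (yd j).
Hypothesis p_cvg : forall j, chart_coord (p t) j @[t --> +oo] --> chart_coord B j.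
Hypothesis yd_cvg : forall j, yd j t * (1 + t) ^+ 2 @[t --> +oo] --> (0 : R).

Let chart := chart_C1_compactify p_simplex B_simplex p_C1 p_cvg yd_cvg.
Let sigma := speed G (compactify p B) (compact_velocity yd).

Lemma compactify0 : compactify p B 0 = A.
Proof. by rewrite /compactify ltr01 /to_halfline mul0r. Qed.

Lemma compactify1 : compactify p B 1 = B.
Proof. by rewrite /compactify ltxx. Qed.

Lemma compactify_admissible : admissible A B (compactify p B).
Proof. by rewrite -{1}compactify0 -{2}compactify1;
  exact: chart_admissible chart. Qed.

Lemma infinite_minimiser_geodesic :
  (forall c, admissible A B c -> (risk_infty G p <= risk G c)%E) ->
  geodesic_up_to_reparam_infty G p.
Proof.
move=> pmin.
have [|e [ge epos enull]] := C1_minimiser_geodesic hG chart.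
  move=> c; rewrite compactify0 compactify1.
  by rewrite -(risk_infty_compactify hG p_simplex B_simplex p_C1 p_cvg yd_cvg);
    exact: pmin.
have pE t : 0 <= t -> p t = compactify p B (of_halfline t).
  by move=> t0; rewrite compactify_of_halfline.
have k01 (t : R) : 0 <= t -> 0 <= of_halfline t <= 1.
  by move=> t0; have /andP[-> /ltW ->] := of_halfline_itv t0.
have k0 : of_halfline (0 : R) = 0 by rewrite /of_halfline mul0r.
have [L0|L0] := leP (prim 0 sigma 1) 0.
  (* With zero length there is nothing to normalise; [e] is constant on [[0, 1]], so any
     nondecreasing C^1 function from 0 to the limit 1 serves. *)
  exists e, (@of_halfline R); split.
  - exact: ge.
  - by exists (fun t => (1 + t) ^- 2); exact: of_halfline_C1.
  - move=> s t; rewrite !in_itv /= !andbT => s0 _; exact: of_halfline_ndecr.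
  - by split; [exact: k0|exact: of_halfline_cvg].
  - by move=> t t0; rewrite pE//; apply: (enull L0); exact: k01.
have L1 : prim 0 sigma 1 != 0 by rewrite gt_eqF.
have NC1 := halfline_length_C1 hG p_simplex B_simplex p_C1 p_cvg yd_cvg.
have Ncvg := halfline_length_cvg hG p_simplex B_simplex p_C1 p_cvg yd_cvg.
have cs := within_continuous_speed hG ler01 chart.
exists e, (fun t => prim 0 sigma (of_halfline t) / prim 0 sigma 1); split.
- exact: ge.
- exists (fun t => (prim 0 sigma 1)^-1 * speed G p yd t).
  by apply: eq_C1_deriv (C1_derivZ (prim 0 sigma 1)^-1 NC1) => t _;
    [rewrite mulrC|].
- move=> s t; rewrite !in_itv /= !andbT => s0 t0 st.
  rewrite ler_pM2r ?invr_gt0//.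
  have /andP[ks _] := k01 _ s0; have /andP[_ kt] := k01 _ t0.
  apply: (C1_deriv_ndecr (C1_deriv_prim ler01 cs) _ ks (of_halfline_ndecr s0
    st) kt) => u _.
  exact: speed_ge0.
- split; first by rewrite k0 prim_left mul0r.
  rewrite -[X in _ --> X](divff L1); apply: cvgM; first exact: Ncvg.
  exact: cvg_cst.
- by move=> t t0; rewrite pE//; apply: (epos L0); exact: k01.
Qed.

End FlowPath.
End CompetingPaths.

Theorem proposition2 (R : realType) (m : nat)
    (G : 'cV[R]_m.+1 -> 'M[R]_m.+1) (A B : 'cV[R]_m.+1)
    (p2 : R -> 'cV[R]_m.+1)
    (hG : risk_metric G) (hA : simplex A) (hB : simplex B)
    (hp2 : minimising_geodesic G A B p2) :
  [/\ (forall c, admissible A B c ->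
         (risk G p2 <= risk G c)%E),
      (forall (mu : 'cV[R]_m.+1) (Sigma : 'M[R]_m.+1) (lambda : R),
         sympd Sigma -> 0 < lambda -> markowitz_target mu Sigma lambda B ->
         (risk G p2 <= risk G (straight_line A B))%E /\
         (forall p1 : R -> 'cV[R]_m.+1,
            gradient_flow mu Sigma lambda A p1 ->
            (forall t : R, 0 <= t -> simplex (p1 t)) ->
            (risk G p2 <= risk_infty G p1)%E /\
            (~ geodesic_up_to_reparam_infty G p1 ->
             (risk G p2 < risk_infty G p1)%E))) &
      (forall c, admissible A B c -> ~ geodesic_up_to_reparam G c ->
         (risk G p2 < risk G c)%E)].
Proof.
have [adm2 min2] := hp2; split=> [//|mu Sigma lambda hS hl hT|c adm ngeo]; last first.
  rewrite ltNge; apply/negP => le_c; apply: ngeo.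
  apply: (admissible_minimiser_geodesic hG adm) => c' adm'.
  exact: le_trans le_c (min2 _ adm').
split; first by apply: min2; exact: straight_line_admissible.
move=> p flow ps.
have p_C1 j : C1_deriv `[0, +oo[ (fun t => chart_coord (p t) j)
    (fun t => chart_coord (flow_velocity mu Sigma lambda p t) j).
  by have [_ /C1_deriv_mxP] := flow; apply.
have p_cvg j : chart_coord (p t) j @[t --> +oo] --> chart_coord B j.
  exact: (flow_cvg hS hl hB hT flow ps).
have v_cvg j : chart_coord (flow_velocity mu Sigma lambda p t) j * (1 + t) ^+ 2
    @[t --> +oo] --> (0 : R).
  exact: (flow_velocity_cvg hS hl hB hT flow ps).
have p0 : p 0 = A by have [] := flow.
(* Convergence to [B] at a sufficient rate has been derived from the flow equation, so the
   compactified path is an admissible competitor and carries the improper risk of [p]. *)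
have riskE := risk_infty_compactify hG ps hB p_C1 p_cvg v_cvg.
have admc := compactify_admissible hB ps p0 p_C1 p_cvg v_cvg.
split=> [|ngeo]; first by rewrite riskE; exact: min2.
rewrite ltNge; apply/negP => le_p; apply: ngeo.
apply: (infinite_minimiser_geodesic hG hB ps p0 p_C1 p_cvg v_cvg) => c adm.
exact: le_trans le_p (min2 _ adm).
Qed.
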